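(* Let $R$ be an integral domain that is not a field, with complete integral closure $R^*$. Then the following are equivalent. (1) $R$ is a TAF-domain such that $R:R^*\neq (0)$. (2) $R$ is a Mori globalized pseudo-valuation domain. (3) There exist a Dedekind domain $T$, distinct maximal ideals $N_1,\dots,N_n$ of $T$ and field extensions $K_i\subseteq T/N_i$ ($1\le i\le n$) such that $R$ is the pullback domain $\pi^{-1}\bigl(\prod_{i=1}^n K_i\bigr)$, where $\pi:T\to\prod_{i=1}^n (T/N_i)$ is the canonical map. (4) $R^*$ is a Dedekind domain and $R/(R:R^* )\subseteq R^*/(R:R^* )$ is a unibranched extension of Artinian reduced rings.
   Context: All rings are commutative and unital. Let $R$ be an integral domain with quotient field $K$. For $R$-submodules $I,J$ of $K$, $I:J=\{x\in K\mid xJ\subseteq I\}$. An overring of $R$ is a ring $T$ with $R\subseteq T\subseteq K$. The complete integral closure $R^*$ is the set of $x\in K$ for which there is a nonzero $d\in R$ with $dx^n\in R$ for all $n\ge 1$. A proper ideal $I$ of a ring is 2-absorbing if $a_1a_2a_3\in I$ implies that one of $a_1a_2,\ a_1a_3,\ a_2a_3$ lies in $I$. A TAF-domain is an integral domain in which each proper ideal is a finite product of 2-absorbing ideals. $R$ is a Mori domain if it satisfies the ascending chain condition on divisorial ideals, i.e. ideals $I$ with $R:(R:I)=I$. A ring extension $R\subseteq T$ is unibranched if for each prime ideal $P$ of $R$ there is exactly one prime ideal $Q$ of $T$ with $Q\cap R=P$. A ring is reduced if its zero ideal is a radical ideal. $R$ is a globalized pseudo-valuation domain (GPVD) if there exists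 a Prüfer overring $T$ of $R$ (every localization of $T$ at a maximal ideal is a valuation domain) such that: (i) $R\subseteq T$ is unibranched; (ii) there exists a nonzero radical ideal $A$ common to $T$ and $R$ such that each prime ideal of $T$ (respectively, $R$) which contains $A$ is a maximal ideal of $T$ (respectively, $R$). *)

(* Defs.v *)
From HB Require Import structures.
From mathcomp Require Import all_boot all_order all_algebra.
From mathcomp Require Import boolp classical_sets.

Set Implicit Arguments.
Unset Strict Implicit.
Unset Printing Implicit Defensive.

Import GRing.Theory.
Local Open Scope classical_set_scope.
Local Open Scope ring_scope.

(* Rings occur as subrings S of an ambient commutative ring A, and ideals of S
   as subsets of A.  The zero ring is allowed: it does occur as a quotient. *)

Section Subrings.
Variable A : comPzRingType.
Implicit Types (S T I J P M : set A).

Definition subring S : Prop :=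
  [/\ S 1, forall x y, S x -> S y -> S (x - y)
    & forall x y, S x -> S y -> S (x * y)].

Definition ideal S I : Prop :=
  [/\ I `<=` S, I 0, forall x y, I x -> I y -> I (x + y)
    & forall s x, S s -> I x -> I (s * x)].

Definition proper_ideal S I : Prop := ideal S I /\ I <> S.

Definition prime_ideal S P : Prop :=
  proper_ideal S P /\
  forall a b, S a -> S b -> P (a * b) -> P a \/ P b.

Definition maximal_ideal S M : Prop :=
  proper_ideal S M /\
  forall J, ideal S J -> M `<=` J -> J = M \/ J = S.

Definition radical_ideal S I : Prop :=
  ideal S I /\ forall x n, S x -> I (x ^+ n) -> I x.

Definition reduced S : Prop := radical_ideal S [set 0].

Definition acc (C : set A -> Prop) : Prop :=
  forall I : nat -> set A,
    (forall n, C (I n)) -> (forall n, I n `<=` I n.+1) ->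
    exists N, forall n, (N <= n)%N -> I n = I N.

Definition dcc (C : set A -> Prop) : Prop :=
  forall I : nat -> set A,
    (forall n, C (I n)) -> (forall n, I n.+1 `<=` I n) ->
    exists N, forall n, (N <= n)%N -> I n = I N.

Definition noetherian S : Prop := acc (ideal S).
Definition artinian S : Prop := dcc (ideal S).

Definition ideal_mul I J : set A :=
  [set x | exists n (a b : 'I_n -> A),
     (forall i, I (a i) /\ J (b i)) /\ x = \sum_(i < n) a i * b i].

Definition ideal_prod S (s : seq (set A)) : set A := foldr ideal_mul S s.

Definition two_absorbing S I : Prop :=
  proper_ideal S I /\
  forall a b c, S a -> S b -> S c -> I (a * b * c) ->
    [\/ I (a * b), I (a * c) | I (b * c)].

(* That S is a domain is not part of the definition: it is only used for
   subrings of fields. *)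
Definition TAF S : Prop :=
  forall I, proper_ideal S I ->
    exists s : seq (set A),
      (forall J, J \in s -> two_absorbing S J) /\ I = ideal_prod S s.

Definition unibranched S T : Prop :=
  forall P, prime_ideal S P -> exists! Q, prime_ideal T Q /\ Q `&` S = P.

Definition subfield S : Prop :=
  subring S /\ forall x, S x -> x <> 0 -> exists2 y, S y & x * y = 1.

End Subrings.

Section SubringsOfFields.
Variable K : fieldType.
Implicit Types (R S T I J M V : set K).

Definition colon I J : set K := [set x | forall y, J y -> I (x * y)].

Definition quotient_field S : set K :=
  [set x | exists a b, [/\ S a, S b, b <> 0 & x = a / b]].

Definition complete_integral_closure R : set K :=
  [set x | exists d, [/\ R d, d <> 0
                       & forall n, (1 <= n)%N -> R (d * x ^+ n)]].

Definition integral_over S (x : K) : Prop :=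
  exists p : {poly K}, [/\ p \is monic, forall i, S p`_i & root p x].

Definition integrally_closed S : Prop :=
  forall x, quotient_field S x -> integral_over S x -> S x.

(* Fields are allowed. *)
Definition dedekind S : Prop :=
  [/\ subring S, noetherian S, integrally_closed S
    & forall P, prime_ideal S P -> P <> [set 0] -> maximal_ideal S P].

Definition divisorial_ideal R I : Prop :=
  ideal R I /\ colon R (colon R I) = I.

Definition mori R : Prop := acc (divisorial_ideal R).

Definition localization S P : set K :=
  [set x | exists a b, [/\ S a, S b, ~ P b & x = a / b]].

Definition valuation_domain V : Prop :=
  subring V /\
  forall x, quotient_field V x -> x <> 0 -> V x \/ V x^-1.

Definition prufer S : Prop :=
  subring S /\
  forall M, maximal_ideal S M -> valuation_domain (localization S M).

(* K is meant to be the quotient field of R, so that the overrings of R are the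
   subrings T of K containing R. *)
Definition gpvd R : Prop :=
  exists T : set K,
    [/\ prufer T, R `<=` T, unibranched R T
      & exists I : set K,
          [/\ I <> [set 0], radical_ideal T I, radical_ideal R I,
              forall Q, prime_ideal T Q -> I `<=` Q -> maximal_ideal T Q
            & forall P, prime_ideal R P -> I `<=` P -> maximal_ideal R P]].

End SubringsOfFields.

(* The ideal quotients of ring_quotient only cover proper ideals, hence never
   give the zero ring. *)
Section QuotientRing.
Variable A : comPzRingType.

Record ideal_of := IdealOf {
  ideal_set :> set A;
  ideal_ofP : ideal [set: A] ideal_set }.

Variable I : ideal_of.

Definition ideal_pred : {pred A} := fun x => `[< ideal_set I x >].

Lemma ideal_predP x : reflect (ideal_set I x) (x \in ideal_pred).
Proof. exact: asboolP. Qed.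

Lemma ideal_predM a x : x \in ideal_pred -> a * x \in ideal_pred.
Proof.
move=> /ideal_predP Ix; apply/ideal_predP.
by case: (ideal_ofP I) => _ _ _; apply.
Qed.

Lemma ideal_pred_zmod : zmod_closed ideal_pred.
Proof.
case: (ideal_ofP I) => _ I0 ID _; split; first exact/ideal_predP.
move=> x y /ideal_predP Ix yI; apply/ideal_predP/ID => //.
by apply/ideal_predP; rewrite -mulN1r; apply: ideal_predM.
Qed.

HB.instance Definition _ := GRing.isZmodClosed.Build A ideal_pred ideal_pred_zmod.

Definition quotient_ring : Type := Quotient.quot ideal_pred.

HB.instance Definition _ := GRing.Zmodule.on quotient_ring.

Definition quotient_map (x : A) : quotient_ring := (\pi_(Quotient.quot ideal_pred) x)%qT.

Lemma quotient_mapE x y : (quotient_map x = quotient_map y) <-> ideal_set I (x - y).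
Proof.
have -> : ideal_set I (x - y) <-> x - y \in ideal_pred by split => /ideal_predP.
rewrite Quotient.idealrBE; split => [/eqP|/eqP]; by [].
Qed.

Lemma quotient_mapD x y : quotient_map (x + y) = quotient_map x + quotient_map y.
Proof. by rewrite /quotient_map !piE. Qed.

Let lft (q : quotient_ring) : A := repr (q : Quotient.quot ideal_pred).
Let lftK q : quotient_map (lft q) = q. Proof. exact: reprK. Qed.

Definition quotient_one : quotient_ring := quotient_map 1.
Definition quotient_mul (p q : quotient_ring) : quotient_ring :=
  quotient_map (lft p * lft q).

Lemma quotient_mapM x y :
  quotient_map (x * y) = quotient_mul (quotient_map x) (quotient_map y).
Proof.
apply/quotient_mapE; set x' := lft _; set y' := lft _.
have Ix : x - x' \in ideal_pred by apply/ideal_predP/quotient_mapE; rewrite lftK.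
have Iy : y - y' \in ideal_pred by apply/ideal_predP/quotient_mapE; rewrite lftK.
have -> : x * y - x' * y' = y * (x - x') + x' * (y - y').
  by rewrite !mulrBr [y * x]mulrC [y * x']mulrC addrA subrK.
by apply/ideal_predP/rpredD; apply: ideal_predM.
Qed.

Lemma quotient_mulA : associative quotient_mul.
Proof.
by move=> x y z; rewrite -[x]lftK -[y]lftK -[z]lftK -!quotient_mapM mulrA.
Qed.

Lemma quotient_mulC : commutative quotient_mul.
Proof. by move=> x y; rewrite -[x]lftK -[y]lftK -!quotient_mapM mulrC. Qed.

Lemma quotient_mul1 : left_id quotient_one quotient_mul.
Proof. by move=> x; rewrite -[x]lftK -quotient_mapM mul1r. Qed.

Lemma quotient_mulDl : left_distributive quotient_mul +%R.
Proof.
move=> x y z; rewrite -[x]lftK -[y]lftK -[z]lftK.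
by rewrite -quotient_mapD -!quotient_mapM mulrDl quotient_mapD.
Qed.

HB.instance Definition _ := GRing.Zmodule_isComPzRing.Build quotient_ring
  quotient_mulA quotient_mulC quotient_mul1 quotient_mulDl.

End QuotientRing.

Section Domain.
Variable R : idomainType.

(* R as a subring of its quotient field *)
Definition dom : set {fraction R} := range (@tofrac R).

Lemma dom_subring : subring dom.
Proof.
split; first by exists 1; rewrite // rmorph1.
  by move=> _ _ [x _ <-] [y _ <-]; exists (x - y); rewrite // rmorphB.
by move=> _ _ [x _ <-] [y _ <-]; exists (x * y); rewrite // rmorphM.
Qed.

Definition cic : set {fraction R} := complete_integral_closure dom.

Definition cic_pred : {pred {fraction R}} := fun x => `[< cic x >].

Lemma cic_predP x : reflect (cic x) (x \in cic_pred).
Proof. exact: asboolP. Qed.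

(* The bound on n may be dropped. *)
Lemma cicE x : cic x <-> exists d, [/\ dom d, d <> 0 & forall n, dom (d * x ^+ n)].
Proof.
split=> -[d [dR d0 H]]; exists d; split=> // -[|n]; try exact: H.
by rewrite expr0 mulr1.
Qed.

Lemma cic_subring : GRing.subring_closed cic_pred.
Proof.
have [R1 RB RM] := dom_subring.
have R0 : dom 0 by rewrite -(subrr 1); apply: RB.
have RN x : dom x -> dom (- x) by move=> Rx; rewrite -sub0r; apply: RB.
have RD x y : dom x -> dom y -> dom (x + y).
  by move=> Rx Ry; rewrite -[y]opprK; apply/RB/RN.
have Rsum n (F : 'I_n -> {fraction R}) :
    (forall i, dom (F i)) -> dom (\sum_i F i) by move=> H; apply: big_ind.
have Rmuln x n : dom x -> dom (x *+ n).
  by move=> Rx; elim: n => [|n IH]; rewrite ?mulr0n // mulrS; apply: RD.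
split.
- apply/cic_predP/cicE; exists 1; split => [//||n]; first exact/eqP/oner_neq0.
  by rewrite expr1n mulr1.
- move=> x y /cic_predP/cicE[d [dR d0 dx]] /cic_predP/cicE[e [eR e0 ey]].
  apply/cic_predP/cicE; exists (d * e); split => [||n]; first exact: RM.
    by apply/eqP; rewrite mulf_neq0 //; apply/eqP.
  rewrite exprDn mulr_sumr; apply: Rsum => i.
  rewrite mulrnAr; apply: Rmuln; rewrite mulrACA; apply: RM => //.
  by rewrite exprNn mulrCA -signr_odd; case: odd; rewrite ?mulN1r ?mul1r //; apply: RN.
- move=> x y /cic_predP/cicE[d [dR d0 dx]] /cic_predP/cicE[e [eR e0 ey]].
  apply/cic_predP/cicE; exists (d * e); split => [||n]; first exact: RM.
    by apply/eqP; rewrite mulf_neq0 //; apply/eqP.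
  by rewrite exprMn mulrACA; apply: RM.
Qed.

HB.instance Definition _ :=
  GRing.isSubringClosed.Build {fraction R} cic_pred cic_subring.

Record cic_ring : Type := CicRing {
  cic_val :> {fraction R};
  cic_valP : cic_val \in cic_pred }.

HB.instance Definition _ := [isSub for cic_val].
HB.instance Definition _ := [Choice of cic_ring by <:].
HB.instance Definition _ := [SubChoice_isSubComNzRing of cic_ring by <:].

Definition conductor : set {fraction R} := colon dom cic.

Lemma conductor_ideal :
  ideal [set: cic_ring] [set x : cic_ring | conductor (cic_val x)].
Proof.
have [R1 RB RM] := dom_subring.
have cM (x y : cic_ring) : cic (cic_val x * cic_val y).
  by apply/cic_predP/rpredM; apply: cic_valP.
split=> // [y _|x y cx cy z cz|s x _ cx z cz].
- by rewrite mul0r -(subrr 1); apply: RB.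
- rewrite mulrDl -[cic_val y * z]opprK; apply: (RB); first exact: cx.
  by rewrite -[- _]sub0r -(subrr 1); apply: (RB); [apply: RB | apply: cy].
- rewrite -mulrA mulrCA; apply: cx.
  by apply/cic_predP/rpredM; [exact: cic_valP | apply/cic_predP].
Qed.

Definition cic_quotient : comPzRingType :=
  quotient_ring (IdealOf conductor_ideal).

(* R / (R : R^* ) as a subring of R^* / (R : R^* ): the classes of the elements
   of R. *)
Definition dom_quotient : set cic_quotient :=
  [set quotient_map (IdealOf conductor_ideal) x
     | x in [set x : cic_ring | dom (cic_val x)]].

End Domain.

Arguments dom : clear implicits.
Arguments cic : clear implicits.
Arguments conductor : clear implicits.
Arguments dom_quotient : clear implicits.

(* An embedding f identifies R with a subring of T. *)
Definition dedekind_pullback (R : idomainType) : Prop :=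
  exists (T : idomainType) (n : nat) (N : 'I_n -> ideal_of T)
         (k : forall i, set (quotient_ring (N i))) (f : {rmorphism R -> T}),
    let pi : T -> forall i, quotient_ring (N i) :=
      fun t i => quotient_map (N i) t in
    [/\ (0 < n)%N /\ dedekind (dom T),
        forall i, maximal_ideal [set: T] (N i),
        forall i j, i <> j -> (N i : set T) <> N j,
        forall i, subfield (k i)
      & injective f /\ range f = pi @^-1` [set x | forall i, k i (x i)]].

(* Main.v *)
(* All four conditions are compared with (3), read inside the quotient field:
   there are a Dedekind overring T of R and finitely many nonzero maximal ideals
   N of T such that R is the set of x \in T with residues in prescribed subfields
   K_N of the T / N. Then A = \bigcap N is a nonzero common ideal and T = R^*.

   (1) => (3). In a localization of R at a maximal ideal, with maximal ideal M,
   every nonzero 2-absorbing principal ideal contains M^2, which forces M = y V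
   for a discrete valuation ring V = M : M. Every nonzero 2-absorbing ideal of R
   contains a product of two maximal ideals, so R has finite character; together
   with R : R^* <> 0 this makes R^* a Dedekind domain with R : R^* as a radical
   ideal.
   (2) => (3). With F = R : T, the ideals F S, for S a finitely generated ideal
   of T, are divisorial in R and determine S, so the Mori property makes the
   Pruefer domain T Noetherian.
   (4) => (3). Unibranchedness makes the contractions to R of the maximal ideals
   of R^* over R : R^* pairwise comaximal, so R splits modulo R : R^*.
   (3) => (1). A 2-absorbing ideal between (N \cap R)^2 and N \cap R can be split
   off from any proper nonzero ideal I contained in N.
   (3) => (2). At each N, a chain of divisorial ideals with a constant extension
   to T jumps at most once. *)

From HB Require Import structures.
From mathcomp Require Import all_boot all_order all_algebra.
From mathcomp Require Import boolp classical_sets.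
From mathcomp Require Import ring.
Require Import Defs.

Set Implicit Arguments.
Unset Strict Implicit.
Unset Printing Implicit Defensive.

Import GRing.Theory.
Local Open Scope classical_set_scope.
Local Open Scope ring_scope.

(** * Ideals of subrings *)

(** Two obstacles shape the argument. The extensions T / N of K_N may be infinite, so R need not be
    Noetherian: finiteness is available for the ideals I T of T, not for the ideals I of R, and
    chains of ideals of R have to be compared with their extensions to T. In (1), on the other hand,
    localizing produces denominators that depend on the element. The way back to R is that c R, for
    c <> 0 in R, contains a product of maximal ideals; hence one u outside M and one k satisfy u x^k
    in c R for all x in M. The list of maximal ideals in (3) may be enlarged at will: at an unlisted
    N <> 0 the map R -> T / N is onto, so N can be listed with K_N = T / N. Ideals above and away
    from the conductor are thereby treated alike. The implications towards (3) end in one criterion: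
    a nonzero radical ideal I of T inside R suffices, provided that the maximal ideals of T over I
    have distinct contractions to R and that an element of R outside such an ideal has an inverse in
    R modulo it. *)

Section Ideals.
Variable A : comPzRingType.
Implicit Types (R S T I J L M N P X : set A).

(** Unlike in [ideal], no inclusion in S: the fractional ideals [colon T I] have to be covered. *)
Definition submodule S I : Prop :=
  [/\ I 0, forall x y, I x -> I y -> I (x + y)
    & forall s x, S s -> I x -> I (s * x)].

Section Subring.
Variable S : set A.
Hypothesis rS : subring S.

Lemma subring1 : S 1. Proof. by case: rS. Qed.
Lemma subringB x y : S x -> S y -> S (x - y). Proof. by case: rS => _ + _; apply. Qed.
Lemma subringM x y : S x -> S y -> S (x * y). Proof. by case: rS => _ _; apply. Qed.
Lemma subring0 : S 0. Proof. by rewrite -(subrr 1); apply: subringB; apply: subring1. Qed.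
Lemma subringN x : S x -> S (- x).
Proof. by move=> Sx; rewrite -sub0r; apply: subringB => //; apply: subring0. Qed.
Lemma subringD x y : S x -> S y -> S (x + y).
Proof. by move=> Sx Sy; rewrite -[y]opprK; apply/subringB/subringN. Qed.
Lemma subringX x n : S x -> S (x ^+ n).
Proof.
move=> Sx; elim: n => [|n IH]; first by rewrite expr0; apply: subring1.
by rewrite exprS; apply: subringM.
Qed.

Lemma submoduleN I x : submodule S I -> I x -> I (- x).
Proof.
by case=> _ _ IM Ix; rewrite -mulN1r; apply: IM => //; apply/subringN/subring1.
Qed.

Lemma submoduleB I x y : submodule S I -> I x -> I y -> I (x - y).
Proof. by move=> sI Ix Iy; case: (sI) => _ + _; apply=> //; apply: submoduleN. Qed.

Lemma submodule_id : submodule S S.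
Proof.
split; [exact: subring0|exact: subringD|exact: subringM].
Qed.

Lemma ideal_submodule I : ideal S I -> submodule S I.
Proof. by case. Qed.

Lemma ideal1 I : ideal S I -> I 1 -> I = S.
Proof.
move=> [IS _ _ IM] I1; apply/seteqP; split=> // x Sx.
by rewrite -[x]mulr1; apply: IM.
Qed.

Lemma proper_ideal1 I : ideal S I -> proper_ideal S I <-> ~ I 1.
Proof.
move=> idI; split=> [[_ IS] I1|I1]; first exact: IS (ideal1 idI I1).
by split=> // IS; apply: I1; rewrite IS; apply: subring1.
Qed.

Lemma ideal_self : ideal S S.
Proof. by case: submodule_id => S0 SD SM; split. Qed.

Lemma ideal0 : ideal S [set 0].
Proof.
split=> // [_ ->|_ _ -> ->|s _ _ ->] /=; first exact: subring0.
  by rewrite addr0.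
by rewrite mulr0.
Qed.

Definition ideal_gen I a : set A := [set x | exists2 i, I i & exists2 s, S s & x = i + s * a].

Lemma ideal_gen_ideal I a : ideal S I -> S a -> ideal S (ideal_gen I a).
Proof.
move=> [IS I0 ID IM] Sa; split.
- by move=> _ [i Ii [s Ss ->]]; apply/subringD/subringM => //; apply: IS.
- by exists 0 => //; exists 0; rewrite ?mul0r ?addr0 //; apply: subring0.
- move=> _ _ [i Ii [s Ss ->]] [j Ij [t St ->]]; exists (i + j); first exact: ID.
  by exists (s + t); [apply: subringD|ring].
- move=> r _ Sr [i Ii [s Ss ->]]; exists (r * i); first exact: IM.
  by exists (r * s); [apply: subringM|ring].
Qed.

Lemma ideal_gen_sub I a : I `<=` ideal_gen I a.
Proof. by move=> i Ii; exists i => //; exists 0; [exact: subring0|ring]. Qed.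

Lemma ideal_gen_mem I a : I 0 -> ideal_gen I a a.
Proof. by move=> I0; exists 0 => //; exists 1; [exact: subring1|ring]. Qed.

Lemma maximal_ideal1 M : maximal_ideal S M -> ~ M 1.
Proof. by case=> pM _; apply/proper_ideal1 => //; case: pM. Qed.

Lemma maximal_inv M x : maximal_ideal S M -> S x -> ~ M x ->
  exists2 y, S y & M (1 - x * y).
Proof.
move=> [[idM MS] maxM] Sx nMx.
have [] := maxM _ (ideal_gen_ideal idM Sx) (@ideal_gen_sub M x).
  move=> E; exfalso; apply: nMx; rewrite -E.
  by apply: ideal_gen_mem; case: idM.
move=> E; have : ideal_gen M x 1 by rewrite E; apply: subring1.
case=> m Mm [s Ss e]; exists s => //.
by rewrite e mulrC addrK.
Qed.

Lemma maximal_prime M : maximal_ideal S M -> prime_ideal S M.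
Proof.
move=> maxM; have [pM _] := maxM; split=> // a b Sa Sb Mab.
have [idM _] := pM; have [_ _ MD MM] := idM.
have [Ma|nMa] := pselect (M a); first by left.
have [y Sy My] := maximal_inv maxM Sa nMa; right.
have -> : b = b * (1 - a * y) + y * (a * b) by ring.
by apply: MD; apply: MM.
Qed.

Lemma maximal_eq M J : maximal_ideal S M -> ideal S J -> ~ J 1 -> M `<=` J -> J = M.
Proof.
move=> [_ maxM] idJ J1 MJ; have [//|E] := maxM _ idJ MJ.
by case: J1; rewrite E; apply: subring1.
Qed.

Lemma maximalP M : ideal S M -> ~ M 1 ->
  (forall x, S x -> ~ M x -> exists2 y, S y & M (1 - x * y)) -> maximal_ideal S M.
Proof.
move=> idM M1 H; split; first exact/proper_ideal1.
move=> J idJ MJ; have [JM|nJM] := pselect (J `<=` M); first by left; apply/seteqP.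
right; apply: ideal1 => //; move/existsNP: nJM => [x /not_implyP[Jx nMx]].
have [JS _ JD JM] := idJ.
have [y Sy /MJ My] := H x (JS _ Jx) nMx.
by rewrite -[1](subrK (x * y)); apply: JD => //; rewrite mulrC; apply: JM.
Qed.

Lemma max_ex I : ideal S I -> ~ I 1 -> exists2 M, maximal_ideal S M & I `<=` M.
Proof.
move=> idI I1.
have [IS I0 ID IM] := idI.
(* Adjoining I to X takes care of the empty chain, whose union is empty. *)
pose Q X := ideal S (I `|` X) /\ ~ (I `|` X) 1.
have [|X [[idX X1] maxX]] := @Zorn_bigcup _ Q.
  move=> F FQ totF; split; last first.
    by move=> [//|[X FX X1]]; case: (FQ _ FX) => _; apply; right.
  split.
  - move=> x [/IS//|[X FX Xx]]; have [[XS _ _ _] _] := FQ _ FX.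
    by apply: XS; right.
  - by left.
  - move=> x y [Ix|[X FX Xx]] [Iy|[Y FY Yy]]; first by left; apply: ID.
    + have [[_ _ YD _] _] := FQ _ FY.
      by case: (YD x y (or_introl Ix) (or_intror Yy)) => ?; [left|right; exists Y].
    + have [[_ _ XD _] _] := FQ _ FX.
      by case: (XD x y (or_intror Xx) (or_introl Iy)) => ?; [left|right; exists X].
    + have [/(_ x Xx) Yx|/(_ y Yy) Xy] := totF _ _ FX FY.
        have [[_ _ YD _] _] := FQ _ FY.
        by case: (YD x y (or_intror Yx) (or_intror Yy)) => ?; [left|right; exists Y].
      have [[_ _ XD _] _] := FQ _ FX.
      by case: (XD x y (or_intror Xx) (or_intror Xy)) => ?; [left|right; exists X].
  - move=> s x Ss [Ix|[X FX Xx]]; first by left; apply: IM.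
    have [[_ _ _ XM] _] := FQ _ FX.
    by case: (XM s x Ss (or_intror Xx)) => ?; [left|right; exists X].
exists (I `|` X); last by move=> x; left.
split; first exact/proper_ideal1.
move=> J idJ sJ; have [J1|J1] := pselect (J 1); first by right; apply: ideal1.
left; apply/seteqP; split=> //; apply/not_notP => nJ.
have IJ : I `|` J = J by apply/seteqP; split=> [x [Ix|//]|x]; [apply: sJ; left|right].
apply: (maxX J); last by rewrite /Q IJ.
split; first by move=> x Xx; apply: sJ; right.
by move=> JX; apply: nJ => x /JX; right.
Qed.

(** Each M in s contributes a factor x y, with x in M outside N and y an inverse of x modulo N. *)
Lemma max_avoid N (s : seq (set A)) : maximal_ideal S N ->
  (forall M, M \in s -> maximal_ideal S M) -> N \notin s ->
  exists e, [/\ S e, N (1 - e) & forall M, M \in s -> M e].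
Proof.
move=> mN; have [[idN _] _] := mN; have [NS N0 ND NM] := idN.
elim: s => [|M s IH] mS; first by exists 1; rewrite subrr; split=> //; apply: subring1.
rewrite inE negb_or => /andP[neNM Ns].
have [|//|e [Se Ne He]] := IH; first by move=> M' M's; apply: mS; rewrite inE M's orbT.
have mM : maximal_ideal S M by apply: mS; rewrite inE eqxx.
have [[idM _] _] := mM; have [MS M0 MD MM] := idM.
have : ~ (M `<=` N).
  move=> MN; have := maximal_eq mM idN (maximal_ideal1 mN) MN.
  by move=> E; rewrite E eqxx in neNM.
move=> /existsNP[x /not_implyP[Mx nNx]].
have [y Sy Ny] := maximal_inv mN (MS _ Mx) nNx.
have Sxy : S (x * y) by apply: subringM => //; apply: MS.
exists (e * (x * y)); split.
- by apply: subringM.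
- have -> : 1 - e * (x * y) = (1 - e) + e * (1 - x * y) by ring.
  by apply: ND => //; apply: NM.
- move=> M'; rewrite inE => /orP[/eqP->|M's]; first by rewrite mulrCA mulrC; apply: (MM) => //; apply: subringM.
  have [|[[_ _ _ M'M] _] _] := mS M'; first by rewrite inE M's orbT.
  by rewrite mulrC; apply: M'M => //; apply: He.
Qed.

End Subring.

Lemma ideal_mul_in I J a b : I a -> J b -> ideal_mul I J (a * b).
Proof.
move=> Ia Jb; exists 1%N, (fun=> a), (fun=> b); split=> //.
by rewrite big_ord1.
Qed.

(** This is how invertibility is used: an additive property of z that holds at the products a * b
    with a in I and b in [colon T I] holds at 1, without expanding 1 as a sum. *)
Lemma ideal_mul_ind I J X : X 0 -> (forall x y, X x -> X y -> X (x + y)) ->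
  (forall a b, I a -> J b -> X (a * b)) -> ideal_mul I J `<=` X.
Proof.
move=> X0 XD XM _ [n [a [b [H ->]]]]; apply: big_ind => // i _.
by apply: XM; case: (H i).
Qed.

Lemma ideal_mul0 I J : ideal_mul I J 0.
Proof.
exists 0%N, (fun=> 0), (fun=> 0); split; first by case.
by rewrite big_ord0.
Qed.

Lemma ideal_mulD I J x y : ideal_mul I J x -> ideal_mul I J y -> ideal_mul I J (x + y).
Proof.
move=> [n [a [b [H ->]]]] [m [c [d [H' ->]]]].
exists (n + m)%N, (fun i => match split i with inl j => a j | inr j => c j end),
  (fun i => match split i with inl j => b j | inr j => d j end); split.
  by move=> i; case: (split i).
rewrite big_split_ord; congr (_ + _); apply: eq_bigr => i _.
  by rewrite -[lshift _ _]/(unsplit (inl _)) unsplitK.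
by rewrite -[rshift _ _]/(unsplit (inr _)) unsplitK.
Qed.

Lemma ideal_mulC I J : ideal_mul I J = ideal_mul J I.
Proof.
by apply/seteqP; split; apply: ideal_mul_ind;
  [exact: ideal_mul0|exact: ideal_mulD|move=> a b Ia Jb; rewrite mulrC; apply: ideal_mul_in
  |exact: ideal_mul0|exact: ideal_mulD|move=> a b Ia Jb; rewrite mulrC; apply: ideal_mul_in].
Qed.

Lemma ideal_mulS I J I' J' : I `<=` I' -> J `<=` J' -> ideal_mul I J `<=` ideal_mul I' J'.
Proof.
move=> sI sJ; apply: ideal_mul_ind; [exact: ideal_mul0|exact: ideal_mulD|].
by move=> a b /sI Ia /sJ Jb; apply: ideal_mul_in.
Qed.

Lemma ideal_mulA I J L : ideal_mul I (ideal_mul J L) = ideal_mul (ideal_mul I J) L.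
Proof.
have Hsub : forall I J L, ideal_mul I (ideal_mul J L) `<=` ideal_mul (ideal_mul I J) L.
  move=> {}I {}J {}L; apply: ideal_mul_ind; [exact: ideal_mul0|exact: ideal_mulD|].
  move=> a b Ia; move: b.
  apply: (@ideal_mul_ind _ _ [set b | ideal_mul (ideal_mul I J) L (a * b)]) => /=.
  - by rewrite mulr0; apply: ideal_mul0.
  - by move=> x y Hx Hy; rewrite mulrDr; apply: ideal_mulD.
  - by move=> b c Jb Lc; rewrite mulrA; apply: ideal_mul_in => //; apply: ideal_mul_in.
apply/seteqP; split; first exact: Hsub.
by rewrite ideal_mulC (ideal_mulC I) (ideal_mulC I) (ideal_mulC J L); apply: Hsub.
Qed.

Lemma ideal_mul_submodule S I J : submodule S I -> submodule S (ideal_mul I J).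
Proof.
move=> [_ _ IM]; split; [exact: ideal_mul0|exact: ideal_mulD|].
move=> s x Ss; move: x.
apply: (@ideal_mul_ind _ _ [set x | ideal_mul I J (s * x)]) => /=.
- by rewrite mulr0; apply: ideal_mul0.
- by move=> x y Hx Hy; rewrite mulrDr; apply: ideal_mulD.
- by move=> a b Ia Jb; rewrite mulrA; apply: ideal_mul_in => //; apply: IM.
Qed.

Lemma ideal_mul_ideal S I J : subring S -> ideal S I -> ideal S J -> ideal S (ideal_mul I J).
Proof.
move=> rS idI idJ.
have [sub0 subD subM] := ideal_mul_submodule J (ideal_submodule idI).
split=> //.
apply: ideal_mul_ind; [exact: subring0|exact: subringD|].
by case: idI idJ => IS _ _ _ [JS _ _ _] a b /IS Sa /JS Sb; apply: subringM.
Qed.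

Lemma ideal_meet R T N : subring R -> R `<=` T -> ideal T N -> ideal R (N `&` R).
Proof.
move=> rR RT [NT N0 ND NM]; split=> [x []//||x y [Nx Rx] [Ny Ry]|x y Rx [Ny Ry]].
- by split=> //; apply: subring0.
- by split; [apply: ND|apply: subringD].
- by split; [apply: NM => //; apply: RT|apply: subringM].
Qed.

Lemma prime_meet R T P : subring R -> subring T -> R `<=` T ->
  prime_ideal T P -> prime_ideal R (P `&` R).
Proof.
move=> rR rT RT [[idP PT] primeP]; have idPR := ideal_meet rR RT idP.
split; first by apply/(proper_ideal1 rR idPR) => -[/(ideal1 idP)].
by move=> x y Rx Ry [/(primeP _ _ (RT _ Rx) (RT _ Ry)) [] ? _]; [left|right].
Qed.

Lemma ideal_extend R T I : subring T -> R `<=` T -> ideal R I -> ideal T (ideal_mul T I).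
Proof.
move=> rT RT [IR _ _ _]; have [H1 H2 H3] := ideal_mul_submodule I (submodule_id rT).
split=> //; apply: ideal_mul_ind; [exact: subring0|exact: subringD|].
by move=> a b Ta /IR/RT; apply: subringM.
Qed.

Lemma sub_ideal_extend T I : subring T -> I `<=` ideal_mul T I.
Proof.
by move=> rT y Iy; rewrite -[y]mul1r; apply: ideal_mul_in => //; apply: subring1.
Qed.

Lemma ideal_mul_subr S I J : ideal S J -> I `<=` S -> ideal_mul I J `<=` J.
Proof.
move=> [_ J0 JD JM] IS; apply: ideal_mul_ind => // a b /IS Sa Jb; exact: JM.
Qed.

Lemma ideal_mul_subl S I J : ideal S I -> J `<=` S -> ideal_mul I J `<=` I.
Proof. by rewrite ideal_mulC; apply: ideal_mul_subr. Qed.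

Lemma ideal_mul1 S I : subring S -> submodule S I -> ideal_mul S I = I.
Proof.
move=> rS sI; apply/seteqP; split.
  by case: sI => I0 ID IM; apply: ideal_mul_ind.
by move=> x Ix; rewrite -[x]mul1r; apply: ideal_mul_in => //; apply: subring1.
Qed.

Lemma ideal_prod_ideal S s : subring S -> (forall J, J \in s -> ideal S J) ->
  ideal S (ideal_prod S s).
Proof.
move=> rS; elim: s => [|J s IH] H /=; first exact: ideal_self.
apply: ideal_mul_ideal => //; first by apply: H; rewrite inE eqxx.
by apply: IH => L Ls; apply: H; rewrite inE Ls orbT.
Qed.

Lemma ideal_prod_rem S s J : J \in s ->
  ideal_prod S s = ideal_mul J (ideal_prod S (rem J s)).
Proof.
elim: s => //= L s IH; rewrite inE; case: eqVneq => [->//|neJL /= /IH ->] /=.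
by rewrite !ideal_mulA (ideal_mulC L).
Qed.

Lemma ideal_prod_cat S s t : subring S -> (forall J, J \in t -> ideal S J) ->
  ideal_prod S (s ++ t) = ideal_mul (ideal_prod S s) (ideal_prod S t).
Proof.
move=> rS H; elim: s => [|J s IH] /=; last by rewrite IH ideal_mulA.
by rewrite ideal_mul1 //; apply/ideal_submodule/ideal_prod_ideal.
Qed.

Lemma prime_mul S P I J : prime_ideal S P -> I `<=` S -> J `<=` S ->
  ideal_mul I J `<=` P -> I `<=` P \/ J `<=` P.
Proof.
move=> [_ pP] IS JS sP; have [|/existsNP[a /not_implyP[Ia nPa]]] := pselect (I `<=` P); first by left.
right=> b Jb; have [] := pP a b (IS _ Ia) (JS _ Jb); try by [].
by apply: sP; apply: ideal_mul_in.
Qed.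

Lemma prime_prod S P s : subring S -> prime_ideal S P -> (forall J, J \in s -> ideal S J) ->
  ideal_prod S s `<=` P -> exists2 J, J \in s & J `<=` P.
Proof.
move=> rS pP; elim: s => [|J s IH] H /=.
  move=> SP; case: pP => -[idP nP] _; exfalso; apply: nP; apply: ideal1 => //.
  by apply: SP; apply: subring1.
have Hs L : L \in s -> ideal S L by move=> Ls; apply: H; rewrite inE Ls orbT.
have idJ : ideal S J by apply: H; rewrite inE eqxx.
move=> /(prime_mul pP) [|||/(IH Hs)[L Ls LP]].
- by case: idJ.
- by case: (ideal_prod_ideal rS Hs).
- by exists J; rewrite ?inE ?eqxx.
- by exists L; rewrite // inE Ls orbT.
Qed.

(** Noetherian induction: every counterexample has a strictly larger one, and iterating a choice of
    it contradicts the chain condition. *)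
Lemma acc_ind (C Q : set A -> Prop) : acc C ->
  (forall I, C I -> (forall J, C J -> I `<` J -> Q J) -> Q I) -> forall I, C I -> Q I.
Proof.
move=> accC H I0 CI0; apply: contrapT => nQ0.
pose D := {I : set A | C I /\ ~ Q I}.
have next (d : D) : {e : D | sval d `<` sval e}.
  apply: cid; case: d => I [CI nQI] /=.
  apply: contrapT => nex; apply: nQI; apply: H => // J CJ IJ.
  apply: contrapT => nQJ; apply: nex.
  by exists (exist _ J (conj CJ nQJ)).
pose d0 : D := exist _ I0 (conj CI0 nQ0).
pose f n := iter n (fun d => sval (next d)) d0.
have [|n|N HN] := accC (fun n => sval (f n)).
- by move=> n; case: (svalP (f n)).
- by have [] := svalP (next (f n)).
have /= E := HN N.+1 (leqnSn N); have [_ h2] := svalP (next (f N)).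
by apply: h2 => x; rewrite E.
Qed.

End Ideals.

(** * Dedekind domains and invertible ideals *)

Section Dedekind.
Variable K : fieldType.
Implicit Types (S T I J L M N P X : set K).

Definition invertible T I : Prop := ideal_mul I (colon T I) 1.

(* Equivalent to [dedekind]; unlike integral closedness, it is easy to transfer
   along embeddings. *)
Definition ded T : Prop :=
  subring T /\ forall I, ideal T I -> I <> [set 0] -> invertible T I.

Definition compl_int_closed T : Prop :=
  forall d x, T d -> d <> 0 -> (forall n, T (d * x ^+ n)) -> T x.

Lemma set_nz I : I 0 -> I <> [set 0] -> exists2 x, I x & x <> 0.
Proof.
move=> I0 nI; apply: contrapT => H; apply: nI; apply/seteqP; split=> [x Ix|_ ->//].
by apply: contrapT => x0; apply: H; exists x.
Qed.

Lemma nz_set I x : I x -> x <> 0 -> I <> [set 0].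
Proof. by move=> Ix x0 E; apply: x0; rewrite E in Ix. Qed.

Lemma colon_submodule T I : subring T -> submodule T (colon T I).
Proof.
move=> rT; split.
- by move=> y _; rewrite mul0r; apply: subring0.
- by move=> x y Hx Hy z Iz; rewrite mulrDl; apply: subringD => //; [apply: Hx|apply: Hy].
- by move=> s x Ts Hx y Iy; rewrite -mulrA; apply: subringM => //; apply: Hx.
Qed.

Lemma colon_mul_ideal T I J : subring T -> ideal T I -> I `<=` J ->
  ideal T (ideal_mul I (colon T J)).
Proof.
move=> rT idI IJ; have [H1 H2 H3] := ideal_mul_submodule (colon T J) (ideal_submodule idI).
split=> //; apply: ideal_mul_ind; [exact: subring0|exact: subringD|].
by move=> a b /IJ Ja Hb; rewrite mulrC; apply: Hb.
Qed.

Section Ded.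
Variable T : set K.
Hypothesis dT : ded T.
Let rT : subring T := proj1 dT.

Lemma ded_inv I x : ideal T I -> I x -> x <> 0 -> ideal_mul I (colon T I) 1.
Proof. by move=> idI Ix x0; apply: (proj2 dT) => //; apply: nz_set Ix x0. Qed.

(** The ideal I of all t with t x^n in T for every n is stable under x. Expanding 1 in I (T : I)
    makes x a sum of terms b (a x) with a x in I and b in T : I. *)
Lemma ded_cic : compl_int_closed T.
Proof.
move=> d x Td d0 H.
pose I := [set t | T t /\ forall n, T (t * x ^+ n)].
have idI : ideal T I.
  split=> [t []//||s t [Ts Hs] [Tt Ht]|s t Ts [Tt Ht]].
  - by split=> [|n]; rewrite ?mul0r; apply: subring0.
  - by split=> [|n]; rewrite ?mulrDl; apply: subringD.
  - by split=> [|n]; rewrite -?mulrA; apply: subringM.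
have := ded_inv idI (conj Td H) d0.
suff /[apply] : ideal_mul I (colon T I) `<=` [set z | T (z * x)] by rewrite /= mul1r.
apply: ideal_mul_ind => /= [|a b Ha Hb|a b [Ta Ha] Hb].
- by rewrite mul0r; apply: subring0.
- by rewrite mulrDl; apply: subringD.
- have -> : a * b * x = b * (a * x) by ring.
  apply: Hb; split=> [|n]; first by rewrite -[x]expr1; apply: Ha.
  by rewrite -mulrA -exprS; apply: Ha.
Qed.

(** For y outside P let B = P + y T. If c is in T : B, then c P is inside P, since (c p) y = p (c y)
    is in P; so c^n x is in T for all n and c is in T. Invertibility of B now gives 1 in B. *)
Lemma ded_prime_maximal P x : prime_ideal T P -> P x -> x <> 0 -> maximal_ideal T P.
Proof.
move=> pP Px x0; have [[idP PT] primeP] := pP; have [PS P0 PD PM] := idP.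
apply: maximalP => //; first by apply/(proper_ideal1 rT idP).
move=> y Ty nPy.
have idB := ideal_gen_ideal rT idP Ty; set B := ideal_gen T P y in idB.
have By : B y by apply: ideal_gen_mem.
have PB : P `<=` B by apply: ideal_gen_sub.
have y0 : y <> 0 by move=> E; apply: nPy; rewrite E.
have cT c : colon T B c -> T c.
  move=> Hc.
  have cP p : P p -> P (c * p).
    move=> Pp; have [] := primeP (c * p) y => //; first by apply: Hc; apply: PB.
    by rewrite -mulrA mulrCA mulrC; apply: PM => //; apply: Hc.
  apply: (@ded_cic x); [exact: PS|exact: x0|] => n; apply: PS.
  elim: n => [|n IH]; first by rewrite expr0 mulr1.
  by rewrite exprS mulrCA; apply: cP.
have [B_T B0 BD BM] := idB.
have := ded_inv idB By y0.
suff /[apply] -[p Pp [s Ts ->]] : ideal_mul B (colon T B) `<=` B.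
  by exists s => //; rewrite (mulrC y) addrK.
by apply: ideal_mul_ind => // a b Ba /cT Tb; rewrite mulrC; apply: BM.
Qed.

(** The elements of the union U in an expansion of 1 in U (T : U) lie in a single I k, which then
    contains U. *)
Lemma ded_noetherian : noetherian T.
Proof.
move=> I idI mI.
have mono m n : (m <= n)%N -> I m `<=` I n.
  elim: n => [|n IH]; first by rewrite leqn0 => /eqP->.
  by rewrite leq_eqVlt => /orP[/eqP->//|/IH H x /H]; apply: mI.
pose U := [set x | exists n, I n x].
suff [k Hk] : exists k, U `<=` I k.
  exists k => n kn; apply/seteqP; split; last exact: mono.
  by move=> x Ix; apply: Hk; exists n.
have idU : ideal T U.
  split=> [x [n]||x y [m Hx] [n Hy]|s x Ts [n Hx]].
  - by case: (idI n) => IT _ _ _; apply: IT.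
  - by exists 0%N; case: (idI 0%N).
  - exists (maxn m n); case: (idI (maxn m n)) => _ _ ID _; apply: ID.
      exact: mono (leq_maxl _ _) _ Hx.
    exact: mono (leq_maxr _ _) _ Hy.
  - by exists n; case: (idI n) => _ _ _; apply.
have [E|/(proj2 dT _ idU)] := pselect (U = [set 0]).
  by exists 0%N => x; rewrite E => ->; case: (idI 0%N).
suff /[apply] : ideal_mul U (colon T U) `<=` [set z | exists k, forall x, U x -> I k (z * x)].
  by move=> /= [k Hk]; exists k => x /Hk; rewrite mul1r.
apply: ideal_mul_ind => /=.
- by exists 0%N => x _; rewrite mul0r; case: (idI 0%N).
- move=> x y [m Hm] [n Hn]; exists (maxn m n) => z Uz.
  rewrite mulrDl; case: (idI (maxn m n)) => _ _ ID _; apply: ID.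
    exact: mono (leq_maxl _ _) _ (Hm _ Uz).
  exact: mono (leq_maxr _ _) _ (Hn _ Uz).
- move=> a b [n Ia] Hb; exists n => x Ux; rewrite -mulrA mulrC.
  by case: (idI n) => _ _ _; apply=> //; apply: Hb.
Qed.

Lemma compl_int_closed_integrally_closed : integrally_closed T.
Proof.
move=> x [a [b [Ta Tb b0 ->]]] [p [monp Hp]] /rootP rp.
have [m Em] : exists m, size p = m.+1.
  by exists (size p).-1; rewrite prednK // size_poly_gt0 monic_neq0.
set y := a / b in rp *.
have bn n : T (b ^+ n) by apply: subringX.
have by1 : b * y = a by rewrite /y mulrCA divff ?mulr1 //; apply/eqP.
have ym : y ^+ m = - \sum_(i < m) p`_i * y ^+ i.
  have := rp; rewrite horner_coef Em big_ord_recr /=.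
  have -> : p`_m = 1 by move/monicP: monp; rewrite lead_coefE Em.
  by rewrite mul1r addrC => /eqP; rewrite addr_eq0 => /eqP.
(* b^m clears the denominators of y^i for i < m, and the monic equation reduces all higher powers to
   these. *)
have H n : forall i, (i < m)%N -> T (b ^+ m * y ^+ (n + i)).
  elim: n => [|n IH] i im.
    rewrite add0n -[X in b ^+ X](subnK (ltnW im)) exprD -mulrA -exprMn by1.
    by apply: (subringM) => //; apply: subringX.
  rewrite addSnnS; case: (ltnP i.+1 m) => im1; first exact: IH.
  have -> : (n + i.+1 = m + n)%N by rewrite addnC; congr (_ + _)%N; apply/eqP; rewrite eqn_leq im.
  rewrite exprD ym mulNr mulrN mulr_suml mulr_sumr.
  apply: (subringN) => //; apply: (big_ind T) => [||j _]; [exact: subring0|exact: subringD|].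
  have -> : b ^+ m * (p`_j * y ^+ j * y ^+ n) = p`_j * (b ^+ m * y ^+ (n + j)).
    by rewrite exprD; ring.
  by apply: subringM => //; apply: IH.
apply: (@ded_cic (b ^+ m)) => // [|n]; first by apply/eqP/expf_neq0/eqP.
case: m Em ym H => [|m] Em ym H; last by rewrite -[n]addn0; apply: H.
by have := ym; rewrite big_ord0 oppr0 expr0 => /eqP; rewrite oner_eq0.
Qed.

Lemma ded_dedekind : dedekind T.
Proof.
split; [exact: rT|exact: ded_noetherian|exact: compl_int_closed_integrally_closed|].
move=> P pP P0; have [x Px x0] : exists2 x, P x & x <> 0.
  by apply: set_nz => //; case: pP => -[[]].
exact: ded_prime_maximal pP Px x0.
Qed.

Lemma maximal_nsq N : maximal_ideal T N -> N <> [set 0] ->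
  exists2 y, N y & ~ ideal_mul N N y.
Proof.
move=> mN N0; have [[idN _] _] := mN; have [NT _ ND NM] := idN.
apply: contrapT => H.
have NN x : N x -> ideal_mul N N x.
  by move=> Nx; apply: contrapT => nx; apply: H; exists x.
apply: (maximal_ideal1 rT mN).
have invN := proj2 dT _ idN N0; apply: (ideal_mul_ind (X := N)) invN => [||a b /NN Na Hb].
- by case: idN.
- by [].
move: {Na} a (Na : ideal_mul N N a); apply: (ideal_mul_ind (X := [set a | N (a * b)])) => /=.
- by rewrite mul0r; case: idN.
- by move=> x y Hx Hy; rewrite mulrDl; apply: ND.
- by move=> x y Nx Ny; rewrite -mulrA mulrC; apply: NM => //; rewrite mulrC; apply: Hb.
Qed.

(** At N, the ideal N is generated by y. The witness is s = y c with c in T : N; if all of these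
    were in N, then y, an element of y N (T : N), would be in N^2. *)
Lemma maximal_nsq_factor N y : maximal_ideal T N -> N y -> ~ ideal_mul N N y ->
  exists s, [/\ T s, ~ N s & forall x, N x -> exists2 t, T t & s * x = y * t].
Proof.
move=> mN Ny nNy; have [[idN _] _] := mN; have [NT _ ND NM] := idN.
have y0 : y <> 0 by move=> E; apply: nNy; rewrite E; apply: ideal_mul0.
apply: contrapT => H.
have Hc c : colon T N c -> N (y * c).
  move=> Hc; apply: contrapT => nN; apply: H; exists (y * c); split=> //.
    by rewrite mulrC; apply: Hc.
  by move=> x Nx; exists (c * x); [apply: Hc|ring].
apply: nNy; rewrite -[y]mulr1.
apply: (ideal_mul_ind (X := [set z | ideal_mul N N (y * z)])) (ded_inv idN Ny y0) => /=.
- by rewrite mulr0; apply: ideal_mul0.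
- by move=> a b Ha Hb; rewrite mulrDr; apply: ideal_mulD.
- move=> a b Na /Hc Nb; have -> : y * (a * b) = a * (y * b) by ring.
  exact: ideal_mul_in.
Qed.

End Ded.

Lemma noetherian_prod_primes T I : subring T -> noetherian T -> ideal T I ->
  I <> [set 0] ->
  exists2 s, (forall P, P \in s -> prime_ideal T P /\ I `<=` P) & ideal_prod T s `<=` I.
Proof.
move=> rT nT; move: I; apply: (acc_ind (Q := fun I => I <> [set 0] ->
  exists2 s, (forall P, P \in s -> prime_ideal T P /\ I `<=` P) & ideal_prod T s `<=` I) nT).
move=> I idI IH I0.
have [I1|I1] := pselect (I 1).
  by exists [::] => //=; rewrite (ideal1 idI I1).
have [pI|npI] := pselect (prime_ideal T I).
  exists [:: I]; first by move=> P; rewrite inE => /eqP->; split.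
  by move=> x /=; rewrite ideal_mulC ideal_mul1 //; apply: ideal_submodule.
have [a [b [Ta Tb Iab nIa nIb]]] : exists a b, [/\ T a, T b, I (a * b), ~ I a & ~ I b].
  apply: contrapT => H; apply: npI; split; first exact/(proper_ideal1 rT idI).
  move=> a b Ta Tb Iab; have [|nIa] := pselect (I a); [by left|right].
  by apply: contrapT => nIb; apply: H; exists a, b.
have gI c : T c -> ~ I c -> exists2 s, (forall P, P \in s -> prime_ideal T P /\ I `<=` P)
   & ideal_prod T s `<=` ideal_gen T I c.
  move=> Tc nIc; have Ig : I `<=` ideal_gen T I c by apply: ideal_gen_sub.
  have [||x Ix x0] := @set_nz I => //; first by case: idI.
  have [|||s Hs sI] := IH (ideal_gen T I c); first exact: ideal_gen_ideal.
  - by split=> // H; apply: nIc; apply: H; apply: ideal_gen_mem => //; case: idI.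
  - by apply: (nz_set (x := x)) => //; apply: Ig.
  by exists s => // P /Hs[pP IP]; split=> //; apply: subset_trans IP.
have [s Hs sI] := gI _ Ta nIa; have [t Ht tI] := gI _ Tb nIb.
exists (s ++ t); first by move=> P; rewrite mem_cat => /orP[/Hs|/Ht].
have [IT Iz ID IM] := idI.
rewrite ideal_prod_cat //; last by move=> J /Ht[[[]]].
apply: subset_trans (ideal_mulS sI tI) _; apply: ideal_mul_ind => //.
move=> _ _ [i Ii [u Tu ->]] [j Ij [v Tv ->]].
have -> : (i + u * a) * (j + v * b) = j * i + ((v * b) * i + ((u * a) * j + (u * v) * (a * b))).
  by ring.
apply: (ID); first by apply: IM => //; apply: IT.
apply: (ID); first by apply: IM => //; apply: subringM.
by apply: (ID); apply: IM => //; apply: subringM.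
Qed.

Lemma ded_prod_maximal T I : ded T -> ideal T I -> I <> [set 0] ->
  exists2 s, (forall P, P \in s -> maximal_ideal T P /\ I `<=` P) & ideal_prod T s `<=` I.
Proof.
move=> dT idI I0; have rT := proj1 dT.
have [s Hs sI] := noetherian_prod_primes rT (ded_noetherian dT) idI I0.
exists s => // P /Hs[pP IP]; split=> //.
have [|x Ix x0] := set_nz _ I0; first by case: idI.
by apply: (ded_prime_maximal dT pP _ x0); apply: IP.
Qed.

Section DedekindDed.
Variable T : set K.
Hypothesis dT : dedekind T.
Let rT : subring T. Proof. by case: dT. Qed.

Lemma dedekind_cic : compl_int_closed T.
Proof.
move=> d x Td d0 H; have [_ nT icT _] := dT.
have dU : d != 0 by apply/eqP.
(* The ideals d (T + T x + ... + T x^(n-1)) form a chain. Where it stops, d x^N = d q(x) with q of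
   degree less than N, a monic equation for x. *)
pose I n := [set z | exists q : {poly K}, [/\ forall i, T q`_i, (size q <= n)%N & z = d * q.[x]]].
have [||N /(_ N.+1 (leqnSn N)) E] := nT I.
- move=> n; split.
  + move=> _ [q [Tq _ ->]]; rewrite horner_coef mulr_sumr.
    apply: (big_ind T) => [||j _]; [exact: subring0|exact: subringD|].
    by rewrite mulrCA; apply: subringM.
  + exists 0; split; rewrite ?size_poly0 ?horner0 ?mulr0 // => i.
    by rewrite coef0; apply: subring0.
  + move=> _ _ [q [Tq sq ->]] [r [Tr sr ->]]; exists (q + r); split.
    * by move=> i; rewrite coefD; apply: subringD.
    * by rewrite (leq_trans (size_polyD _ _)) // geq_max sq.
    * by rewrite hornerD mulrDr.
  + move=> s _ Ts [q [Tq sq ->]]; exists (s *: q); split.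
    * by move=> i; rewrite coefZ; apply: subringM.
    * by rewrite (leq_trans (size_scale_leq _ _)).
    * by rewrite hornerZ; ring.
- by move=> n z [q [Tq sq ->]]; exists q; split=> //; apply: leqW.
have : I N.+1 (d * x ^+ N).
  exists 'X^N; split; rewrite ?size_polyXn ?hornerXn // => i.
  by rewrite coefXn; case: eqP => _; [exact: subring1|exact: subring0].
rewrite E => -[q [Tq sq /(mulfI dU) Eq]].
apply: icT; first by exists (d * x), d; split=> //; [rewrite -[x]expr1|rewrite mulrC mulKf].
exists ('X^N - q); split.
- by rewrite monicE lead_coefDl ?lead_coefXn // size_polyN size_polyXn ltnS.
- move=> i; rewrite coefB coefXn; apply: subringB => //.
  by case: eqP => _; [exact: subring1|exact: subring0].
- by apply/rootP; rewrite hornerD hornerN hornerXn Eq subrr.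
Qed.

Lemma dedekind_colon_stable I x c : ideal T I -> I x -> x <> 0 ->
  (forall y, I y -> I (c * y)) -> T c.
Proof.
move=> [IT _ _ _] Ix x0 H; apply: (@dedekind_cic x) => //; first exact: IT.
move=> n; apply: IT; elim: n => [|n IH]; first by rewrite expr0 mulr1.
by rewrite exprS mulrCA; apply: H.
Qed.

Lemma dedekind_maximal_inv N : maximal_ideal T N -> N <> [set 0] -> invertible T N.
Proof.
move=> mN N0; have [[idN _] _] := mN; have [NT Nz ND NM] := idN.
have [_ nT _ pmax] := dT.
have [a Na a0] := set_nz Nz N0; have aU : a != 0 by apply/eqP.
pose aT := ideal_gen T [set 0] a.
have idaT : ideal T aT by apply: ideal_gen_ideal; [exact: rT|apply: ideal0|apply: NT].
have aTa : aT a by apply: ideal_gen_mem.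
have aTN : aT `<=` N.
  by move=> _ [_ -> [s Ts ->]]; rewrite add0r; apply: NM.
(* Dropping the factor P = N from a shortest product of nonzero primes inside a T leaves some b
   outside a T with N b inside a T. Then c = b / a is in T : N but not in T. *)
pose Q n := `[< exists s, [/\ size s = n, forall P, P \in s -> prime_ideal T P /\ P <> [set 0]
  & ideal_prod T s `<=` aT] >].
have exQ : exists n, Q n.
  have [s Hs saT] := noetherian_prod_primes rT nT idaT (nz_set aTa a0).
  exists (size s); apply/asboolP; exists s; split=> // P /Hs[pP aP]; split=> //.
  exact: nz_set (aP _ aTa) a0.
case: (ex_minnP exQ) => n /asboolP[s [ss Hs saT]] minn.
have [P Ps PN] : exists2 P, P \in s & P `<=` N.
  apply: (prime_prod rT (maximal_prime rT mN)) => [J /Hs[[[]]]//|].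
  exact: subset_trans aTN.
have [pP P0] := Hs _ Ps.
have EP : N = P.
  apply: (maximal_eq rT (pmax _ pP P0)) => //.
  exact: maximal_ideal1 mN.
have sub : ideal_mul N (ideal_prod T (rem P s)) `<=` aT.
  by rewrite {1}EP -(ideal_prod_rem T Ps).
have [b nb bs] : exists2 b, ~ aT b & ideal_prod T (rem P s) b.
  apply: contrapT => H.
  have /minn : Q (size (rem P s)).
    apply/asboolP; exists (rem P s); split=> // [L /mem_rem/Hs//|x Hx].
    by apply: contrapT => nx; apply: H; exists x.
  by rewrite size_rem // ss; case: n ss {minn} => [|n _]; [case: (s) Ps|rewrite ltnn].
pose c := b / a.
have cN : colon T N c.
  move=> x Nx; have : aT (x * b) by apply: sub; apply: ideal_mul_in.
  case=> _ -> [t Tt]; rewrite add0r => E.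
  by have -> : c * x = t by rewrite /c mulrAC [b * x]mulrC E mulfK.
have nTc : ~ T c.
  move=> Tc; apply: nb; exists 0 => //; exists c => //.
  by rewrite add0r /c divfK.
have idX := colon_mul_ideal rT idN (@subset_refl _ _).
apply: contrapT => nX1.
have XN : ideal_mul N (colon T N) = N.
  apply: (maximal_eq rT mN) => // x Nx; rewrite -[x]mulr1; apply: ideal_mul_in => //.
  by move=> y Ny; rewrite mul1r; apply: NT.
apply: nTc; apply: (dedekind_colon_stable idN Na a0) => y Ny.
by rewrite -XN mulrC; apply: ideal_mul_in.
Qed.

Lemma dedekind_ded : ded T.
Proof.
split; first exact: rT.
have [_ nT _ _] := dT.
apply: (acc_ind nT) => I idI IH I0; have [IT Iz ID IM] := idI.
have [I1|I1] := pselect (I 1).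
  rewrite /invertible -[1]mulr1; apply: ideal_mul_in => // y Iy.
  by rewrite mul1r; apply: IT.
have [N mN IN] := max_ex rT idI I1.
have [x Ix x0] := set_nz Iz I0.
have N0 : N <> [set 0] by apply: (nz_set (x := x)) => //; apply: IN.
have invN := dedekind_maximal_inv mN N0.
have [[idN _] _] := mN; have [NT Nz ND NM] := idN.
pose J := ideal_mul I (colon T N).
have IJ : I `<=` J.
  move=> y Iy; rewrite -[y]mulr1; apply: ideal_mul_in => // z Nz'.
  by rewrite mul1r; apply: NT.
have idJ : ideal T J := colon_mul_ideal rT idI IN.
(* If J = I (T : N) were no larger than I, then T : N would stabilize I, hence lie in T, and 1 would
   be in N. *)
have [JI|nJI] := pselect (J `<=` I).
  exfalso; apply: (maximal_ideal1 rT mN).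
  apply: (ideal_mul_ind (X := N)) invN => // a b Na Hb.
  rewrite mulrC; apply: NM => //; apply: (dedekind_colon_stable idI Ix x0) => y Iy.
  by rewrite mulrC; apply: JI; apply: ideal_mul_in.
have := IH J idJ (conj IJ nJI) (nz_set (IJ _ Ix) x0).
rewrite /invertible /J -ideal_mulA; apply: (ideal_mulS (@subset_refl _ I)).
apply: ideal_mul_ind; try by case: (@colon_submodule T I rT).
move=> a b Ha Hb y Iy.
have -> : a * b * y = b * (y * a) by ring.
by apply: Hb; apply: ideal_mul_in.
Qed.

End DedekindDed.

End Dedekind.

(** * Pullbacks of Dedekind domains *)

Section Pullback.
Variable K : fieldType.
Implicit Types (R S T I J L M N P X : set K) (s : seq (set K)).

(* Condition (3) inside a field: R consists of the x in T whose residue at each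
   N in s lies in K_N, where K_N is the image of R in T / N. *)
Record pullback_of R T s : Prop := PullbackOf {
  pullback_subring : subring R;
  pullback_ded : ded T;
  pullback_sub : R `<=` T;
  pullback_max : forall N, N \in s -> maximal_ideal T N;
  pullback_nz : forall N, N \in s -> N <> [set 0];
  pullback_mem : forall x, T x ->
    (forall N, N \in s -> exists2 r, R r & N (x - r)) -> R x;
  pullback_inv : forall N x, N \in s -> R x -> ~ N x -> exists2 y, R y & N (1 - x * y) }.

Section Theory.
Variables (R T : set K) (s : seq (set K)).
Hypothesis cR : pullback_of R T s.
Let rR : subring R := pullback_subring cR.
Let dT : ded T := pullback_ded cR.
Let rT : subring T := proj1 dT.
Let RT : R `<=` T := pullback_sub cR.

Lemma pullback_ideal N : N \in s -> ideal T N.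
Proof. by case/(pullback_max cR) => -[]. Qed.

Lemma pullback_prime N x y : N \in s -> T x -> T y -> N (x * y) -> N x \/ N y.
Proof. by move=> /(pullback_max cR)/(maximal_prime rT)[_]; apply. Qed.

Lemma pullback_proper N : N \in s -> ~ N 1.
Proof. by move/(pullback_max cR); apply: maximal_ideal1. Qed.

Lemma pullback_meet x : T x -> (forall N, N \in s -> N x) -> R x.
Proof.
move=> Tx H; apply: (pullback_mem cR) => // N Ns; exists 0; first exact: subring0.
by rewrite subr0; apply: H.
Qed.

(** The residues 0 and 1 lie in every K_M, so such an element of T belongs to R. It is idempotent
    modulo the meet of s. *)
Lemma pullback_idem N : N \in s ->
  exists e, [/\ R e, N (1 - e) & forall M, M \in s -> M <> N -> M e].
Proof.
move=> Ns.
have [|||e [Te Ne He]] := @max_avoid _ _ rT N [seq M <- s | M != N].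
- exact: (pullback_max cR).
- by move=> M; rewrite mem_filter => /andP[_]; apply: (pullback_max cR).
- by rewrite mem_filter eqxx.
have He' M : M \in s -> M <> N -> M e.
  by move=> Ms /eqP MN; apply: He; rewrite mem_filter MN.
exists e; split=> //; apply: (pullback_mem cR) => // M Ms.
have [->|MN] := pselect (M = N).
  exists 1; first exact: subring1.
  by rewrite -opprB; apply: (submoduleN rT) => //; apply/ideal_submodule/pullback_ideal.
by exists 0; [exact: subring0|rewrite subr0; apply: He'].
Qed.

Lemma pullback_meet_nonzero : exists a, [/\ T a, a <> 0 & forall N, N \in s -> N a].
Proof.
have H N : N \in s -> exists2 a, N a & a <> 0.
  by move=> Ns; apply: set_nz; [by case: (pullback_ideal Ns)|exact: (pullback_nz cR)].
have : {subset s <= s} by [].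
elim: {1 3}s => [_|N t IH Hs].
  by exists 1; split=> //; [exact: subring1|exact/eqP/oner_neq0].
have [|a [Ta a0 Ha]] := IH; first by move=> M Mt; apply: Hs; rewrite inE Mt orbT.
have Ns : N \in s by apply: Hs; rewrite inE eqxx.
have [b Nb b0] := H _ Ns; have [NT _ _ NM] := pullback_ideal Ns.
exists (a * b); split.
- by apply: subringM => //; apply: NT.
- by apply/eqP; rewrite mulf_neq0 //; apply/eqP.
- move=> M; rewrite inE => /orP[/eqP->|Mt]; first exact: NM.
  have [|_ _ _ MM] := @pullback_ideal M; first by apply: Hs; rewrite inE Mt orbT.
  by rewrite mulrC; apply: MM; [apply: NT|apply: Ha].
Qed.

(** If N is not listed, some e in the meet of s is 1 modulo N; since e T lies in R, the map R -> T /
    N is onto. A local argument at a nonzero maximal ideal may thus assume that the ideal is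
    listed. *)
Lemma pullback_extend N : maximal_ideal T N -> N <> [set 0] ->
  exists2 t, pullback_of R T t & N \in t.
Proof.
move=> mN N0; have [Ns|Ns] := boolP (N \in s); first by exists s.
have [e [Te Ne He]] := max_avoid rT mN (@pullback_max _ _ _ cR) Ns.
exists (N :: s); last by rewrite inE eqxx.
split=> //.
- by move=> M; rewrite inE => /orP[/eqP->//|]; apply: (pullback_max cR).
- by move=> M; rewrite inE => /orP[/eqP->//|]; apply: (pullback_nz cR).
- move=> x Tx H; apply: (pullback_mem cR) => // M Ms.
  by apply: H; rewrite inE Ms orbT.
- move=> M x; rewrite inE => /orP[/eqP->|]; last exact: (pullback_inv cR).
  move=> Rx nNx; have [y Ty Ny] := maximal_inv rT mN (RT Rx) nNx.
  have [[[_ _ ND NM] _] _] := mN.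
  exists (e * y).
    apply: pullback_meet => [|L Ls]; first exact: subringM.
    have [_ _ _ LM] := pullback_ideal Ls.
    by rewrite mulrC; apply: LM => //; apply: He.
  have -> : 1 - x * (e * y) = (1 - e) + e * (1 - x * y) by ring.
  by apply: ND => //; apply: NM.
Qed.

Lemma pullback_sub_maximal I : ideal R I -> ~ I 1 ->
  (forall x, T x -> (forall N, N \in s -> N x) -> I x) ->
  exists2 N, N \in s & I `<=` N.
Proof.
move=> [IR I0 ID IM] I1 AI; apply: contrapT => H; apply: I1.
have HN N : N \in s -> exists2 z, I z & N (1 - z).
  move=> Ns; apply: contrapT => Hz; apply: H; exists N => // x Ix.
  apply: contrapT => nNx; apply: Hz.
  have [y Ry Ny] := pullback_inv cR Ns (IR _ Ix) nNx.
  by exists (x * y) => //; rewrite mulrC; apply: IM.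
suff [z Iz Hz] : exists2 z, I z & forall N, N \in s -> N (1 - z).
  rewrite -[1](subrK z); apply: ID => //; apply: AI => //.
  by apply: subringB; [|apply: subring1|apply/RT/IR].
have : {subset s <= s} by [].
elim: {1 3}s => [_|N t IH Hs]; first by exists 0.
have [|z Iz Hz] := IH; first by move=> M Mt; apply: Hs; rewrite inE Mt orbT.
have Ns : N \in s by apply: Hs; rewrite inE eqxx.
have [w Iw Nw] := HN _ Ns.
have TI x : I x -> T (1 - x).
  by move=> Ix; apply: subringB => //; [apply: subring1|apply/RT/IR].
(* The complements 1 - z multiply while z itself stays in I. *)
exists (z + (1 - z) * w).
  apply: ID => //; apply: IM => //.
  by apply: subringB => //; [apply: subring1|apply: IR].
have -> : 1 - (z + (1 - z) * w) = (1 - z) * (1 - w) by ring.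
move=> M Mt; have [_ _ _ MM] := pullback_ideal (Hs _ Mt).
move: Mt; rewrite inE => /orP[/eqP EM|Mt]; last first.
  by rewrite mulrC; apply: MM; [exact: TI|apply: Hz].
by apply: MM; [exact: TI|rewrite EM].
Qed.

(** If I contains the meet A of s, a listed ideal contains I. Otherwise I T is proper: 1 in I T
    would give A inside A T I, hence inside I, because A T lies in R. *)
Lemma pullback_lying_over I x : ideal R I -> ~ I 1 -> I x -> x <> 0 ->
  exists N, [/\ maximal_ideal T N, N <> [set 0] & I `<=` N].
Proof.
move=> idI I1 Ix x0.
have nz N : I `<=` N -> N <> [set 0] by move=> IN; apply: (nz_set (IN _ Ix)).
have [IR I0 ID IM] := idI.
have [AI|nAI] := pselect (forall x, T x -> (forall N, N \in s -> N x) -> I x).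
  have [N Ns IN] := pullback_sub_maximal idI I1 AI.
  by exists N; split=> //; [apply: (pullback_max cR)|apply: nz].
have IX := @sub_ideal_extend _ T I rT.
have idX := ideal_extend rT RT idI.
have [|N mN XN] := max_ex rT idX.
  move=> X1; apply: nAI => a Ta Ha; rewrite -[a]mulr1.
  apply: (ideal_mul_ind (X := [set z | I (a * z)])) X1 => /= [|y z Hy Hz|t i Tt Ii].
  - by rewrite mulr0.
  - by rewrite mulrDr; apply: ID.
  - rewrite mulrA; apply: IM => //; apply: pullback_meet; first exact: subringM.
    move=> N Ns; have [_ _ _ NM] := pullback_ideal Ns.
    by rewrite mulrC; apply: NM => //; apply: Ha.
have IN : I `<=` N by apply: subset_trans XN.
by exists N; split=> //; apply: nz.
Qed.

(** If a and b are outside N and a b c is in J, then c is in N. With y an inverse of a b modulo N, c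
    = c (1 - a b y) + y (a b c), where the first term is a product of two elements of N; so c is in
    J. *)
Lemma pullback_two_absorbing N J : N \in s -> ideal R J -> J `<=` N ->
  (forall a b, R a -> R b -> N a -> N b -> J (a * b)) -> two_absorbing R J.
Proof.
move=> Ns idJ JN H; have [JR J0 JD JM] := idJ; have [NT N0 ND NM] := pullback_ideal Ns.
split; first by apply/(proper_ideal1 rR idJ) => /JN; apply: pullback_proper.
have key a b c : R a -> R b -> R c -> ~ N a -> ~ N b -> J (a * b * c) -> J c.
  move=> Ra Rb Rc nNa nNb Jabc.
  have Rab : R (a * b) by apply: subringM.
  have nNab : ~ N (a * b).
    by case/(pullback_prime Ns (RT Ra) (RT Rb)).
  have Nc : N c.
    by case: (pullback_prime Ns (RT Rab) (RT Rc) (JN _ Jabc)).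
  have [y Ry Ny] := pullback_inv cR Ns Rab nNab.
  have -> : c = c * (1 - a * b * y) + y * (a * b * c) by ring.
  apply: JD; last exact: JM.
  apply: H => //; apply: subringB => //; first exact: subring1.
  exact: subringM.
move=> a b c Ra Rb Rc Jabc.
have [Na|nNa] := pselect (N a); last first.
  have [Nb|nNb] := pselect (N b); last first.
    by apply: Or32; apply: JM => //; apply: key Jabc.
  have [Nc|nNc] := pselect (N c); first by apply: Or33; apply: H.
  apply: Or31; apply: JM => //; apply: (key a c) => //.
  by rewrite mulrAC.
have [Nb|nNb] := pselect (N b); first by apply: Or31; apply: H.
have [Nc|nNc] := pselect (N c); first by apply: Or32; apply: H.
apply: Or31; rewrite mulrC; apply: JM => //; apply: (key b c) => //.
by rewrite mulrC mulrA.
Qed.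

(** In T, already N is divisible by y at N. The second factor from N makes the quotient vanish
    modulo N, and e makes it vanish modulo the other listed ideals, so it lies in R whatever K_N
    is. *)
Lemma pullback_square_dvd N y : N \in s -> N y -> ~ ideal_mul N N y ->
  exists e, [/\ R e, N (1 - e) & forall z, ideal_mul N N z -> exists2 t, R t & e * z = y * t].
Proof.
move=> Ns Ny nNy; have mN := pullback_max cR Ns.
have [NT N0 ND NM] := pullback_ideal Ns.
have [u [Tu nNu Hu]] := maximal_nsq_factor dT mN Ny nNy.
have [v Tv Nv] := maximal_inv rT mN Tu nNu.
have [e [Re Ne He]] := pullback_idem Ns.
have Rmul t : T t -> N t -> R (e * t).
  move=> Tt Nt; apply: pullback_meet => [|M Ms]; first by apply: subringM => //; apply: RT.
  have [_ _ _ MM] := pullback_ideal Ms.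
  have [->|MN] := pselect (M = N); first by apply: NM => //; apply: RT.
  by rewrite mulrC; apply: MM => //; apply: He.
have Tuv : T (u * v) by apply: subringM.
have Ruv : R (e * (u * v)).
  have -> : e * (u * v) = e - e * (1 - u * v) by ring.
  apply: subringB => //; apply: Rmul => //.
  by apply: subringB => //; apply: subring1.
exists (e * (u * v)); split=> //.
  have -> : 1 - e * (u * v) = (1 - e) + e * (1 - u * v) by ring.
  by apply: ND => //; apply: NM => //; apply: RT.
apply: ideal_mul_ind => /= [|z w [t Rt Et] [t' Rt' Et']|a b Na Nb].
- by exists 0; [exact: subring0|rewrite !mulr0].
- by exists (t + t'); [exact: subringD|rewrite !mulrDr Et Et'].
- have [t Tt Et] := Hu _ Na; exists (e * (v * t * b)).
    apply: Rmul; first by apply: (subringM) => //; [apply: subringM|apply: NT].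
    by apply: NM => //; apply: subringM.
  have -> : e * (u * v) * (a * b) = (u * a) * (e * v * b) by ring.
  by rewrite Et; ring.
Qed.

(* J is I + Q if I is not contained in N^2, and y R + Q with y in N \ N^2
   otherwise, where Q = N^2 \cap R; in both cases I' = I :_R J. *)
Lemma pullback_factor I x N : ideal R I -> N \in s -> I `<=` N -> I x -> x <> 0 ->
  exists J I', [/\ two_absorbing R J, ideal R I', J `<=` N & I = ideal_mul J I'].
Proof.
move=> idI Ns IN Ix x0; have mN := pullback_max cR Ns.
have [NT N0 ND NM] := pullback_ideal Ns; have [IR I0 ID IM] := idI.
pose N2 := ideal_mul N N; pose Q := N2 `&` R.
have [Q0' QD' QM'] := ideal_mul_submodule N (ideal_submodule (pullback_ideal Ns)).
have N2N : N2 `<=` N by apply: (ideal_mul_subr (pullback_ideal Ns)).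
have idQ : ideal R Q.
  by apply: ideal_meet rR RT _; split=> //; apply: subset_trans NT.
have [_ Q0 QD QM] := idQ.
pose quo J := [set z | R z /\ forall j, J j -> I (z * j)].
have idquo J : J `<=` R -> ideal R (quo J).
  move=> JR; split=> [z []//||z w [Rz Hz] [Rw Hw]|r z Rr [Rz Hz]].
  - by split=> [|j _]; [exact: subring0|rewrite mul0r].
  - by split=> [|j Jj]; [exact: subringD|rewrite mulrDl; apply: ID; [apply: Hz|apply: Hw]].
  - by split=> [|j Jj]; [exact: subringM|rewrite -mulrA; apply: IM => //; apply: Hz].
(* It is enough to treat I e: the remaining part of i is (1 - e)^2 i, where (1 - e)^2 is in Q, hence
   in J, and i multiplies J into I. *)
have main J e : ideal R J -> J `<=` N -> I `<=` J -> Q `<=` J ->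
    R e -> N (1 - e) -> (forall i, I i -> ideal_mul J (quo J) (i * e)) ->
  exists J I', [/\ two_absorbing R J, ideal R I', J `<=` N & I = ideal_mul J I'].
  move=> idJ JN IJ QJ Re Ne He; have [JR J0 JD JM] := idJ.
  exists J, (quo J); split=> //; first 1 last.
  - exact: idquo.
  - apply/seteqP; split; last first.
      by apply: ideal_mul_ind => // a b Ja [_ Hb]; rewrite mulrC; apply: Hb.
    move=> i Ii.
    have Re1 : R (1 - e) by apply: subringB => //; apply: subring1.
    have -> : i = (1 - e) * (1 - e) * i + (1 + (1 - e)) * (i * e) by ring.
    apply: ideal_mulD.
      apply: ideal_mul_in.
        by apply: QJ; split; [apply: ideal_mul_in|apply: subringM].
      by split=> [|j Jj]; [exact: IR|rewrite mulrC; apply: IM => //; apply: JR].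
    have [_ _ +] := ideal_mul_submodule (quo J) (ideal_submodule idJ); apply; last exact: He.
    by apply: subringD => //; apply: subring1.
  - apply: (pullback_two_absorbing Ns) => // a b Ra Rb Na Nb; apply: QJ.
    by split; [apply: ideal_mul_in|apply: subringM].
have [sub|nsub] := pselect (I `<=` N2).
  have [y0 Ny0 nNy0] := maximal_nsq dT mN (pullback_nz cR Ns).
  have [e0 [Re0 Ne0 He0]] := pullback_idem Ns.
  (* The factor e0 makes y vanish at the other listed ideals, so that y is in R; modulo N^2 nothing
     changes. *)
  pose y := y0 * e0.
  have Ny : N y by rewrite /y mulrC; apply: NM => //; apply: RT.
  have nNy : ~ N2 y.
    move=> N2y; apply: nNy0; have -> : y0 = y + y0 * (1 - e0) by rewrite /y; ring.
    by apply: QD' => //; apply: ideal_mul_in.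
  have Ry : R y.
    apply: pullback_meet => [|M Ms]; first exact: NT.
    have [_ _ _ MM] := pullback_ideal Ms.
    have [->//|MN] := pselect (M = N).
    by apply: MM; [apply: NT|apply: He0].
  have [e [Re Ne He]] := pullback_square_dvd Ns Ny nNy.
  have y0' : y != 0 by apply/eqP => E; apply: nNy; rewrite E; apply: Q0'.
  (* As e / y maps J into R, i e / y is in I : J for i in I, and i e = y (i e / y) is in J (I :
     J). *)
  have RcJ j : ideal_gen R Q y j -> R (e / y * j).
    case=> q [N2q Rq] [r Rr ->]; have [t Rt Et] := He _ N2q.
    have -> : e / y * (q + r * y) = t + e * r; last first.
      by apply: subringD => //; apply: subringM.
    by rewrite mulrDr mulrAC Et mulrAC divff // mul1r [r * y]mulrC mulrA divfK.
  have IQ : I `<=` Q by move=> i Ii; split; [apply: sub|apply: IR].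
  have IJ : I `<=` ideal_gen R Q y.
    exact: subset_trans IQ (@ideal_gen_sub _ _ rR Q y).
  apply: (main (ideal_gen R Q y) e) => //.
  - exact: ideal_gen_ideal.
  - move=> _ [q [/N2N Nq _] [r Rr ->]]; apply: ND => //; apply: NM => //; exact: RT.
  - exact: ideal_gen_sub.
  - move=> i Ii; have -> : i * e = y * (e / y * i) by rewrite mulrA [y * _]mulrC divfK // mulrC.
    apply: ideal_mul_in; first exact: ideal_gen_mem.
    split; first by apply: RcJ; apply: IJ.
    by move=> j /RcJ Rj; rewrite mulrAC; apply: IM.
move/existsNP: nsub => [y /not_implyP[Iy nN2y]].
have [e [Re Ne He]] := pullback_square_dvd Ns (IN _ Iy) nN2y.
pose J := [set z | exists2 i, I i & exists2 q, Q q & z = i + q].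
have IJ : I `<=` J by move=> i Ii; exists i => //; exists 0; rewrite ?addr0.
have QJ : Q `<=` J by move=> q Qq; exists 0 => //; exists q; rewrite ?add0r.
have idJ : ideal R J.
  split.
  - by move=> _ [i Ii [q Qq ->]]; apply: subringD => //; [apply: IR|case: Qq].
  - exact: IJ.
  - move=> _ _ [i Ii [q Qq ->]] [i' Ii' [q' Qq' ->]]; exists (i + i'); first exact: ID.
    by exists (q + q'); [exact: QD|ring].
  - move=> r _ Rr [i Ii [q Qq ->]]; exists (r * i); first exact: IM.
    by exists (r * q); [exact: QM|ring].
have He' q : Q q -> I (e * q).
  by case=> N2q _; have [t Rt ->] := He _ N2q; rewrite mulrC; apply: IM.
apply: (main J e) => //.
  by move=> _ [i /IN Ni [q [/N2N Nq _] ->]]; apply: ND.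
move=> i Ii; apply: ideal_mul_in; first exact: IJ.
split=> // _ [i' Ii' [q Qq ->]]; rewrite mulrDr; apply: ID; last exact: He'.
exact: IM.
Qed.

End Theory.
End Pullback.

Section PullbackTAF.
Variable K : fieldType.
Implicit Types (R S T I J L M N P X : set K) (s : seq (set K)).

(* Noetherian induction on I T: if I = J I' with J inside a maximal ideal of T,
   then I' T is strictly larger than I T. *)
Lemma pullback_prod_two_absorbing R T s I x : pullback_of R T s -> ideal R I -> I x -> x <> 0 ->
  exists2 t, (forall J, J \in t -> two_absorbing R J) & I = ideal_prod R t.
Proof.
move=> cR idI Ix x0.
have dT := pullback_ded cR; have rT : subring T := proj1 dT; have rR := pullback_subring cR.
have RT := pullback_sub cR.
pose Q H := forall I x, ideal R I -> I x -> x <> 0 -> ideal_mul T I = H ->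
  exists2 t, (forall J, J \in t -> two_absorbing R J) & I = ideal_prod R t.
have idTI L : ideal R L -> ideal T (ideal_mul T L) := @ideal_extend _ R T L rT RT.
have LTL L : L `<=` ideal_mul T L := @sub_ideal_extend _ T L rT.
suff : forall H, ideal T H -> Q H by move/(_ _ (idTI _ idI) _ _ idI Ix x0 erefl).
apply: (acc_ind (ded_noetherian dT)) => H idH IH {idI Ix x0 x}I x idI Ix x0 EH.
have [I1|I1] := pselect (I 1); first by exists [::] => //=; apply: ideal1.
have [N [mN N0 IN]] := pullback_lying_over cR idI I1 Ix x0.
have [t ct Nt] := pullback_extend cR mN N0.
have [J [I' [abJ idI' JN EI]]] := pullback_factor ct idI Nt IN Ix x0.
have [[idJ _] _] := abJ; have [JR _ _ _] := idJ.
have II' : I `<=` I' by rewrite EI; apply: ideal_mul_subr idI' _.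
have QI' : Q (ideal_mul T I').
  apply: IH; first exact: idTI.
  split; first by rewrite -EH; apply: ideal_mulS.
  (* Otherwise H = J H with J inside N, and multiplying by T : H puts 1 into N. *)
  move=> sub; apply: (maximal_ideal1 rT mN).
  have E : ideal_mul T I' = H.
    by apply/seteqP; split=> //; rewrite -EH; apply: ideal_mulS.
  have Hx : H x by rewrite -EH; apply: LTL.
  have [[idN _] _] := mN; have [NT _ ND NM] := idN.
  apply: (ideal_mul_ind (X := N)) (ded_inv dT idH Hx x0) => //; first by case: idN.
  move=> a b Ha' Hb; have Ha : ideal_mul J (ideal_mul I' T) a.
    by rewrite ideal_mulA -EI ideal_mulC EH.
  have HT c : ideal_mul I' T c -> T (b * c).
    by rewrite ideal_mulC E => Hc; apply: Hb.
  move: {Ha'} a Ha; apply: (ideal_mul_ind (X := [set a | N (a * b)])) => /=.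
  + by rewrite mul0r; case: idN.
  + by move=> y z Hy Hz; rewrite mulrDl; apply: ND.
  + by move=> y z /JN Ny /HT Tz; rewrite -mulrA mulrC [z * b]mulrC; apply: NM.
have [t' abt' EI'] := QI' _ _ idI' (II' _ Ix) x0 erefl.
exists (J :: t') => /=; last by rewrite -EI'.
by move=> L; rewrite inE => /orP[/eqP->|/abt'].
Qed.

(** * Pullbacks as TAF-domains, and a criterion for being a pullback *)

Lemma zero_two_absorbing R : subring R -> two_absorbing R [set 0].
Proof.
move=> rR; split.
  by apply/(proper_ideal1 rR (ideal0 rR)) => /eqP; rewrite oner_eq0.
move=> a b c _ _ _ /eqP; rewrite !mulf_eq0 => /orP[/orP[]|] /eqP->.
- by apply: Or31; rewrite /= mul0r.
- by apply: Or31; rewrite /= mulr0.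
- by apply: Or32; rewrite /= mulr0.
Qed.

Lemma pullback_TAF R T s : pullback_of R T s -> TAF R.
Proof.
move=> cR I [idI _]; have rR := pullback_subring cR.
have [->|I0] := pselect (I = [set 0]).
  exists [:: [set 0]]; split.
    by move=> J; rewrite inE => /eqP->; apply: zero_two_absorbing.
  by rewrite /= ideal_mulC ideal_mul1 //; apply/ideal_submodule/ideal0.
have [|x Ix x0] := set_nz _ I0; first by case: idI.
by have [t ? ?] := pullback_prod_two_absorbing cR idI Ix x0; exists t.
Qed.

Lemma pullback_cic R T s : pullback_of R T s -> complete_integral_closure R = T.
Proof.
move=> cR; have dT := pullback_ded cR; have RT := pullback_sub cR.
apply/seteqP; split=> x.
  move=> [d [Rd d0 H]]; apply: (ded_cic dT (RT _ Rd) d0) => -[|n].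
    by rewrite expr0 mulr1; apply: RT.
  by apply: RT; apply: H.
move=> Tx; have [a [Ta a0 Ha]] := pullback_meet_nonzero cR.
have Rax n : R (a * x ^+ n).
  have Tx' : T (x ^+ n) by apply: subringX => //; case: dT.
  apply: (pullback_meet cR); first by apply: subringM => //; case: dT.
  move=> N Ns; have [_ _ _ NM] := pullback_ideal cR Ns.
  by rewrite mulrC; apply: NM => //; apply: Ha.
by exists a; split=> //; rewrite -[a]mulr1 -(expr0 x).
Qed.

Lemma pullback_conductor R T s : pullback_of R T s -> colon R T <> [set 0].
Proof.
move=> cR; have dT := pullback_ded cR.
have [a [Ta a0 Ha]] := pullback_meet_nonzero cR; apply: (nz_set _ a0) => t Tt.
apply: (pullback_meet cR); first by apply: subringM => //; case: dT.
move=> N Ns; have [_ _ _ NM] := pullback_ideal cR Ns.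
by rewrite mulrC; apply: NM => //; apply: Ha.
Qed.

(** The list s consists of maximal ideals over I with product inside I. If x has its residues in the
    images of R, the Chinese remainder theorem in R, applied to the distinct contractions, gives one
    r with x - r in every N of s. A power of x - r is then in I, so x - r is in I and x in R. *)
Lemma radical_pullback R T I a : subring R -> ded T -> R `<=` T ->
    radical_ideal T I -> I `<=` R -> I a -> a <> 0 ->
    (forall M N, maximal_ideal T M -> maximal_ideal T N -> I `<=` M -> I `<=` N ->
       M `&` R = N `&` R -> M = N) ->
    (forall N x, maximal_ideal T N -> I `<=` N -> R x -> ~ N x ->
       exists2 y, R y & N (1 - x * y)) ->
  exists s, pullback_of R T s.
Proof.
move=> rR dT RT [idI radI] IR Ia a0 injN invN; have rT := proj1 dT.
have [s Hs sI] := ded_prod_maximal dT idI (nz_set Ia a0).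
have idN N : N \in s -> ideal T N by case/Hs => -[[]].
have maxR N : N \in s -> maximal_ideal R (N `&` R).
  move=> Ns; have [mN IN] := Hs _ Ns; have [NT N0 ND NM] := idN _ Ns.
  apply: maximalP => //.
  - exact: ideal_meet (idN _ Ns).
  - by case=> /(maximal_ideal1 rT mN).
  - move=> x Rx nNx; have [|y Ry Ny] := invN N x mN IN Rx.
      by move=> Nx; apply: nNx.
    exists y => //; split=> //; apply: subringB => //; first exact: subring1.
    exact: subringM.
exists s; split=> //.
- by move=> N /Hs[].
- by move=> N /Hs[_ IN]; apply: nz_set (IN _ Ia) a0.
- move=> x Tx Hx.
  suff [r Rr Hr] : exists2 r, R r & forall N, N \in s -> N (x - r).
    rewrite -(subrK r x); apply: subringD => //; apply: IR.
    apply: (radI _ (size s)); first by apply: subringB => //; apply: RT.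
    apply: sI; elim: (s) Hr => [_|N t IH Ht]; first by rewrite expr0; apply: subring1.
    rewrite /= exprS; apply: ideal_mul_in; first by apply: Ht; rewrite inE eqxx.
    by apply: IH => M Mt; apply: Ht; rewrite inE Mt orbT.
  have : {subset s <= s} by [].
  elim: {1 3}s => [_|N t IH Ht]; first by exists 0 => //; apply: subring0.
  have Ns : N \in s by apply: Ht; rewrite inE eqxx.
  have ts M : M \in t -> M \in s by move=> Mt; apply: Ht; rewrite inE Mt orbT.
  have [//|r Rr Hr] := IH; have [u Ru Nu] := Hx _ Ns.
  have [Nt|nNt] := boolP (N \in t).
    by exists r => // M; rewrite inE => /orP[/eqP->|]; apply: Hr.
  have [|||e [Re [Ne _] He]] := @max_avoid _ _ rR (N `&` R) [seq M `&` R | M <- t].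
  + exact: (maxR N Ns).
  + by move=> _ /mapP[M Mt ->]; apply/maxR/ts.
  + apply/negP => /mapP[M Mt E]; have [mN IN] := Hs _ Ns; have [mM IM] := Hs _ (ts _ Mt).
    by move: nNt; rewrite (injN _ _ mN mM IN IM E) Mt.
  exists (r + e * (u - r)).
    by apply: subringD => //; apply: subringM => //; apply: subringB.
  have Tur : T (u - r) by apply: RT; apply: subringB.
  move=> M; rewrite inE => /orP[/eqP->|Mt].
    have [_ _ ND NM] := idN _ Ns.
    have -> : x - (r + e * (u - r)) = (x - u) + (u - r) * (1 - e) by ring.
    by apply: ND => //; apply: NM.
  have sM := ideal_submodule (idN _ (ts _ Mt)); have [_ _ MM] := sM.
  rewrite opprD addrA; apply: (submoduleB rT sM); first exact: Hr.
  rewrite mulrC; apply: MM => //.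
  by have [] : (M `&` R) e by apply: He; apply/mapP; exists M.
- by move=> N x /Hs[mN IN]; apply: invN.
Qed.

End PullbackTAF.

(** * Pullbacks as Mori globalized pseudo-valuation domains *)

Section PullbackGPVD.
Variable K : fieldType.
Implicit Types (R S T I J L M N P X : set K) (s : seq (set K)).

(** Write x = p / q. As the ideal J = (p, q) is invertible, some u in T : J has u p or u q outside
    M, and x = (u p) / (u q). *)
Lemma ded_valuation T M : ded T -> maximal_ideal T M -> valuation_domain (localization T M).
Proof.
move=> dT mM; have rT := proj1 dT; have [_ pM] := maximal_prime rT mM.
have [[idM _] _] := mM; have [MT M0 MD MM] := idM.
have nz b : ~ M b -> b != 0 by move=> nMb; apply/eqP => E; apply: nMb; rewrite E.
have nM b d : T b -> T d -> ~ M b -> ~ M d -> ~ M (b * d) by move=> Tb Td ? ? /(pM _ _ Tb Td)[].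
split.
  split.
  - exists 1, 1; split; rewrite ?divr1 //; try exact: subring1.
    exact: maximal_ideal1 mM.
  - move=> _ _ [a [b [Ta Tb nb ->]]] [c [d [Tc Td nd ->]]].
    exists (a * d - c * b), (b * d); split; [|exact: subringM|exact: nM|].
      by apply: subringB => //; apply: subringM.
    by field; rewrite !nz.
  - move=> _ _ [a [b [Ta Tb nb ->]]] [c [d [Tc Td nd ->]]].
    exists (a * c), (b * d); split; [exact: subringM|exact: subringM|exact: nM|].
    by field; rewrite !nz.
move=> x [_ [_ [[a [b [Ta Tb nb ->]]] [c [d [Tc Td nd ->]]] cd0 Ex]]] x0.
have d0 := nz _ nd; have b0 := nz _ nb.
have c0 : c != 0 by apply/eqP => E; apply: cd0; rewrite E mul0r.
pose p := a * d; pose q := b * c.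
have {}Ex : x = p / q by rewrite Ex /p /q; field; rewrite c0 b0 d0.
have Tp : T p by apply: subringM.
have Tq : T q by apply: subringM.
have q0 : q != 0 by rewrite mulf_neq0.
have p0 : p != 0 by apply/eqP => E; apply: x0; rewrite Ex E mul0r.
pose J := ideal_gen T (ideal_gen T [set 0] p) q.
have idJp := ideal_gen_ideal rT (ideal0 rT) Tp.
have idJ : ideal T J by apply: ideal_gen_ideal.
have Jq : J q by apply: ideal_gen_mem => //; case: idJp.
have Jp : J p by apply: ideal_gen_sub => //; apply: ideal_gen_mem.
have invJ := ded_inv dT idJ Jq (elimN eqP q0).
have [u Hu nu] : exists2 u, colon T J u & ~ (M (u * p) /\ M (u * q)).
  apply: contrapT => H; apply: (maximal_ideal1 rT mM).
  apply: (ideal_mul_ind (X := M)) invJ => // _ u [_ [_ -> [v Tv ->]] [w Tw ->]] Hu.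
  have [Mp Mq] : M (u * p) /\ M (u * q).
    by apply: contrapT => nu; apply: H; exists u.
  have -> : (0 + v * p + w * q) * u = v * (u * p) + w * (u * q) by ring.
  by apply: MD; apply: MM.
have [Tup Tuq] : T (u * p) /\ T (u * q) by split; apply: Hu.
have [Mq|nMq] := pselect (M (u * q)); last first.
  left; exists (u * p), (u * q); split=> //; rewrite Ex; field.
  by have := nz _ nMq; rewrite mulf_eq0 negb_or => /andP[-> ->].
have nMp : ~ M (u * p) by move=> Mp; apply: nu.
right; exists (u * q), (u * p); split=> //; rewrite Ex; field.
by have := nz _ nMp; rewrite mulf_eq0 negb_or q0 => /andP[-> ->].
Qed.

Lemma pullback_top R T s : pullback_of R T s -> pullback_of T T s.
Proof.
move=> cR; have dT := pullback_ded cR; have rT := proj1 dT; split=> //.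
- exact: (pullback_max cR).
- exact: (pullback_nz cR).
- by move=> N x /(pullback_max cR) mN; apply: maximal_inv.
Qed.

(** P lies in some listed N. If x is in N and in R and e is the idempotent at N, then x e is in all
    listed ideals, hence in P, whereas e is not in P. *)
Lemma pullback_prime_meet R T s P : pullback_of R T s -> prime_ideal R P ->
  (forall x, T x -> (forall N, N \in s -> N x) -> P x) ->
  exists2 N, N \in s & P = N `&` R.
Proof.
move=> cR [pP primeP] AP; have rR := pullback_subring cR; have [idP _] := pP.
have P1 : ~ P 1 by apply/(proper_ideal1 rR idP).
have [N Ns PN] := pullback_sub_maximal cR idP P1 AP.
have [PR _ _ _] := idP; have RT := pullback_sub cR.
exists N => //; apply/seteqP; split=> [x Px|x [Nx Rx]].
  by split; [apply: PN|apply: PR].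
have [e [Re Ne He]] := pullback_idem cR Ns.
have [NT N0 ND NM] := pullback_ideal cR Ns.
have [] // := primeP x e Rx Re.
  apply: AP => [|M Ms].
    by apply: subringM; [case: (pullback_ded cR)|apply: RT|apply: RT].
  have [->|MN] := pselect (M = N); first by rewrite mulrC; apply: NM => //; apply: RT.
  by have [_ _ _ MM] := pullback_ideal cR Ms; apply: MM; [apply: RT|apply: He].
move/PN => Ne'; exfalso; apply: (pullback_proper cR Ns).
by rewrite -[1](subrK e); apply: ND.
Qed.

Lemma pullback_maximal R T s N : pullback_of R T s -> N \in s -> maximal_ideal R (N `&` R).
Proof.
move=> cR Ns; have rR := pullback_subring cR; have RT := pullback_sub cR.
have [NT N0 ND NM] := pullback_ideal cR Ns.
apply: maximalP => //.
- exact: ideal_meet (pullback_ideal cR Ns).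
- by case=> /(pullback_proper cR Ns).
- move=> x Rx nNx; have [|y Ry Ny] := pullback_inv cR Ns Rx.
    by move=> Nx; apply: nNx.
  exists y => //; split=> //; apply: subringB => //; first exact: subring1.
  exact: subringM.
Qed.

Lemma pullback_unibranched R T s : pullback_of R T s -> unibranched R T.
Proof.
move=> cR P pP; have rR := pullback_subring cR; have RT := pullback_sub cR.
have dT := pullback_ded cR; have rT := proj1 dT.
have [[idP _] primeP] := pP; have [PR P0 PD PM] := idP.
have P1 : ~ P 1 by case: pP => pP _; apply/(proper_ideal1 rR idP).
have AM x y : T y -> T x -> (forall N, N \in s -> N x) -> T (x * y) /\ forall N, N \in s -> N (x * y).
  move=> Ty Tx Hx; split=> [|N Ns]; first exact: subringM.
  by have [_ _ _ NM] := pullback_ideal cR Ns; rewrite mulrC; apply: NM => //; apply: Hx.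
have AR x : T x /\ (forall N, N \in s -> N x) -> R x by case; apply: (pullback_meet cR).
have [AP|] := pselect (forall x, T x -> (forall N, N \in s -> N x) -> P x).
  have [N Ns EP] := pullback_prime_meet cR pP AP.
  exists N; split; first by split=> //; apply/maximal_prime/(pullback_max cR).
  move=> Q [pQ EQ].
  have AQ x : T x -> (forall N, N \in s -> N x) -> Q x.
    by move=> Tx Hx; have := AP x Tx Hx; rewrite -EQ => -[].
  have [M Ms EM] := pullback_prime_meet (pullback_top cR) pQ AQ.
  have {}EM : Q = M.
    by rewrite EM; apply/seteqP; split=> x; [case|move=> Mx; split=> //; case: (pullback_ideal cR Ms) => MT _ _ _; apply: MT].
  rewrite EM; apply: contrapT => NM.
  have [e [Re Ne He]] := pullback_idem cR Ns.
  have : (Q `&` R) e by split=> //; rewrite EM; apply: He => //; apply: nesym.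
  rewrite EQ EP => -[Ne' _]; apply: (pullback_proper cR Ns); rewrite -[1](subrK e).
  by case: (pullback_ideal cR Ns) => _ _ ND _; apply: ND.
move=> /existsNP[a /not_implyP[Ta /not_implyP[Ha nPa]]].
have Ra : R a by apply: AR.
have RaT t : T t -> R (a * t) by move=> Tt; apply/AR/AM.
(* The only candidate: since a is in R outside P and a T lies in R, a prime of T over P contains t
   exactly when P contains a t. *)
pose Q := [set t | T t /\ P (a * t)].
have EQ : Q `&` R = P.
  apply/seteqP; split=> [x [[Tx Pax] Rx]|x Px].
    by have [] := primeP _ _ Ra Rx Pax.
  by split; [split; [apply/RT/PR|apply: PM]|apply: PR].
exists Q; split.
  split=> //; have idQ : ideal T Q.
    split=> [x []//||x y [Tx Px] [Ty Py]|x y Tx [Ty Py]].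
    - by split; rewrite ?mulr0 //; apply: subring0.
    - by split; [apply: subringD|rewrite mulrDr; apply: PD].
    - split; first exact: subringM.
      have : P (a * x * (a * y)) by apply: PM => //; apply: RaT.
      have -> : a * x * (a * y) = a * (a * (x * y)) by ring.
      by case/primeP => //; apply: RaT; apply: subringM.
  split; first by apply/(proper_ideal1 rT idQ) => -[_]; rewrite mulr1.
  move=> x y Tx Ty [Txy Pxy].
  have : P (a * x * (a * y)).
    have -> : a * x * (a * y) = a * (a * (x * y)) by ring.
    exact: PM.
  by case/(primeP _ _ (RaT _ Tx) (RaT _ Ty)) => ?; [left|right].
move=> Q' [[[idQ' _] primeQ'] EQ']; have [Q'T _ _ Q'M] := idQ'.
apply/seteqP; split=> [t [Tt Pat]|t Qt].
  have : Q' (a * t) by move: Pat; rewrite -EQ' => -[].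
  case/(primeQ' _ _ Ta Tt) => // Q'a; exfalso; apply: nPa.
  by rewrite -EQ'.
have Tt := Q'T _ Qt; split=> //.
rewrite -EQ'; split; first exact: Q'M.
exact: RaT.
Qed.

Lemma pullback_gpvd R T s : pullback_of R T s -> gpvd R.
Proof.
move=> cR; have rR := pullback_subring cR; have RT := pullback_sub cR.
have dT := pullback_ded cR; have rT := proj1 dT.
exists T; split=> //; [by split=> // M; apply: ded_valuation|exact: pullback_unibranched cR|].
pose I := [set x | T x /\ forall N, N \in s -> N x].
have [a [Ta a0 Ha]] := pullback_meet_nonzero cR.
have IR x : I x -> R x by case; apply: (pullback_meet cR).
have rad x n N : N \in s -> T x -> N (x ^+ n) -> N x.
  move=> Ns Tx; elim: n => [|n IH]; first by rewrite expr0 => /(pullback_proper cR Ns).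
  by rewrite exprS => /(pullback_prime cR Ns Tx (subringX rT _ Tx))[].
have idI : ideal T I.
  split=> [x []//||x y [Tx Hx] [Ty Hy]|x y Tx [Ty Hy]].
  - by split=> [|N Ns]; [exact: subring0|case: (pullback_ideal cR Ns)].
  - split=> [|N Ns]; first exact: subringD.
    by case: (pullback_ideal cR Ns) => _ _ ND _; apply: ND; [apply: Hx|apply: Hy].
  - split=> [|N Ns]; first exact: subringM.
    by case: (pullback_ideal cR Ns) => _ _ _; apply=> //; apply: Hy.
have [IT I0 ID IM] := idI.
exists I; split.
- by apply: (nz_set (x := a)).
- by split=> // x n Tx [_ H]; split=> // N Ns; apply: (rad x n) => //; apply: H.
- split.
    by split=> // r x Rr Ix; apply: IM => //; apply: RT.
  by move=> x n Rx [_ H]; split=> [|N Ns]; [exact: RT|apply: (rad x n) => //; [apply: RT|apply: H]].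
- move=> Q pQ IQ; apply: (ded_prime_maximal dT pQ _ a0).
  by apply: IQ.
- move=> P pP IP; have [|N Ns ->] := pullback_prime_meet cR pP.
    by move=> x Tx Hx; apply: IP.
  exact: pullback_maximal cR Ns.
Qed.

Section Mori.
Variables (R T : set K) (s : seq (set K)).
Hypothesis cR : pullback_of R T s.
Let rR : subring R := pullback_subring cR.
Let dT : ded T := pullback_ded cR.
Let rT : subring T := proj1 dT.
Let RT : R `<=` T := pullback_sub cR.

(* With H = I T, the image of a divisorial ideal I in the one-dimensional
   (T / N)-space H / N H is either everything or one-dimensional over K_N: a
   chain of divisorial ideals with the same H thus jumps at most once at N. *)
Lemma pullback_divisorial_dichotomy I N e h0 h1 : divisorial_ideal R I -> N \in s ->
  R e -> (forall M, M \in s -> M <> N -> M e) ->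
  I h0 -> I h1 -> ~ ideal_mul N (ideal_mul T I) h0 ->
  (forall r, R r -> ~ ideal_mul N (ideal_mul T I) (h1 - r * h0)) ->
  forall h, ideal_mul T I h -> I (e * h).
Proof.
move=> [idI divI] Ns Re He Ih0 Ih1; set H := ideal_mul T I => nh0 nh1 h Hh.
have [IR I0 ID IM] := idI; have mN := pullback_max cR Ns.
have [NT N0 ND NM] := pullback_ideal cR Ns.
have IH : I `<=` H := @sub_ideal_extend _ T I rT.
have idH : ideal T H := ideal_extend rT RT idI.
rewrite -divI => x xI.
have xH g : H g -> T (x * g).
  move: g; apply: (ideal_mul_ind (X := [set g | T (x * g)])) => /= [|y z Hy Hz|t i Tt Ii].
  - by rewrite mulr0; apply: subring0.
  - by rewrite mulrDr; apply: subringD.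
  - by rewrite mulrCA; apply: subringM => //; apply/RT/xI.
have Txh : T (x * h) by apply: xH.
rewrite -mulrA [h * x]mulrC; apply: (pullback_meet cR).
  by apply: subringM => //; apply: RT.
move=> M Ms; have [_ _ _ MM] := pullback_ideal cR Ms.
have [->|MN] := pselect (M = N); last by rewrite [e * _]mulrC; apply: MM => //; apply: He.
apply: (NM); first exact: RT.
(* If x h is outside N, so is x h0, because h0 generates H at N. An inverse of x h0 modulo N exists
   in R, which makes h1 an R-multiple of h0 modulo N H, against the choice of h1. *)
apply: contrapT => nNxh.
have h00 : h0 <> 0 by move=> E; apply: nh0; rewrite E; apply: ideal_mul0.
have [c Hc nNc] : exists2 c, colon T H c & ~ N (h0 * c).
  apply: contrapT => nc; apply: nh0; rewrite -[h0]mulr1.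
  apply: (ideal_mul_ind (X := [set g | ideal_mul N H (h0 * g)])) (ded_inv dT idH (IH _ Ih0) h00) => /=.
  - by rewrite mulr0; apply: ideal_mul0.
  - by move=> y z Hy Hz; rewrite mulrDr; apply: ideal_mulD.
  - move=> a b Ha Hb; rewrite mulrCA [a * _]mulrC; apply: ideal_mul_in => //.
    by apply: contrapT => nN; apply: nc; exists b => //.
have Th0c : T (h0 * c) by rewrite mulrC; apply: Hc; apply: IH.
have [v Tv Nv] := maximal_inv rT mN Th0c nNc.
have nNxh0 : ~ N (x * h0).
  move=> Nxh0; apply: nNxh.
  have -> : x * h = (x * h) * (1 - h0 * c * v) + (c * h * v) * (x * h0) by ring.
  by apply: ND; apply: NM => //; apply: subringM => //; apply: Hc.
have [y Ry Ny] := pullback_inv cR Ns (xI _ Ih0) nNxh0.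
apply: (nh1 (x * h1 * y)); first by apply: subringM => //; apply: xI.
have -> : h1 - x * h1 * y * h0 = (1 - x * h0 * y) * h1 by ring.
by apply: ideal_mul_in => //; apply: IH.
Qed.

Lemma pullback_mori : mori R.
Proof.
move=> I divI mI.
have mono m n : (m <= n)%N -> I m `<=` I n.
  elim: n => [|n IH]; first by rewrite leqn0 => /eqP->.
  by rewrite leq_eqVlt => /orP[/eqP->//|/IH sub x /sub]; apply: mI.
have idI n : ideal R (I n) by case: (divI n).
have ITI n : I n `<=` ideal_mul T (I n) := @sub_ideal_extend _ T (I n) rT.
have idTI n : ideal T (ideal_mul T (I n)) := ideal_extend rT RT (idI n).
have [||n0 Hn0] := ded_noetherian dT (I := fun n => ideal_mul T (I n)).
- exact: idTI.
- by move=> n; apply: ideal_mulS.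
(* I n agrees at N with the common extension to T. From n1 on, no further N of the finite list
   becomes full. *)
pose full n N := exists2 e, (R e /\ N (1 - e)) & forall h, ideal_mul T (I n0) h -> I n (e * h).
have [n1 n01 Hn1] : exists2 n1, (n0 <= n1)%N &
    forall N n, N \in s -> full n N -> full n1 N.
  elim: (s) => [|N t [n1 n01 Hn1]]; first by exists n0.
  have [m Hm] : exists m, forall n, full n N -> full m N.
    have [[n Hn]|nH] := pselect (exists n, full n N); first by exists n.
    by exists 0%N => n Hn; exfalso; apply: nH; exists n.
  have fm k l M : (k <= l)%N -> full k M -> full l M.
    by move=> kl [e He H]; exists e => // h /H; apply: mono.
  exists (maxn n1 m); first by rewrite (leq_trans n01) // leq_maxl.
  move=> M n; rewrite inE => /orP[/eqP->|Mt].
    by move/Hm; apply: fm; apply: leq_maxr.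
  by move/(Hn1 _ _ Mt); apply: fm; apply: leq_maxl.
exists n1 => n n1n; apply/seteqP; split; last exact: mono.
move=> x Ix; set H := ideal_mul T (I n0) in full Hn1.
have EH k : (n0 <= k)%N -> ideal_mul T (I k) = H by move/Hn0.
have n0n := leq_trans n01 n1n.
have Hx : H x by rewrite -(EH _ n0n); apply: ITI.
have [IR I0 ID IM] := idI n1.
have [x0|/eqP x0] := eqVneq x 0; first by rewrite x0.
have AH a h : T a -> (forall N, N \in s -> N a) -> H h -> I n1 (a * h).
  move=> Ta Ha; rewrite -(EH _ n01); move: h.
  apply: (ideal_mul_ind (X := [set h | I n1 (a * h)])) => /= [|y z Hy Hz|t i Tt Ii].
  - by rewrite mulr0.
  - by rewrite mulrDr; apply: ID.
  - rewrite mulrA; apply: IM => //; apply: (pullback_meet cR); first exact: subringM.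
    move=> N Ns; have [_ _ _ NM] := pullback_ideal cR Ns.
    by rewrite mulrC; apply: NM => //; apply: Ha.
have loc N : N \in s -> exists2 e, R e /\ N (1 - e) & I n1 (e * x).
  move=> Ns; have [fn|nfn] := pselect (full n N).
    by have [e He Hf] := Hn1 _ _ Ns fn; exists e => //; apply: Hf.
  have [e [Re Ne He]] := pullback_idem cR Ns; exists e => //.
  have mN := pullback_max cR Ns; have [NT N0 ND NM] := pullback_ideal cR Ns.
  have idH : ideal T H by apply: idTI.
  have [h0 Ih0 nh0] : exists2 h0, I n1 h0 & ~ ideal_mul N H h0.
    apply: contrapT => nex.
    have HNH : H `<=` ideal_mul N H.
      have [H1 H2 H3] := ideal_mul_submodule H (ideal_submodule (pullback_ideal cR Ns)).
      rewrite -{1}(EH _ n01); apply: ideal_mul_ind => // t i Tt Ii; apply: H3 => //.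
      by apply: contrapT => ni; apply: nex; exists i.
    apply: (maximal_ideal1 rT mN).
    apply: (ideal_mul_ind (X := N)) (ded_inv dT idH Hx x0) => // a b /HNH Ha Hb.
    move: a Ha; apply: (ideal_mul_ind (X := [set a | N (a * b)])) => /= [|y z Hy Hz|y z Ny Hz].
    - by rewrite mul0r.
    - by rewrite mulrDl; apply: ND.
    - by rewrite -mulrA mulrC; apply: NM => //; rewrite mulrC; apply: Hb.
  (* I n is not full at N; by the dichotomy, with h0 taken from the smaller I n1, x must be an
     R-multiple of h0 modulo N H. *)
  have [r Rr Hr] : exists2 r, R r & ideal_mul N H (x - r * h0).
    apply: contrapT => nr; apply: nfn; exists e => //.
    rewrite -(EH _ n0n).
    apply: (pullback_divisorial_dichotomy (h0 := h0) (h1 := x) (divI n) Ns Re He) => //.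
    - exact: mono Ih0.
    - by rewrite (EH _ n0n).
    - by rewrite (EH _ n0n) => r Rr Hr; apply: nr; exists r.
  have -> : e * x = (e * r) * h0 + e * (x - r * h0) by ring.
  apply: (ID); first by apply: IM => //; apply: subringM.
  move: {Rr} (x - r * h0) Hr.
  apply: (ideal_mul_ind (X := [set z | I n1 (e * z)])) => /= [|y z Hy Hz|y z Ny Hz].
  - by rewrite mulr0.
  - by rewrite mulrDr; apply: ID.
  - rewrite mulrA; apply: AH => //.
      by apply: subringM => //; [apply: RT|apply: NT].
    move=> M Ms; have [_ _ _ MM] := pullback_ideal cR Ms.
    have [->|MN] := pselect (M = N); first by apply: NM => //; apply: RT.
    by rewrite mulrC; apply: MM; [apply: NT|apply: He].
(* The local multipliers are glued to one z; the rest (1 - z) x lies in A H, with A the meet of s,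
   and I n1 contains A H. *)
have [z [Rz Hz Iz]] : exists z, [/\ R z, forall N, N \in s -> N (1 - z) & I n1 (z * x)].
  have : {subset s <= s} by [].
  elim: {1 3}s => [_|N t IHt Ht].
    by exists 0; split=> //; [exact: subring0|rewrite mul0r].
  have [|z [Rz Hz Iz]] := IHt; first by move=> M Mt; apply: Ht; rewrite inE Mt orbT.
  have [|e [Re Ne] Ie] := loc N; first by apply: Ht; rewrite inE eqxx.
  have R1 u : R u -> R (1 - u) by move=> Ru; apply: subringB => //; apply: subring1.
  exists (z + (1 - z) * e); split.
  - by apply: subringD => //; apply: subringM => //; apply: R1.
  - have -> : 1 - (z + (1 - z) * e) = (1 - z) * (1 - e) by ring.
    move=> M Mt; have [_ _ _ MM] := pullback_ideal cR (Ht _ Mt).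
    move: Mt; rewrite inE => /orP[/eqP EM|Mt]; last first.
      by rewrite mulrC; apply: MM; [apply/RT/R1|apply: Hz].
    by apply: MM; [apply/RT/R1|rewrite EM].
  - rewrite mulrDl -mulrA; apply: ID => //; apply: IM => //; exact: R1.
have -> : x = (1 - z) * x + z * x by ring.
apply: (ID); last by [].
by apply: AH => //; apply: RT; apply: subringB => //; apply: subring1.
Qed.

End Mori.
End PullbackGPVD.

(** * Mori globalized pseudo-valuation domains *)

Section MoriGPVD.
Variable K : fieldType.
Implicit Types (R S T I J L M N P X : set K) (s : seq (set K)) (l : seq K).

Definition span T l : set K := foldr (fun a J => ideal_gen T J a) [set 0] l.

Section Span.
Variable T : set K.
Hypothesis rT : subring T.

Lemma span_ideal l : (forall x, x \in l -> T x) -> ideal T (span T l).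
Proof.
elim: l => [_|a l IH H] /=; first exact: ideal0.
apply: ideal_gen_ideal => //; first by apply: IH => x xl; apply: H; rewrite inE xl orbT.
by apply: H; rewrite inE eqxx.
Qed.

Lemma span_mem l x : (forall x, x \in l -> T x) -> x \in l -> span T l x.
Proof.
elim: l => // a l IH H; have Tl y : y \in l -> T y by move=> yl; apply: H; rewrite inE yl orbT.
rewrite inE => /orP[/eqP->|xl].
  by apply: (ideal_gen_mem rT); case: (span_ideal Tl).
by apply: (ideal_gen_sub rT); apply: IH.
Qed.

Lemma span_sub J l : ideal T J -> (forall x, x \in l -> J x) -> span T l `<=` J.
Proof.
move=> [JT J0 JD JM]; elim: l => [_ _ ->//|a l IH H] /=.
move=> _ [i Hi [t Tt ->]]; apply: JD.
  by apply: IH => // x xl; apply: H; rewrite inE xl orbT.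
by apply: JM => //; apply: H; rewrite inE eqxx.
Qed.

(** In the valuation ring at M, one of the current generator y and the new element a divides the
    other; u collects the denominators. *)
Lemma prufer_span_local M l : maximal_ideal T M -> valuation_domain (localization T M) ->
  (forall x, x \in l -> T x) ->
  exists y u, [/\ span T l y, T u, ~ M u & forall x, span T l x -> exists2 t, T t & u * x = y * t].
Proof.
move=> mM [_ val]; have [_ primeM] := maximal_prime rT mM.
have M1 := maximal_ideal1 rT mM; have [[[_ M0 _ _] _] _] := mM.
have T1 := subring1 rT; have T0 := subring0 rT.
have qf x : T x -> localization T M x by move=> Tx; exists x, 1; rewrite divr1.
elim: l => [_|a l IH H].
  by exists 0, 1; split=> // _ ->; exists 0; rewrite ?mulr0.
have Ta : T a by apply: H; rewrite inE eqxx.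
have Tl x : x \in l -> T x by move=> xl; apply: H; rewrite inE xl orbT.
have [y [u [Sy Tu nMu Hu]]] := IH Tl.
have idS := span_ideal Tl; have [ST S0 _ _] := idS.
have [->|/eqP a0] := eqVneq a 0.
  exists y, u; split=> //; first exact: ideal_gen_sub.
  by move=> _ [i /Hu[t Tt Et] [r Rr ->]]; exists t; rewrite // mulr0 addr0.
have [y0|/eqP y0] := eqVneq y 0.
  exists a, 1; split=> //; first exact: ideal_gen_mem.
  move=> _ [i /Hu[t Tt Et] [r Rr ->]]; exists r => //.
  have -> : i = 0; last by ring.
  move/eqP: Et; rewrite y0 mul0r mulf_eq0 => /orP[/eqP u0|/eqP//].
  by case: nMu; rewrite u0.
have ay0 : a / y <> 0 by apply/eqP; rewrite mulf_neq0 ?invr_eq0; apply/eqP.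
have [|[p [q [Tp Tq nMq E]]]|[p [q [Tp Tq nMq E]]]] := val (a / y) _ ay0.
- by exists a, y; split=> //; apply: qf => //; apply: ST.
- have q0 : q != 0 by apply/eqP => q0; apply: nMq; rewrite q0.
  have {}E : q * a = y * p.
    by rewrite -[a](divfK (x := y)) ?E; [field|apply/eqP].
  exists y, (u * q); split; [exact: ideal_gen_sub|exact: subringM|by case/(primeM _ _ Tu Tq)|].
  move=> _ [i /Hu[t Tt Et] [r Rr ->]]; exists (q * t + u * r * p).
    by apply: subringD => //; do !apply: subringM => //.
  have -> : u * q * (i + r * a) = q * (u * i) + u * r * (q * a) by ring.
  by rewrite Et E; ring.
- have q0 : q != 0 by apply/eqP => q0; apply: nMq; rewrite q0.
  have {}E : q * y = a * p.
    have aU : a != 0 by apply/eqP.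
    have yU : y != 0 by apply/eqP.
    have <- : (a / y)^-1 * a = y by field; rewrite aU yU.
    by rewrite E; field.
  exists a, (u * q); split; [exact: ideal_gen_mem|exact: subringM|by case/(primeM _ _ Tu Tq)|].
  move=> _ [i /Hu[t Tt Et] [r Rr ->]]; exists (p * t + u * q * r).
    by apply: subringD => //; do !apply: subringM => //.
  have -> : u * q * (i + r * a) = q * (u * i) + u * r * (q * a) by ring.
  by rewrite Et mulrA E; ring.
Qed.

Lemma prufer_span_invertible l x : prufer T -> (forall z, z \in l -> T z) ->
  span T l x -> x <> 0 -> invertible T (span T l).
Proof.
move=> [_ val] Tl Sx x0; have idS := span_ideal Tl.
apply: contrapT => nX; have idX := colon_mul_ideal rT idS (@subset_refl _ _).
have [M mM XM] := max_ex rT idX nX.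
have [y [u [Sy Tu nMu Hu]]] := prufer_span_local mM (val _ mM) Tl.
have [[[_ M0 _ _] _] _] := mM.
have y0 : y != 0.
  apply/eqP => y0; have [t _ /eqP] := Hu _ Sx.
  rewrite y0 mul0r mulf_eq0 => /orP[]/eqP // u0.
  by apply: nMu; rewrite u0.
apply: nMu; apply: XM; have -> : u = y * (u / y) by rewrite mulrCA divff ?mulr1.
apply: ideal_mul_in => // z /Hu[t Tt E].
by rewrite mulrAC E mulrAC divff // mul1r.
Qed.

Lemma invertible_local J M : maximal_ideal T M -> ideal T J -> invertible T J ->
  exists y u, [/\ J y, T u, ~ M u & forall x, J x -> exists2 t, T t & u * x = y * t].
Proof.
move=> mM idJ invJ; have [[[MT M0 MD MM] _] _] := mM.
apply: contrapT => H; apply: (maximal_ideal1 rT mM).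
apply: (ideal_mul_ind (X := M)) invJ => // a b Ja Hb.
apply: contrapT => nM; apply: H; exists a, (a * b); split=> //.
  by rewrite mulrC; apply: Hb.
by move=> x Jx; exists (b * x); [apply: Hb|rewrite mulrA].
Qed.

End Span.

(** Let F = R : T. For b in T : J and t in T, b t maps F J into R. So x in R : (R : F J) satisfies x
    b T inside R, that is, x b in F, and expanding 1 in J (T : J) gives x in F J. *)
Lemma colon_mul_divisorial R T J : subring R -> subring T -> R `<=` T -> ideal T J ->
  invertible T J -> divisorial_ideal R (ideal_mul (colon R T) J).
Proof.
move=> rR rT RT [JT J0 JD JM] invJ.
have FR : colon R T `<=` R by move=> x Fx; rewrite -[x]mulr1; apply: Fx; apply: subring1.
have FT x t : colon R T x -> T t -> colon R T (x * t).
  by move=> Fx Tt y Ty; rewrite -mulrA; apply: Fx; apply: subringM.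
split.
  have [H1 H2 H3] := ideal_mul_submodule J (colon_submodule T rR).
  split=> //; apply: ideal_mul_ind; [exact: subring0|exact: subringD|].
  by move=> a b Fa /JT; apply: Fa.
apply/seteqP; split=> [x Hx|x Hx y Hy]; last by rewrite mulrC; apply: Hy.
rewrite -[x]mulr1.
apply: (ideal_mul_ind (X := [set z | ideal_mul (colon R T) J (x * z)])) invJ => /=.
- by rewrite mulr0; apply: ideal_mul0.
- by move=> y z Hy Hz; rewrite mulrDr; apply: ideal_mulD.
- move=> a b Ja Hb; rewrite mulrCA mulrC; apply: ideal_mul_in => // t Tt.
  rewrite -mulrA; apply: Hx; apply: ideal_mul_ind.
  + by rewrite /= mulr0; apply: subring0.
  + by move=> y z Hy Hz; rewrite mulrDr; apply: subringD.
  + move=> f j Ff Jj.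
    have -> : b * t * (f * j) = f * (b * j * t) by ring.
    by apply: Ff; apply: subringM => //; apply: Hb.
Qed.

(* I T_N is a radical ideal of the valuation ring T_N, hence prime, so its
   contraction to T is a prime ideal between I and N. *)
Lemma radical_prufer_local T I N b : prufer T -> radical_ideal T I ->
  (forall Q, prime_ideal T Q -> I `<=` Q -> maximal_ideal T Q) ->
  maximal_ideal T N -> I `<=` N -> N b -> exists u, [/\ T u, ~ N u & I (u * b)].
Proof.
move=> [rT val] [idI radI] primeI mN IN Nb.
have [IT I0 ID IM] := idI; have [_ primeN] := maximal_prime rT mN.
have N1 := maximal_ideal1 rT mN; have [[[NT N0 ND NM] _] _] := mN.
pose P := [set x | T x /\ exists u, [/\ T u, ~ N u & I (u * x)]].
have T1 := subring1 rT.
have nN x y : T x -> T y -> ~ N x -> ~ N y -> ~ N (x * y) by move=> Tx Ty ? ? /(primeN _ _ Tx Ty)[].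
have idP : ideal T P.
  split=> [x []//||x y [Tx [u [Tu nu Iu]]] [Ty [v [Tv nv Iv]]]|r x Tr [Tx [u [Tu nu Iu]]]].
  - by split; [exact: subring0|exists 1; rewrite mulr0].
  - split; first exact: subringD.
    exists (u * v); split; [exact: subringM|exact: nN|].
    have -> : u * v * (x + y) = v * (u * x) + u * (v * y) by ring.
    by apply: ID; apply: IM.
  - split; first exact: subringM.
    by exists u; split=> //; rewrite mulrCA; apply: IM.
have IP : I `<=` P.
  by move=> x Ix; split; [exact: IT|exists 1; rewrite mul1r].
have sq x u : T x -> T u -> ~ N u -> I (u * (x * x)) -> P x.
  move=> Tx Tu nu Iu; split=> //; exists u; split=> //.
  apply: (radI (u * x) 2%N); first exact: subringM.
  rewrite expr2; have -> : u * x * (u * x) = u * (u * (x * x)) by ring.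
  exact: IM.
(* At N, x is a multiple of y, so that x y in P puts x^2 into P; radicality of I then gives x in
   P. *)
have key x y p q u : T x -> T y -> T p -> T q -> ~ N q -> q * x = y * p -> T u -> ~ N u ->
    I (u * (x * y)) -> P x.
  move=> Tx Ty Tp Tq nq E Tu nu Iu; apply: (sq x (u * q)) => //; [exact: subringM|exact: nN|].
  have -> : u * q * (x * x) = u * x * (q * x) by ring.
  rewrite E; have -> : u * x * (y * p) = p * (u * (x * y)) by ring.
  exact: IM.
have P0 : P 0 by case: idP.
have pP : prime_ideal T P.
  split.
    apply/(proper_ideal1 rT idP) => -[_ [u [_ nu]]]; rewrite mulr1 => /IN; exact: nu.
  move=> x y Tx Ty [Txy [u [Tu nu Iu]]].
  have [->|x0] := eqVneq x 0; first by left.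
  have [->|y0] := eqVneq y 0; first by right.
  have [_ /(_ (x / y))] := val _ mN.
  have qf z : T z -> localization T N z by move=> Tz; exists z, 1; rewrite divr1.
  case.
  - by exists x, y; split=> //; [apply: qf|apply: qf|apply/eqP].
  - by apply/eqP; rewrite mulf_neq0 ?invr_eq0.
  - case=> p [q [Tp Tq nq E]]; left; apply: (key x y p q u) => //.
    have q0 : q != 0 by apply/eqP => q0; apply: nq; rewrite q0.
    by rewrite -[x](divfK y0) E; field.
  - case=> p [q [Tp Tq nq E]]; right; apply: (key y x p q u) => //; last by rewrite [y * x]mulrC.
    have q0 : q != 0 by apply/eqP => q0; apply: nq; rewrite q0.
    have <- : (x / y)^-1 * x = y by field; rewrite x0 y0.
    by rewrite E; field.
have PN : P `<=` N by move=> x [Tx [u [Tu nu /IN/(primeN _ _ Tu Tx)[]]]].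
have EN := maximal_eq rT (primeI _ pP IP) (proj1 (proj1 mN)) N1 PN.
by have [] : P b by rewrite -EN.
Qed.

Section MoriPrufer.
Variables (R T I : set K) (a : K).
Hypotheses (rR : subring R) (mR : mori R) (pT : prufer T) (RT : R `<=` T).
Hypotheses (radT : radical_ideal T I) (IR : I `<=` R) (Ia : I a) (a0 : a <> 0).
Hypothesis primeI : forall Q, prime_ideal T Q -> I `<=` Q -> maximal_ideal T Q.
Let rT : subring T := proj1 pT.
Let F := colon R T.

(* If 1 \notin B, then some N contains B, hence F = F B and I; locally at N we
   have B = b T_N and b \in N T_N = I T_N \subset F T_N = b F T_N, whence
   1 \in F T_N. *)
Lemma conductor_mul_cancel B : ideal T B -> invertible T B -> F `<=` ideal_mul F B -> B 1.
Proof.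
move=> idB invB FB; have [[IT I0 ID IM] _] := radT; have [BT B0 BD BM] := idB.
have FT x : F x -> T x by move=> Fx; apply: RT; rewrite -[x]mulr1; apply: Fx; apply: subring1.
have IF : I `<=` F by move=> x Ix t Tt; apply: IR; rewrite mulrC; apply: IM.
apply: contrapT => B1; have [N mN BN] := max_ex rT idB B1.
have [[[NT N0 ND NM] _] _] := mN; have [_ primeN] := maximal_prime rT mN.
have FN : F `<=` N.
  move=> x /FB; apply: ideal_mul_ind => // f b Ff /BN Nb.
  by apply: NM => //; apply: FT.
have IN : I `<=` N by apply: subset_trans FN.
have [b [u [Bb Tu nu Hu]]] := invertible_local rT mN idB invB.
have [v [Tv nv Iv]] := radical_prufer_local pT radT primeI mN IN (BN _ Bb).
have b0 : b != 0.
  apply/eqP => b0; have B0' z : B z -> z = 0.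
    move=> Bz; have [t _ /eqP] := Hu _ Bz; rewrite b0 mul0r mulf_eq0 => /orP[]/eqP // u0.
    by case: nu; rewrite u0.
  apply: a0; move: (FB _ (IF _ Ia)); apply: (ideal_mul_ind (X := [set 0])) => //=.
    by move=> y z -> ->; rewrite addr0.
  by move=> f z _ /B0' ->; rewrite mulr0.
have [t Ft Et] : exists2 t, F t & u * (v * b) = b * t.
  move: (FB _ (IF _ Iv)).
  apply: (ideal_mul_ind (X := [set z | exists2 t, F t & u * z = b * t])) => /=.
  - by exists 0; rewrite ?mulr0 // => t _; rewrite mul0r; apply: subring0.
  - move=> y z [t Ft Et] [t' Ft' Et']; exists (t + t'); last by rewrite !mulrDr Et Et'.
    by have [_ FD _] := colon_submodule T rR; apply: FD.
  - move=> f z Ff /Hu[t Tt Et]; exists (f * t); last by rewrite mulrCA Et mulrCA.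
    by move=> w Tw; rewrite -mulrA; apply: Ff; apply: subringM.
have : N (u * v).
  have -> : u * v = t; last exact: FN.
  by apply: (mulfI b0); rewrite -Et; ring.
by case/(primeN _ _ Tu Tv).
Qed.

(* For finitely generated S, the ideal F S is divisorial in R, so that ascending
   chains of finitely generated ideals of T are stationary. *)
Lemma mori_prufer_ded : ded T.
Proof.
split=> // J idJ J0; have [JT Jz JD JM] := idJ; have [j Jj j0] := set_nz Jz J0.
apply: contrapT => ninv.
(* The common entry j keeps all spans nonzero, hence invertible. *)
pose D := {l : seq K | j \in l /\ forall x, x \in l -> J x}.
have DT (d : D) x : x \in sval d -> T x by case: (svalP d) => _ H /H /JT.
pose S (d : D) := span T (sval d).
have idS d : ideal T (S d) := span_ideal rT (@DT d).
have Sj d : S d j by apply: (span_mem rT (@DT d)); case: (svalP d).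
have invS d : invertible T (S d) := prufer_span_invertible rT pT (@DT d) (Sj d) j0.
have next (d : D) : {e : D | S d `<` S e}.
  apply: cid; have SJ : S d `<=` J by apply: span_sub => //; case: (svalP d).
  have [x Jx nSx] : exists2 x, J x & ~ S d x.
    apply: contrapT => H; apply: ninv; have <- : S d = J; last exact: invS.
    by apply/seteqP; split=> // x Jx; apply: contrapT => nx; apply: H; exists x.
  have Hxd : j \in x :: sval d /\ forall y, y \in x :: sval d -> J y.
    case: (svalP d) => jd Jd; split; first by rewrite inE jd orbT.
    by move=> y; rewrite inE => /orP[/eqP->|/Jd].
  pose e : D := exist _ (x :: sval d) Hxd.
  exists e; split; first exact: ideal_gen_sub.
  move=> sub; apply: nSx; apply: sub; apply: (span_mem rT (@DT e)).
  by rewrite inE eqxx.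
have Hj : j \in [:: j] /\ forall x, x \in [:: j] -> J x.
  by rewrite inE eqxx; split=> // x; rewrite inE => /eqP->.
pose f n := iter n (fun d => sval (next d)) (exist _ [:: j] Hj : D).
have fS n : S (f n) `<` S (f n.+1) := svalP (next (f n)).
have [n|n|n /(_ n.+1 (leqnSn n)) E] := mR (I := fun n => ideal_mul F (S (f n))).
- exact: colon_mul_divisorial.
- by apply: ideal_mulS => //; case: (fS n).
have [sub nsub] := fS n; apply: nsub; set S0 := S (f n) in E sub *; set S1 := S (f n.+1) in E sub *.
have id1 : ideal T S1 by apply: idS.
have id0 : ideal T S0 by apply: idS.
have [S0T _ _ _] := id0.
(* B is the quotient of S0 by S1 among the invertible ideals: F S0 = F S1 gives F inside F B, and 1
   in B means S1 inside S0. *)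
pose B := ideal_mul S0 (colon T S1).
have idB : ideal T B := colon_mul_ideal rT id0 sub.
have inv1 : invertible T S1 by apply: invS.
have inv0 : invertible T S0 by apply: invS.
have sub1 : ideal_mul S1 (colon T S0) `<=` colon T B.
  apply: ideal_mul_ind; [by case: (colon_submodule B rT)|by case: (colon_submodule B rT)|].
  move=> x y S1x Hy; apply: ideal_mul_ind.
  - by rewrite /= mulr0; apply: subring0.
  - by move=> z w Hz Hw; rewrite mulrDr; apply: subringD.
  - move=> z w S0z Hw; have -> : x * y * (z * w) = (y * z) * (w * x) by ring.
    by apply: subringM => //; [apply: Hy|apply: Hw].
have invB : invertible T B.
  apply: (ideal_mulS (@subset_refl _ B) sub1).
  rewrite /B -ideal_mulA [ideal_mul (colon T S1) _]ideal_mulA [ideal_mul (colon T S1) S1]ideal_mulC.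
  rewrite [ideal_mul _ (colon T S0)]ideal_mulC ideal_mulA -[1]mulr1.
  exact: ideal_mul_in.
have B1 : B 1.
  apply: conductor_mul_cancel => // x Fx; rewrite /B ideal_mulA -E -ideal_mulA -[x]mulr1.
  exact: ideal_mul_in.
move=> x S1x; rewrite -[x]mul1r; move: B1.
apply: (ideal_mul_ind (X := [set z | S0 (z * x)])) => /=.
- by rewrite mul0r; case: id0.
- by move=> y z Hy Hz; rewrite mulrDl; case: id0 => _ _ SD _; apply: SD.
- move=> y z S0y Hz; rewrite -mulrA mulrC; case: id0 => _ _ _; apply=> //; exact: Hz.
Qed.

End MoriPrufer.

Lemma mori_gpvd_pullback R : subring R -> mori R -> gpvd R -> exists T s, pullback_of R T s.
Proof.
move=> rR mR [T [pT RT uRT [I [I0 radT radR maxT maxR]]]].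
have [[IR Iz _ _] _] := radR; have [a Ia a0] := set_nz Iz I0.
have dT : ded T by apply: (mori_prufer_ded (a := a) rR mR pT RT radT IR Ia a0 maxT).
have rT : subring T by case: pT.
have pN N : maximal_ideal T N -> prime_ideal R (N `&` R).
  by move=> mN; apply: (prime_meet rR rT RT); apply: maximal_prime.
exists T; apply: (radical_pullback rR dT RT radT IR Ia a0).
  move=> M N mM mN IM IN E; have [Q [_ uQ]] := uRT _ (pN _ mM).
  by rewrite -(uQ M) ?(uQ N) //; split=> //; apply: maximal_prime.
move=> N x mN IN Rx nNx.
have mNR : maximal_ideal R (N `&` R).
  by apply: (maxR _ (pN _ mN)) => y Iy; split; [apply: IN|apply: IR].
have [|y Ry [Ny _]] := maximal_inv rR mNR Rx; first by case.
by exists y.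
Qed.

End MoriGPVD.

(** * Local TAF-domains *)

Section Local.
Variable K : fieldType.
Implicit Types (R S T I J L M N P X C : set K) (s : seq (set K)).

(** Expanding (x + y)^2 only yields 2 x y. Instead, x y (x + y) is in I, and whichever pair of these
    factors has its product in I, x y is in I. *)
Lemma two_absorbing_square S I X : subring S -> two_absorbing S I -> ideal S X ->
  (forall x, X x -> I (x * x)) -> forall x y, X x -> X y -> I (x * y).
Proof.
move=> rS [[idI _] abI] [XS _ XD _] H x y Xx Xy; have [_ _ ID IM] := idI.
have sI := ideal_submodule idI.
have Sx := XS _ Xx; have Sy := XS _ Xy.
have := abI x y (x + y) Sx Sy (subringD rS Sx Sy).
case=> [|//|h|h].
- have -> : x * y * (x + y) = y * (x * x) + x * (y * y) by ring.
  by apply: (ID); apply: (IM) => //; apply: H.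
- have -> : x * y = x * (x + y) - x * x by ring.
  by apply: (submoduleB rS sI) => //; apply: H.
- have -> : x * y = y * (x + y) - y * y by ring.
  by apply: (submoduleB rS sI) => //; apply: H.
Qed.

Definition local_ring L M : Prop :=
  [/\ subring L, ideal L M, ~ M 1 & forall x, L x -> ~ M x -> L x^-1].

Section LocalRing.
Variables (L M : set K).
Hypothesis locL : local_ring L M.
Let rL : subring L. Proof. by case: locL. Qed.
Let idM : ideal L M. Proof. by case: locL. Qed.
Let M1 : ~ M 1. Proof. by case: locL. Qed.
Let invL x : L x -> ~ M x -> L x^-1. Proof. by case: locL => _ _ _; apply. Qed.
Let ML : M `<=` L. Proof. by case: idM. Qed.
Let MD x y : M x -> M y -> M (x + y). Proof. by case: idM => _ _ + _; apply. Qed.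
Let MM x y : L x -> M y -> M (x * y). Proof. by case: idM => _ _ _; apply. Qed.
Let L1 : L 1. Proof. exact: subring1. Qed.

Lemma local_nz x : ~ M x -> x != 0.
Proof. by move=> nM; apply/eqP => x0; apply: nM; rewrite x0; case: idM. Qed.

Lemma local_proper I : ideal L I -> ~ I 1 -> I `<=` M.
Proof.
move=> [IL _ _ IM] I1 x Ix; apply: contrapT => nMx; apply: I1.
by rewrite -(mulVf (local_nz nMx)); apply: (IM) => //; apply: invL => //; apply: IL.
Qed.

(* Modulo C: the factors of a regular principal ideal of a local ring are
   principal. *)
Lemma local_factor I J C z : ideal L I -> ideal L J -> ideal L C -> C `<=` M -> L z ->
  (forall r, L r -> C (z * r) -> C r) -> ideal_mul I J = ideal_gen L C z ->
  exists a b c u, [/\ I a, J b, C c, L u & ~ M u /\ a * b = c + z * u].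
Proof.
move=> idI idJ idC CM Lz reg E; have [CL C0 CD CMl] := idC.
apply: contrapT => H.
(* If z had only nonunit coefficients in all products a b, it would lie in C + z M, and regularity
   of z modulo C would force 1 into M. *)
have [c Cc [m Mm Ez]] : exists2 c, C c & exists2 m, M m & z = c + z * m.
  have : ideal_mul I J z by rewrite E; apply: ideal_gen_mem.
  apply: (ideal_mul_ind (X := [set w | exists2 c, C c & exists2 m, M m & w = c + z * m])) => /=.
  - by exists 0 => //; exists 0; [case: idM|ring].
  - move=> x y [c Cc [m Mm ->]] [c' Cc' [m' Mm' ->]]; exists (c + c'); first exact: CD.
    by exists (m + m'); [exact: MD|ring].
  - move=> a b Ia Jb; have : ideal_gen L C z (a * b) by rewrite -E; apply: ideal_mul_in.
    case=> c Cc [u Lu Eab]; exists c => //; exists u; last by rewrite Eab mulrC.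
    apply: contrapT => nMu; apply: H; exists a, b, c, u; split=> //.
    by rewrite Eab mulrC.
apply: M1; rewrite -[1](subrK m); apply: (MD) => //; apply: (CM); apply: (reg).
  by apply: subringB => //; apply: ML.
by have -> : z * (1 - m) = c by rewrite mulrBr mulr1 {1}Ez; ring.
Qed.

(** For x in I write x b = c' + r z. Comparing with a b = c + z u gives z (u x - a r) = a c' - x c
    in C; now z can be cancelled modulo C and u inverted. *)
Lemma local_factor_gen I J C z a b c u : ideal L I -> ideal L J -> ideal L C ->
  (forall r, L r -> C (z * r) -> C r) -> ideal_mul I J = ideal_gen L C z -> C `<=` I ->
  I a -> J b -> C c -> L u -> ~ M u -> a * b = c + z * u -> I = ideal_gen L C a.
Proof.
move=> idI idJ idC reg E CI Ia Jb Cc Lu nMu Eab.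
have [CL C0 CD CM] := idC; have [IL I0 ID IM] := idI; have [JL _ _ _] := idJ.
have u0 := local_nz nMu; have Lu' := invL Lu nMu.
have sC := ideal_submodule idC.
apply/seteqP; split=> [x Ix|_ [i Ci [r Lr ->]]]; last by apply: (ID); [apply: CI|apply: (IM)].
have [c' Cc' [r Lr Exb]] : ideal_gen L C z (x * b) by rewrite -E; apply: ideal_mul_in.
have La := IL _ Ia; have Lx := IL _ Ix.
have Cx : C (u * x - a * r).
  apply: (reg); first by apply: subringB => //; apply: subringM.
  have -> : z * (u * x - a * r) = a * c' - x * c.
    have -> : z * (u * x - a * r) = x * (c + z * u) - x * c - a * (c' + r * z) + a * c' by ring.
    by rewrite -Eab -Exb; ring.
  by apply: (submoduleB rL sC); apply: (CM).
exists (u^-1 * (u * x - a * r)); first exact: CM.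
exists (u^-1 * r); first exact: subringM.
have -> : u^-1 * (u * x - a * r) + u^-1 * r * a = (u^-1 * u) * x by ring.
by rewrite mulVf ?mul1r.
Qed.

(* If I has two minimal primes and x0 avoids only one of them, then replacing x0
   by x0 + a, for a suitable a in I : x0, makes it avoid both. *)
Lemma two_absorbing_choose I x0 : two_absorbing L I -> M x0 -> ~ I (x0 * x0) ->
  exists x, [/\ M x, ~ I (x * x) & forall c, L c -> I (c * x) -> I (c * c)].
Proof.
move=> [[idI _] abI] Mx0 nI; have [IL I0 ID IM] := idI; have sI := ideal_submodule idI.
have [|/existsNP[a /not_implyP[La /not_implyP[Iax nIa]]]] :=
  pselect (forall c, L c -> I (c * x0) -> I (c * c)); first by exists x0.
have sub2 x y : I (x + y) -> I y -> I x.
  by move=> Ixy Iy; rewrite -(addrK y x); apply: (submoduleB rL sI).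
have Lx0 := ML Mx0.
have nu x : L x -> I (x * x * a) -> I (x * a) \/ I (x * x).
  by move=> Lx /abI [] //; [right|left|left].
have Ma : M a.
  apply: contrapT => nMa; apply: nI.
  have -> : x0 * x0 = (x0 * a^-1) * (a * x0).
    by rewrite mulrA -[x0 * _ * a]mulrA mulVf ?mulr1 ?local_nz.
  by apply: (IM) => //; apply: subringM => //; apply: invL.
exists (a + x0); split.
- exact: MD.
- move=> H; have : I (a * a * a).
    apply: (sub2 _ (2%:R * a * (a * x0) + x0 * (a * x0))).
      have -> : a * a * a + (2%:R * a * (a * x0) + x0 * (a * x0)) = a * ((a + x0) * (a + x0)) by ring.
      exact: IM.
    by apply: (ID); apply: (IM) => //; rewrite mulrC mulr_natr mulr2n; apply: subringD.
  by case/abI.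
- move=> b Lb Ib.
  have Iba : I (b * a).
    have : I (a * a * b).
      apply: (sub2 _ (b * (a * x0))); last exact: IM.
      have -> : a * a * b + b * (a * x0) = a * (b * (a + x0)) by ring.
      exact: IM.
    by rewrite [b * a]mulrC; case/abI.
  have Ibx : I (b * x0).
    by apply: (sub2 _ (b * a)) => //; rewrite -mulrDr addrC.
  have [] := abI (a + b) (b + x0) (a + x0); try exact: subringD.
  + have -> : (a + b) * (b + x0) * (a + x0) = b * (b * (a + x0)) + (b + a + x0) * (a * x0)
       + (a + x0) * (b * a) + x0 * (b * x0) by ring.
    have h1 : I (b * (b * (a + x0))) by apply: (IM).
    have h2 : I ((b + a + x0) * (a * x0)) by apply: (IM) => //; apply: subringD => //; apply: subringD.
    have h3 : I ((a + x0) * (b * a)) by apply: (IM) => //; apply: subringD.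
    have h4 : I (x0 * (b * x0)) by apply: (IM).
    by do !apply: (ID).
  + move=> H; apply: (sub2 _ (b * a + a * x0 + b * x0)); last by do !apply: (ID).
    by have <- : (a + b) * (b + x0) = b * b + (b * a + a * x0 + b * x0) by ring.
  + move=> H; exfalso; apply: nIa; apply: (sub2 _ (b * a + a * x0 + b * x0)); last by do !apply: (ID).
    by have <- : (a + b) * (a + x0) = a * a + (b * a + a * x0 + b * x0) by ring.
  + move=> H; exfalso; apply: nI; apply: (sub2 _ (b * a + a * x0 + b * x0)); last by do !apply: (ID).
    by have <- : (b + x0) * (a + x0) = x0 * x0 + (b * a + a * x0 + b * x0) by ring.
Qed.

Hypothesis tafL : TAF L.

Lemma principalP y x : ideal_gen L [set 0] y x <-> exists2 s, L s & x = s * y.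
Proof.
split=> [[_ -> [s Ls ->]]|[s Ls ->]]; first by exists s; rewrite ?add0r.
by exists 0 => //; exists s; rewrite ?add0r.
Qed.

(* It suffices that x^2 \in I = y L for x \in M. If not, let C = I : x. Every
   factor J in a factorization of C + x^3 L into 2-absorbing ideals satisfies
   C \subset I + J C; hence C \subset I + (C + x^3 L) C = I. Then y \in C = I
   yields y \in M y. *)
Lemma two_absorbing_principal y : y <> 0 -> two_absorbing L (ideal_gen L [set 0] y) ->
  forall x x', M x -> M x' -> ideal_gen L [set 0] y (x * x').
Proof.
set I := ideal_gen L [set 0] y => y0 abI.
apply: (two_absorbing_square rL abI idM); apply: contrapT => /existsNP[x0 /not_implyP[Mx0 nIx0]].
have [x [Mx nIxx sqI]] := two_absorbing_choose abI Mx0 nIx0.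
have [pI absI] := abI; have [idI _] := pI; have [IL I0 ID IM] := idI.
have sI := ideal_submodule idI.
have Lx := ML Mx.
pose C := [set c | L c /\ I (c * x)].
have idC : ideal L C.
  split=> [c []//||c d [Lc Ic] [Ld Id]|r c Lr [Lc Ic]].
  - by split; rewrite ?mul0r //; apply: subring0.
  - by split; rewrite ?mulrDl; [apply: subringD|apply: (ID)].
  - by split; rewrite -?mulrA; [apply: subringM|apply: (IM)].
have [CL C0 CD CM] := idC; have sC := ideal_submodule idC.
have C1 : ~ C 1 by case=> _; rewrite mul1r => Ix; apply: nIxx; apply: (IM).
have subCM := local_proper idC C1.
have CC c d : C c -> C d -> I (c * d).
  by apply: (two_absorbing_square rL abI idC) => e [Le Ie]; apply: sqI.
(* Since x * x is not in I, a repeated factor x may be dropped. *)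
have red t : L t -> I (x * x * t) -> I (x * t).
  by move=> Lt /absI[].
(* The cube, because a 2-absorbing ideal containing it contains x * x. *)
pose z := x * x * x; have Lxx : L (x * x) by apply: subringM.
have Lz : L z by apply: subringM.
have reg r : L r -> C (z * r) -> C r.
  move=> Lr [_ H]; split=> //; rewrite mulrC; have Lxr : L (x * r) by apply: subringM.
  apply: (red) => //; rewrite -mulrA; apply: (red) => //; rewrite -mulrA; apply: red.
    exact: subringM.
  have -> : x * x * (x * (x * r)) = z * r * x by rewrite /z; ring.
  by [].
pose k := ideal_gen L C z; have idk : ideal L k by apply: ideal_gen_ideal.
have Ck : C `<=` k by apply: ideal_gen_sub.
have kz : k z by apply: ideal_gen_mem.
have kM : k `<=` M.
  move=> _ [c /subCM Mc [r Lr ->]]; apply: (MD) => //; rewrite /z mulrA.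
  by apply: (MM) => //; apply: subringM.
have [|s [abs Ek]] := tafL (I := k).
  by apply/(proper_ideal1 rL idk) => /kM.
have ids J : J \in s -> ideal L J by case/abs => -[].
(* Here J = C + a L, with cofactor C + b L. Since x * x is in J, it is r a modulo C; this gives b =
   u x r modulo C, and b C lies in I because x C does. *)
have fact J : J \in s -> exists a b, [/\ J a, M a, M b, forall c, C c -> I (b * c)
   & forall w, C w -> exists p q r, [/\ C p, C q, ideal_mul C C r & w = a * p + b * q + r]].
  move=> Js; have idJ := ids _ Js.
  pose J' := ideal_prod L (rem J s).
  have idJ' : ideal L J' by apply: ideal_prod_ideal => // J2 /mem_rem/ids.
  have EJ : ideal_mul J J' = k by rewrite Ek (ideal_prod_rem L Js).
  have kJ : k `<=` J by rewrite -EJ; apply: (ideal_mul_subl idJ); case: idJ'.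
  have kJ' : k `<=` J' by rewrite -EJ; apply: (ideal_mul_subr idJ'); case: idJ.
  have [a [b [c [u [Ja J'b Cc Lu [nMu Eab]]]]]] :=
    local_factor idJ idJ' idC subCM Lz reg EJ.
  have genJ := local_factor_gen idJ idJ' idC reg EJ (subset_trans Ck kJ) Ja J'b Cc Lu nMu Eab.
  have genJ' : J' = ideal_gen L C b.
    apply: (local_factor_gen (J := J) (z := z) (b := a) (c := c) (u := u)) => //.
    - by rewrite ideal_mulC.
    - exact: subset_trans kJ'.
    - by rewrite mulrC.
  have [pJ abJ] := abs _ Js.
  have JM : J `<=` M by apply: local_proper => //; apply/(proper_ideal1 rL idJ).
  have La := ML (JM _ Ja); have Lb : L b by case: idJ' => + _ _ _; apply.
  have Jxx : J (x * x) by case: (abJ x x x Lx Lx Lx (kJ _ kz)).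
  have [c' Cc' [r Lr Exx]] : ideal_gen L C a (x * x) by rewrite -genJ.
  have Lux : L (u * x) by apply: subringM.
  have Luxr : L (u * x * r) by apply: subringM.
  have regu t : L t -> C (u * t) -> C t.
    move=> Lt /(CM _ _ (invL Lu nMu)); rewrite mulrA mulVf ?mul1r //.
    exact: local_nz.
  have Cb : C (b - u * x * r).
    have Lb' : L (b - u * x * r) by apply: subringB.
    apply: (regu) => //; apply: (reg); first exact: subringM.
    have -> : z * (u * (b - u * x * r)) = b * (c + u * x * c') - (b - u * x * r) * c.
      have -> : z * (u * (b - u * x * r)) =
        (c + z * u) * (b - u * x * r) - (b - u * x * r) * c by ring.
      congr (_ - _).
      have -> : u * x * c' = u * z - u * x * r * a by rewrite /z -mulrA Exx; ring.
      have -> : c + (u * z - u * x * r * a) = (c + z * u) - u * x * r * a by ring.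
      by rewrite -Eab; ring.
    apply: (submoduleB rL sC); last exact: CM.
    by apply: (CM) => //; apply: (CD) => //; apply: (CM).
  exists a, b; split=> //.
  - exact: JM.
  - rewrite -[b](subrK (u * x * r)); apply: (MD); first exact: subCM.
    by rewrite mulrAC; apply: (MM) => //; apply: subringM.
  - move=> d Cd; have -> : b * d = (b - u * x * r) * d + (u * r) * (d * x) by ring.
    by apply: (ID); [apply: CC|apply: (IM); [apply: subringM|case: Cd]].
  - move=> w Cw.
    have [t [p [q [v [Lt Cp Cq Hv Ew]]]]] : exists t p q v,
        [/\ L t, C p, C q, ideal_mul C C v & w = t * (a * b) + a * p + b * q + v].
      have : ideal_mul J J' w by rewrite EJ; apply: Ck.
      rewrite genJ genJ'; apply: (ideal_mul_ind (X := [set w | exists t p q v,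
        [/\ L t, C p, C q, ideal_mul C C v & w = t * (a * b) + a * p + b * q + v]])) => /=.
      + exists 0, 0, 0, 0; split=> //; [exact: subring0|exact: ideal_mul0|ring].
      + move=> _ _ [t [p [q [v [? ? ? ? ->]]]]] [t' [p' [q' [v' [? ? ? ? ->]]]]].
        exists (t + t'), (p + p'), (q + q'), (v + v'); split; last by ring.
          exact: subringD. exact: CD. exact: CD. exact: ideal_mulD.
      + move=> _ _ [i Ci [t Lt ->]] [j Cj [t' Lt' ->]].
        exists (t * t'), (t * j), (t' * i), (i * j); split; last by ring.
          exact: subringM. exact: CM. exact: CM. exact: ideal_mul_in.
    (* Regularity of z puts t into C, so the term t (a b) is a times an element of C. *)
    exists (p + t * b), q, v; split=> //; last by rewrite Ew; ring.
    apply: (CD) => //; rewrite mulrC; apply: (CM) => //.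
    apply: (regu) => //; apply: (reg); first exact: subringM.
    have -> : z * (u * t) = t * (c + z * u) - t * c by ring.
    apply: (submoduleB rL sC); last exact: CM.
    rewrite -Eab; have -> : t * (a * b) = w - (p * a + q * b + v) by rewrite Ew; ring.
    apply: (submoduleB rL sC) => //.
    apply: (CD); first by apply: (CD); rewrite mulrC; apply: (CM).
    by apply: (ideal_mul_subr idC CL).
have CI : C `<=` I.
  have step t : {subset t <= s} -> forall w, C w ->
      exists2 i, I i & exists2 v, ideal_mul (ideal_prod L t) C v & w = i + v.
    elim: t => [_ w Cw|J t IH Jts].
      by exists 0 => //; exists w; rewrite ?add0r //= ideal_mul1.
    have {}IH := IH (fun J2 J2t => Jts J2 (mem_behead (s := J :: t) J2t)).
    move=> w /IH [i Ii [v Hv ->]].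
    have [a [b [Ja Ma Mb HbC HC]]] := fact J (Jts J (mem_head _ _)).
    have HJ c : C c -> exists2 i, I i & exists2 v, ideal_mul J C v & c = i + v.
      move=> /HC[p [q [r [Cp Cq Hr ->]]]]; exists (b * q + r).
        apply: (ID); first exact: HbC.
        by apply: ideal_mul_ind Hr.
      by exists (a * p); [apply: ideal_mul_in|ring].
    have [j Ij [v' Hv' ->]] : exists2 i, I i & exists2 w, ideal_mul (ideal_prod L (J :: t)) C w & v = i + w.
      apply: (ideal_mul_ind (X := [set v | exists2 i, I i &
         exists2 w, ideal_mul (ideal_prod L (J :: t)) C w & v = i + w])) Hv => /=.
      - by exists 0 => //; exists 0; [exact: ideal_mul0|rewrite addr0].
      - move=> _ _ [i1 Ii1 [v1 Hv1 ->]] [i2 Ii2 [v2 Hv2 ->]]; exists (i1 + i2); first exact: ID.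
        by exists (v1 + v2); [exact: ideal_mulD|ring].
      - move=> p c Pp /HJ[i1 Ii1 [v1 Hv1 ->]].
        have Lp : L p.
          have [|+ _ _ _] := @ideal_prod_ideal _ L t rL; last by apply.
          by move=> J2 J2t; apply/ids/Jts; rewrite inE J2t orbT.
        exists (p * i1); first exact: IM.
        exists (p * v1); last by rewrite mulrDr.
        by rewrite [ideal_mul J _]ideal_mulC -ideal_mulA; apply: ideal_mul_in.
    exists (i + j); first exact: ID.
    by exists v'; rewrite ?addrA.
  move=> w Cw; have [//|i Ii [v Hv ->]] := step s _ w Cw.
  apply: (ID) => //; move: Hv; rewrite -Ek; apply: ideal_mul_ind => //.
  move=> _ d [c Cc [r Lr ->]] Cd.
  have -> : (c + r * z) * d = c * d + (r * (x * x)) * (d * x) by rewrite /z; ring.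
  by apply: (ID); [apply: CC|apply: (IM); [apply: subringM|case: Cd]].
have [J Js] : exists J, J \in s.
  case: (s) Ek => [/= Ek|J t _]; last by exists J; rewrite inE eqxx.
  by exfalso; apply: M1; apply: kM; rewrite Ek.
have [a [b [Ja Ma Mb _ HC]]] := fact J Js.
have Iy : I y by apply/principalP; exists 1; rewrite ?mul1r.
have Cy : C y.
  split; [exact: IL|apply/principalP; exists x; rewrite // mulrC //].
have [p [q [r [/CI/principalP[p' Lp ->] /CI/principalP[q' Lq ->] Hr Ey]]]] := HC _ Cy.
have [m Mm Er] : exists2 m, M m & r = m * y.
  apply: (ideal_mul_ind (X := [set r | exists2 m, M m & r = m * y])) Hr => /=.
  - by exists 0; [case: idM|rewrite mul0r].
  - by move=> _ _ [m Mm ->] [m' Mm' ->]; exists (m + m'); [exact: MD|ring].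
  - move=> c d /subCM Mc /CI/principalP[t Lt ->]; exists (t * c); last by ring.
    exact: MM.
apply: M1; have -> : 1 = p' * a + q' * b + m.
  apply: (mulIf (x := y)); first exact/eqP.
  by rewrite mul1r {1}Ey Er; ring.
by apply: (MD) => //; apply: (MD); apply: (MM).
Qed.

End LocalRing.
End Local.

(** * Discrete valuation overrings of local TAF-domains *)

Section LocalPVD.
Variable K : fieldType.
Implicit Types (R S T I J L M N P X C V : set K) (s : seq (set K)).

(* V is a discrete valuation ring with maximal ideal M; the last two fields
   express discreteness. *)
Record local_pvd L M V : Prop := LocalPVD {
  pvd_subring : subring V;
  pvd_sub : L `<=` V;
  pvd_mul : forall m v, M m -> V v -> M (m * v);
  pvd_val : forall x, x <> 0 -> V x \/ M x^-1;
  pvd_min : forall J x, J `<=` V -> J x -> x <> 0 ->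
    exists b, [/\ J b, b <> 0 & forall y, J y -> V (y / b)];
  pvd_arch : forall c, L c -> c <> 0 -> exists n, forall m, M m -> M (m ^+ n / c) }.

Section Structure.
Variables (L M : set K) (m0 : K).
Hypotheses (locL : local_ring L M) (tafL : TAF L) (Mm0 : M m0) (m00 : m0 <> 0).
Hypothesis fracL : forall x, exists a b, [/\ L a, L b, b <> 0 & x = a / b].
Let rL : subring L. Proof. by case: locL. Qed.
Let idM : ideal L M. Proof. by case: locL. Qed.
Let M1 : ~ M 1. Proof. by case: locL. Qed.
Let invL x : L x -> ~ M x -> L x^-1. Proof. by case: locL => _ _ _; apply. Qed.
Let ML : M `<=` L. Proof. by case: idM. Qed.
Let MD x y : M x -> M y -> M (x + y). Proof. by case: idM => _ _ + _; apply. Qed.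
Let MM x y : L x -> M y -> M (x * y). Proof. by case: idM => _ _ _; apply. Qed.
Let L1 : L 1. Proof. exact: subring1. Qed.
Let principal y := ideal_gen L [set 0] y.
Let L0 : L 0. Proof. exact: subring0. Qed.

Let principal_ideal y : L y -> ideal L (principal y).
Proof. by move=> Ly; apply: ideal_gen_ideal => //; apply: ideal0. Qed.

Let principal_self y : principal y y.
Proof. exact: ideal_gen_mem. Qed.

Lemma local_principal I J z : ideal L I -> ideal L J -> L z -> z <> 0 ->
  ideal_mul I J = principal z -> exists2 a, I a & I = principal a.
Proof.
move=> idI idJ Lz z0 E; have id0 := ideal0 rL.
have reg r : L r -> [set 0] (z * r) -> [set 0] r.
  by move=> _ /eqP; rewrite mulf_eq0 => /orP[]/eqP.
have sub : [set 0] `<=` M by move=> _ ->; case: idM.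
have [a [b [c [u [Ia Jb Cc Lu [nMu Eab]]]]]] := local_factor locL idI idJ id0 sub Lz reg E.
exists a => //; apply: (local_factor_gen locL idI idJ id0 reg E _ Ia Jb Cc Lu nMu Eab).
by move=> _ ->; case: idI.
Qed.

(** By [two_absorbing_principal], m m' = r y; were r a unit, y would be in M^2. *)
Lemma atom_mul y m m' : M y -> ~ ideal_mul M M y -> two_absorbing L (principal y) ->
  M m -> M m' -> M (m * m' / y).
Proof.
move=> My nM2y abI Mm Mm'; have y0 : y <> 0 by move=> E; apply: nM2y; rewrite E; apply: ideal_mul0.
have yU : y != 0 by apply/eqP.
have /principalP[r Lr E] := two_absorbing_principal locL tafL y0 abI Mm Mm'.
rewrite E mulfK //; apply: contrapT => nMr; apply: nM2y.
have -> : y = (r^-1 * m) * m'.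
  by rewrite -mulrA E mulrA mulVf ?mul1r //; apply: (local_nz locL).
by apply: ideal_mul_in => //; apply: MM => //; apply: invL.
Qed.

(** The first factor of m0 L is a 2-absorbing a L. If a is in M^2, then M^2 = a L, so the factor M
    of a principal ideal is principal too, and its generator serves as y. *)
Lemma atom_ex : exists y, [/\ M y, ~ ideal_mul M M y & two_absorbing L (principal y)].
Proof.
have idm0 := principal_ideal (ML Mm0).
have sub : principal m0 `<=` M by move=> _ [_ -> [r Lr ->]]; rewrite add0r; apply: MM.
have [|s [abs E]] := tafL (I := principal m0).
  by apply/(proper_ideal1 rL idm0) => /sub.
case: s abs E => [_ /= E|J s abs /= E].
  by exfalso; apply: M1; apply: sub; rewrite E.
have abJ := abs _ (mem_head _ _); have [[idJ J1] _] := abJ.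
have ids : ideal L (ideal_prod L s).
  by apply: ideal_prod_ideal => // P Ps; have [[]] := abs P (mem_behead (s := J :: s) Ps).
have [a Ja EJ] := local_principal idJ ids (ML Mm0) m00 (esym E).
have JM : J `<=` M by apply: (local_proper locL idJ); apply/(proper_ideal1 rL idJ).
have [M2a|nM2a] := pselect (ideal_mul M M a); last first.
  by exists a; split=> //; [apply: JM|rewrite -EJ].
have a0 : a <> 0.
  move=> a0; apply: m00; have : ideal_mul J (ideal_prod L s) m0 by rewrite -E.
  apply: (ideal_mul_ind (X := [set 0])) => //= [x y -> ->|x y]; first by rewrite addr0.
  by rewrite EJ => /principalP[r _ ->] _; rewrite a0 mulr0 mul0r.
have M2E : ideal_mul M M = principal a.
  have [H1 H2 H3] := ideal_mul_submodule M (ideal_submodule idM).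
  apply/seteqP; split; last by move=> _ /principalP[r Lr ->]; apply: H3.
  apply: ideal_mul_ind => [||x y Mx My].
  - by case: (principal_ideal (ML (JM _ Ja))).
  - by case: (principal_ideal (ML (JM _ Ja))).
  - by apply: (two_absorbing_principal locL tafL a0) => //; rewrite -[ideal_gen _ _ _]EJ.
have [y My EM] := local_principal idM idM (ML (JM _ Ja)) a0 M2E.
exists y; split=> //.
- move=> M2y; have [m Mm Ey] : exists2 m, M m & y = m * y.
    apply: (ideal_mul_ind (X := [set z | exists2 m, M m & z = m * y])) M2y => /=.
    + by exists 0; [case: idM|rewrite mul0r].
    + by move=> _ _ [m Mm ->] [m' Mm' ->]; exists (m + m'); [exact: MD|ring].
    + move=> m m' Mm Mm'; have /principalP[r Lr ->] : principal y m' by rewrite -EM.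
      by exists (r * m); [apply: MM|ring].
  have y0 : y != 0.
    apply/eqP => y0; apply: a0; have : M a by apply: JM.
    by rewrite EM => /principalP[r _ ->]; rewrite y0 mulr0.
  by apply: M1; have -> : 1 = m by apply: (mulIf y0); rewrite mul1r {1}Ey.
- rewrite -EM; split; first exact/(proper_ideal1 rL idM).
  move=> u v w Lu Lv Lw Muvw.
  have [Mu|nMu] := pselect (M u); first by apply: Or31; rewrite mulrC; apply: MM.
  have [Mv|nMv] := pselect (M v); first by apply: Or31; apply: MM.
  apply: Or32; apply: MM => //.
  have -> : w = (v^-1 * u^-1) * (u * v * w); last first.
    by apply: MM => //; apply: subringM => //; apply: invL.
  have -> : v^-1 * u^-1 * (u * v * w) = (u^-1 * u) * (v^-1 * v) * w by ring.
  by rewrite !mulVf ?mul1r // (local_nz locL).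
Qed.

Lemma local_TAF_pvd : exists V, local_pvd L M V.
Proof.
have [y [My nM2y aby]] := atom_ex.
have y0 : y != 0 by apply/eqP => E; apply: nM2y; rewrite E; apply: ideal_mul0.
have Mdiv := atom_mul My nM2y aby.
(* So M = y V; V is closed under products because M M lies in y M. *)
pose V := [set v | M (v * y)].
have sM := ideal_submodule idM.
have LV : L `<=` V by move=> x Lx; apply: MM.
have rV : subring V.
  split; first exact: LV.
  - by move=> u v Vu Vv; rewrite /V /= mulrBl; apply: (submoduleB rL sM).
  - move=> u v Vu Vv; rewrite /V /=.
    by have -> : u * v * y = (u * y) * (v * y) / y; [field|apply: Mdiv].
have MV m v : M m -> V v -> M (m * v).
  by move=> Mm Vv; have -> : m * v = m * (v * y) / y; [field|apply: Mdiv].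
have Vy m : M m -> V (m / y) by move=> Mm; rewrite /V /= divfK.
have nMV m : M m -> m <> 0 -> ~ V m^-1.
  by move=> Mm /eqP nz /(MV _ _ Mm); rewrite mulfV.
pose unit v := [/\ v != 0, V v & V v^-1].
have unitM u v : unit u -> unit v -> unit (u * v).
  case=> u0 Vu Vu' [v0 Vv Vv']; split; first by rewrite mulf_neq0.
    exact: subringM.
  by rewrite invfM; apply: subringM.
have unitV u : unit u -> unit u^-1 by case=> u0 Vu Vu'; split; rewrite ?invr_eq0 ?invrK.
have unit1 : unit 1 by split; rewrite ?oner_eq0 ?invr1 //; apply: subring1.
have unitX n : V (y ^+ n).
  by apply: subringX => //; apply/LV/ML.
(* k is 1 or 2, according as a is outside or inside M^2; in the second case y^2 is in a L. *)
have exp_atom a : a <> 0 -> M a -> two_absorbing L (principal a) ->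
    exists k u, unit u /\ a = y ^+ k * u.
  move=> /eqP a0 Ma aba.
  have [M2a|nM2a] := pselect (ideal_mul M M a); last first.
    exists 1%N, (a / y); split; last by rewrite expr1 mulrCA divff ?mulr1.
    split; first by rewrite mulf_neq0 ?invr_eq0.
      exact: Vy.
    rewrite invf_div /V /= mulrAC; exact: atom_mul.
  exists 2%N, (a / y ^+ 2); split; last by rewrite mulrCA divff ?mulr1 // expf_neq0.
  split; first by rewrite mulf_neq0 ?invr_eq0 ?expf_neq0.
    rewrite /V /=; have -> : a / y ^+ 2 * y = a / y by field.
    apply: (ideal_mul_ind (X := [set a | M (a / y)])) M2a => //=.
      by rewrite mul0r; case: idM.
    by move=> u v Hu Hv; rewrite mulrDl; apply: MD.
  rewrite invf_div; apply: LV.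
  have /principalP[r Lr] := two_absorbing_principal locL tafL (elimN eqP a0) aba My My.
  by rewrite expr2 => ->; rewrite mulfK.
have principalM a b : ideal_mul (principal a) (principal b) = principal (a * b).
  apply/seteqP; split; last first.
    move=> _ /principalP[r Lr ->]; rewrite mulrA; apply: ideal_mul_in => //.
    by apply/principalP; exists r.
  apply: ideal_mul_ind.
  - by apply/principalP; exists 0; rewrite ?mul0r.
  - move=> _ _ /principalP[r Lr ->] /principalP[t Lt ->]; apply/principalP.
    by exists (r + t); [apply: subringD|rewrite mulrDl].
  - move=> _ _ /principalP[r Lr ->] /principalP[t Lt ->]; apply/principalP.
    by exists (r * t); [apply: subringM|ring].
have expL z : L z -> z <> 0 -> exists k u, unit u /\ z = y ^+ k * u.
  move=> Lz z0; have [Mz|nMz] := pselect (M z); last first.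
    exists 0%N, z; split; last by rewrite mul1r.
    by split; [exact/eqP|exact: LV|apply/LV/invL].
  have idz := principal_ideal Lz.
  have sub : principal z `<=` M by move=> _ /principalP[r Lr ->]; apply: MM.
  have [|s [abs E]] := tafL (I := principal z).
    by apply/(proper_ideal1 rL idz) => /sub.
  have ids J : J \in s -> ideal L J by case/abs => -[].
  have prs J : J \in s -> exists k u, unit u /\ J = principal (y ^+ k * u).
    move=> Js; have idJ := ids _ Js.
    have idr : ideal L (ideal_prod L (rem J s)).
      by apply: ideal_prod_ideal => // P /mem_rem/ids.
    have EJ := E; rewrite (ideal_prod_rem L Js) in EJ.
    have [a Ja EJa] := local_principal idJ idr Lz z0 (esym EJ).
    have [[_ J1] _] := abs _ Js.
    have Ma : M a by apply: (local_proper locL idJ) => //; apply/(proper_ideal1 rL idJ).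
    have a0 : a <> 0.
      move=> a0; apply: z0; have : ideal_mul J (ideal_prod L (rem J s)) z by rewrite -EJ.
      apply: (ideal_mul_ind (X := [set 0])) => //= [x x' -> ->|x x']; first by rewrite addr0.
      by rewrite EJa => /principalP[r _ ->] _; rewrite a0 mulr0 mul0r.
    have [|k [u [uu Ea]]] := exp_atom a a0 Ma; first by rewrite -EJa; apply: abs.
    by exists k, u; rewrite -Ea.
  have [k [u [uu Es]]] : exists k u, unit u /\ ideal_prod L s = principal (y ^+ k * u).
    elim: (s) prs => [_|J t IH Ht].
      exists 0%N, 1; split=> //; rewrite mul1r; apply/seteqP; split=> [x Lx|x /principalP[r Lr ->]].
        by apply/principalP; exists x; rewrite ?mulr1.
      by rewrite mulr1.
    have [|k [u [uu Eu]]] := IH; first by move=> P Pt; apply: Ht; rewrite inE Pt orbT.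
    have [l [v [uv Ev]]] := Ht J (mem_head _ _).
    exists (l + k)%N, (v * u); split; first exact: unitM.
    by rewrite /= Eu Ev principalM exprD; congr (principal _); ring.
  set b := y ^+ k * u in Es.
  have /principalP[r Lr Ez] : principal b z by rewrite -Es -E.
  have /principalP[r' Lr' Eb] : principal z b by rewrite E Es.
  exists k, (r * u); split; last by rewrite Ez /b; ring.
  apply: unitM => //.
  have rr' : r * r' = 1.
    by apply: (mulIf (x := z)); [exact/eqP|rewrite mul1r -mulrA -Eb -Ez].
  have r0 : r != 0 by apply/eqP => r0; move/eqP: rr'; rewrite r0 mul0r eq_sym oner_eq0.
  split=> //; first exact: LV.
  by have -> : r^-1 = r'; [apply: (mulfI r0); rewrite mulfV|apply: LV].
have expK x : x <> 0 -> (exists k u, unit u /\ x = y ^+ k * u) \/ M x^-1.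
  move=> x0; have [a [b [La Lb /eqP b0 Ex]]] := fracL x.
  have a0 : a <> 0 by move=> a0; apply: x0; rewrite Ex a0 mul0r.
  have [k [u [uu Ea]]] := expL _ La a0; have [l [w [uw Eb]]] := expL _ Lb (elimN eqP b0).
  have [u0 _ _] := uu; have [w0 _ _] := uw.
  have [lk|kl] := leqP l k.
    left; exists (k - l)%N, (u / w); split; first by apply: unitM => //; apply: unitV.
    rewrite Ex Ea Eb -{1}(subnK lk) exprD; field.
    by rewrite w0 expf_neq0.
  (* The exponent l - k is positive, and one factor y places x^-1 in M. *)
  right; have -> : x^-1 = y * (y ^+ (l - k.+1) * (w / u)).
    rewrite Ex Ea Eb -{1}(subnK kl) exprD exprS; field.
    by rewrite ?u0 ?w0 ?y0 ?expf_neq0.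
  apply: MV => //; apply: subringM => //.
  by have [] : unit (w / u) by apply: unitM => //; apply: unitV.
exists V; split=> //.
- move=> x /expK[[k [u [[_ Vu _] ->]]]|]; last by right.
  by left; apply: subringM.
- move=> J x JV Jx x0.
  have expJ z : J z -> z <> 0 -> exists k u, unit u /\ z = y ^+ k * u.
    move=> Jz z0; have [//|Mz] := expK _ z0.
    exfalso; apply: (nMV _ Mz); last by rewrite invrK; apply: JV.
    by apply/eqP; rewrite invr_eq0; apply/eqP.
  pose Q k := `[< exists z u, [/\ J z, z <> 0, unit u & z = y ^+ k * u] >].
  have exQ : exists k, Q k.
    by have [k [u [uu E]]] := expJ _ Jx x0; exists k; apply/asboolP; exists x, u.
  case: (ex_minnP exQ) => k /asboolP[b [u [Jb b0 uu Eb]]] mink.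
  exists b; split=> // z Jz.
  have [->|/eqP z0] := eqVneq z 0; first by rewrite mul0r; apply: subring0.
  have [l [w [uw Ez]]] := expJ _ Jz z0.
  have kl : (k <= l)%N by apply: mink; apply/asboolP; exists z, w.
  have [u0 _ Vu] := uu; have [_ Vw _] := uw.
  have -> : z / b = y ^+ (l - k) * (w / u).
    rewrite Ez Eb -{1}(subnK kl) exprD; field.
    by rewrite u0 expf_neq0.
  by apply: subringM => //; apply: subringM.
- move=> c Lc c0; have [k [u [[u0 Vu Vu'] Ec]]] := expL _ Lc c0.
  (* With c = y^k u, k factors m / y of V absorb c; one more m puts the result into M. *)
  exists k.+1 => m Mm.
  have -> : m ^+ k.+1 / c = m * ((m / y) ^+ k * u^-1).
    rewrite Ec exprS expr_div_n; field.
    by rewrite u0 expf_neq0.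
  by apply: MV => //; apply: subringM => //; apply: subringX => //; apply: Vy.
Qed.

End Structure.

(** * Localization at a prime ideal *)

Section Localization.
Variables (R M : set K).
Hypotheses (rR : subring R) (pM : prime_ideal R M).
Let L := localization R M.
Let idM : ideal R M. Proof. by case: pM => -[]. Qed.
Let MR : M `<=` R. Proof. by case: idM. Qed.
Let R1 : R 1. Proof. exact: subring1. Qed.
Let M1 : ~ M 1. Proof. by case: pM => pr _; apply/(proper_ideal1 rR idM). Qed.
Let nM x y : R x -> R y -> ~ M x -> ~ M y -> ~ M (x * y).
Proof. by move=> Rx Ry ? ?; case: pM => _ H /(H _ _ Rx Ry)[]. Qed.
Let nz x : ~ M x -> x != 0.
Proof. by move=> nx; apply/eqP => x0; apply: nx; rewrite x0; case: idM. Qed.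

Definition extension I : set K := [set x | exists a b, [/\ I a, R b, ~ M b & x = a / b]].

Let addE a b c d : ~ M b -> ~ M d -> a / b + c / d = (d * a + b * c) / (b * d).
Proof. by move=> /nz b0 /nz d0; field; rewrite b0 d0. Qed.

Let mulE a b c d : a / b * (c / d) = (a * c) / (b * d) :> K.
Proof. by rewrite invfM; ring. Qed.

Lemma localization_subring : subring L.
Proof.
split; first by exists 1, 1; rewrite divr1.
- move=> _ _ [a [b [Ra Rb nb ->]]] [c [d [Rc Rd nd ->]]].
  exists (d * a + b * - c), (b * d); split; [|exact: subringM|exact: nM|].
    by apply: subringD => //; apply: subringM => //; apply: subringN.
  by rewrite -addE // mulNr.
- move=> _ _ [a [b [Ra Rb nb ->]]] [c [d [Rc Rd nd ->]]].
  by exists (a * c), (b * d); split; [exact: subringM|exact: subringM|exact: nM|exact: mulE].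
Qed.
Let rL := localization_subring.

Lemma localization_sub : R `<=` L.
Proof. by move=> x Rx; exists x, 1; rewrite divr1. Qed.

Lemma extension_sub I : I `<=` extension I.
Proof. by move=> x Ix; exists x, 1; rewrite divr1. Qed.

Lemma extension_ideal I : ideal R I -> ideal L (extension I).
Proof.
move=> [IR I0 ID IM]; split.
- by move=> _ [a [b [/IR Ra Rb nb ->]]]; exists a, b.
- by exists 0, 1; rewrite mul0r.
- move=> _ _ [a [b [Ia Rb nb ->]]] [c [d [Ic Rd nd ->]]].
  exists (d * a + b * c), (b * d); split; [|exact: subringM|exact: nM|exact: addE].
  by apply: ID; apply: IM.
- move=> _ _ [a [b [Ra Rb nb ->]]] [c [d [Ic Rd nd ->]]].
  by exists (a * c), (b * d); split; [exact: IM|exact: subringM|exact: nM|exact: mulE].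
Qed.

Lemma localization_local : local_ring L (extension M).
Proof.
split; [exact: rL|exact: extension_ideal| |].
- case=> a [b [Ma Rb nb E]]; apply: nb.
  have b0 : b != 0 by apply/eqP => b0; move/eqP: E; rewrite b0 invr0 mulr0 oner_eq0.
  by have -> : b = a by rewrite -[b]mul1r E divfK.
- move=> _ [a [b [Ra Rb nb ->]]] nE; exists b, a; split=> //; last by rewrite invf_div.
  by move=> Ma; apply: nE; exists a, b.
Qed.

Lemma extension_mul I J : ideal R I -> ideal R J ->
  extension (ideal_mul I J) = ideal_mul (extension I) (extension J).
Proof.
move=> idI idJ; apply/seteqP; split.
  move=> _ [a [b [Hab Rb nb ->]]]; rewrite mulrC.
  have [_ _ +] := ideal_mul_submodule (extension J) (ideal_submodule (extension_ideal idI)).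
  apply; first by exists 1, b; rewrite div1r.
  exact: (ideal_mulS (@extension_sub I) (@extension_sub J)).
have [_ H0 HD _] := extension_ideal (ideal_mul_ideal rR idI idJ).
apply: ideal_mul_ind => // _ _ [a [b [Ia Rb nb ->]]] [c [d [Jc Rd nd ->]]].
exists (a * c), (b * d); split; [exact: ideal_mul_in|exact: subringM|exact: nM|exact: mulE].
Qed.

Lemma extension_two_absorbing I : two_absorbing R I -> ~ extension I 1 ->
  two_absorbing L (extension I).
Proof.
move=> [[idI _] abI] I1; have idE := extension_ideal idI; have [_ _ _ IM] := idI.
split; first exact/(proper_ideal1 rL idE).
move=> _ _ _ [a [b [Ra Rb nb ->]]] [c [d [Rc Rd nd ->]]] [e [f [Re Rf nf ->]]].
rewrite !mulE => -[g [h [Ig Rh nh E]]].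
have : I (h * a * c * e).
  have -> : h * a * c * e = (b * d * f) * g.
    have b0 := nz nb; have d0 := nz nd; have f0 := nz nf; have h0 := nz nh.
    have -> : g = a * c * e / (b * d * f) * h by rewrite E divfK.
    by field; rewrite b0 d0 f0.
  by apply: IM => //; do !apply: subringM.
have mk u v w t : R v -> R t -> ~ M v -> ~ M t -> I (h * u * w) -> extension I (u / v * (w / t)).
  move=> Rv Rt nv nt Iuw; exists (h * u * w), (h * (v * t)); split=> //.
  - by do !apply: subringM.
  - by apply: (nM _ _ nh); [|apply: subringM|apply: nM].
  - by have h0 := nz nh; have v0 := nz nv; have t0 := nz nt; field; rewrite h0 v0 t0.
case/abI => //; first exact: subringM.
- by move=> ?; apply: Or31; rewrite -mulE; apply: mk.
- by move=> ?; apply: Or32; rewrite -mulE; apply: mk.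
- by move=> ?; apply: Or33; rewrite -mulE; apply: mk => //; rewrite -mulrA; apply: IM.
Qed.

(** Every ideal is extended from its contraction to R, and extension is multiplicative; factors that
    become the unit ideal are filtered out. *)
Lemma localization_TAF : TAF R -> TAF L.
Proof.
move=> tafR I [idI I1]; have [IL I0 ID IM] := idI.
pose I0' := I `&` R.
have id0 : ideal R I0' := ideal_meet rR localization_sub idI.
have EI : I = extension I0'.
  apply/seteqP; split=> [x Ix|_ [a [b [[Ia Ra] Rb nb ->]]]].
    have [a [b [Ra Rb nb E]]] := IL _ Ix; exists a, b; split=> //; split=> //.
    have -> : a = b * x by rewrite E mulrC divfK // nz.
    by apply: IM => //; apply: localization_sub.
  by rewrite mulrC; apply: IM => //; exists 1, b; rewrite div1r.
have [|s [abs E]] := tafR I0'.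
  apply/(proper_ideal1 rR id0) => -[I1' _]; apply: I1; exact: ideal1.
have ids J : J \in s -> ideal R J by case/abs => -[].
exists [seq extension J | J <- s & ~~ `[< extension J 1 >] ]; split.
  move=> _ /mapP[J + ->]; rewrite mem_filter => /andP[/asboolPn nJ Js].
  by apply: extension_two_absorbing => //; apply: abs.
rewrite EI E; elim: (s) ids => [_|J t IH Ht] /=.
  by apply/seteqP; split=> x.
have Jt : J \in J :: t by rewrite inE eqxx.
have Ht' P : P \in t -> ideal R P by move=> Pt; apply: Ht; rewrite inE Pt orbT.
rewrite extension_mul; [|exact: Ht|exact: ideal_prod_ideal].
rewrite IH //; case: asboolP => [J1|J1] //=.
rewrite -IH // (ideal1 (extension_ideal (Ht _ Jt)) J1) ideal_mul1 //.
by apply/ideal_submodule/extension_ideal/ideal_prod_ideal.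
Qed.

End Localization.
End LocalPVD.

(** * TAF-domains *)

Section TAFPullback.
Variable K : fieldType.
Implicit Types (S I J L M N P X C V : set K) (s : seq (set K)).
Variables (R : set K) (r0 : K).
Hypotheses (rR : subring R) (tafR : TAF R) (Rr0 : R r0) (r00 : r0 <> 0)
  (nur0 : forall y, R y -> 1 <> r0 * y)
  (fracR : forall x, exists a b, [/\ R a, R b, b <> 0 & x = a / b]).
Let T := complete_integral_closure R.
Hypothesis rT : subring T.
Let R1 : R 1. Proof. exact: subring1. Qed.

Lemma maximal_nonzero M : maximal_ideal R M -> exists2 m, M m & m <> 0.
Proof.
move=> mM; have [Mr|nMr] := pselect (M r0); first by exists r0.
have [y Ry My] := maximal_inv rR mM Rr0 nMr; exists (1 - r0 * y) => //.
by move/eqP; rewrite subr_eq0 => /eqP; apply: nur0.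
Qed.

Lemma taf_pvd M : maximal_ideal R M ->
  exists V, local_pvd (localization R M) (extension R M M) V.
Proof.
move=> mM; have pM := maximal_prime rR mM.
have [m Mm m0] := maximal_nonzero mM.
apply: (local_TAF_pvd (localization_local rR pM) (localization_TAF rR pM tafR) (m0 := m)) => //.
  exact: (extension_sub rR pM).
move=> x; have [a [b [Ra Rb b0 ->]]] := fracR x.
by exists a, b; split=> //; apply: (localization_sub rR pM).
Qed.

(** Here n does not depend on x, but u does; [taf_separate] improves on this. *)
Lemma taf_power M c : maximal_ideal R M -> R c -> c <> 0 ->
  exists n, forall x, M x -> exists u t, [/\ R u, ~ M u, R t & u * x ^+ n = c * t].
Proof.
move=> mM Rc c0; have pM := maximal_prime rR mM; have [V pvdV] := taf_pvd mM.
have [n Hn] := pvd_arch pvdV (localization_sub rR pM Rc) c0.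
exists n => x Mx; have [a [b [Ma Rb nb E]]] := Hn x (extension_sub rR pM Mx).
have [[[MR M0 _ _] _] _] := mM.
have b0 : b != 0 by apply/eqP => b0; apply: nb; rewrite b0.
exists b, a; split=> //; first exact: MR.
have -> : x ^+ n = a / b * c by rewrite -E divfK //; apply/eqP.
by rewrite mulrA mulrCA divff // mulr1 mulrC.
Qed.

Lemma taf_prime_maximal P c : prime_ideal R P -> P c -> c <> 0 -> maximal_ideal R P.
Proof.
move=> pP Pc c0; have [[idP _] primeP] := pP; have [PR P0 PD PM] := idP.
have P1 : ~ P 1 by case: pP => pr _; apply/(proper_ideal1 rR idP).
have [M mM PsM] := max_ex rR idP P1.
have [[[MR M0 _ _] _] _] := mM.
suff -> : P = M by [].
apply/seteqP; split=> // x Mx.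
have [n Hn] := taf_power mM (PR _ Pc) c0.
have [u [t [Ru nu Rt E]]] := Hn x Mx.
have : P (u * x ^+ n) by rewrite E mulrC; apply: PM.
have nPu : ~ P u by move/PsM.
have Rx := MR _ Mx.
case/(primeP _ _ Ru (subringX rR _ Rx)) => //; elim: (n) => [|k IH].
  by rewrite expr0.
by rewrite exprS => /(primeP _ _ Rx (subringX rR _ Rx))[].
Qed.

Section TwoAbsorbing.
Variables (J : set K) (c : K).
Hypotheses (abJ : two_absorbing R J) (Jc : J c) (c0 : c <> 0).
Let idJ : ideal R J. Proof. by case: abJ => -[]. Qed.
Let JR : J `<=` R. Proof. by case: idJ. Qed.
Let JM x y : R x -> J y -> J (x * y). Proof. by case: idJ => _ _ _; apply. Qed.
Let J1 : ~ J 1. Proof. by case: abJ => p _; apply/(proper_ideal1 rR idJ). Qed.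

Let quotient x := [set r | R r /\ J (r * x)].
Let quotient_ideal x : R x -> ideal R (quotient x).
Proof.
case: idJ => _ J0 JD _ Rx; split=> [r []//||r t [Rr Hr] [Rt Ht]|r t Rr [Rt Ht]].
- by split; [exact: subring0|rewrite mul0r].
- by split; [exact: subringD|rewrite mulrDl; apply: JD].
- by split; [exact: subringM|rewrite -mulrA; apply: JM].
Qed.

(** Some u x^n is in J. Applied to u x^k, x, x, the 2-absorbing property lowers the exponent until x
    x or u x is in J. *)
Lemma two_absorbing_local M x : maximal_ideal R M -> M x ->
  J (x * x) \/ exists u, [/\ R u, ~ M u & J (u * x)].
Proof.
move=> mM Mx; have [n Hn] := taf_power mM (JR Jc) c0.
have [u [t [Ru nu Rt E]]] := Hn x Mx.
have Rx : R x by case: mM => -[[MR _ _ _] _] _; apply: MR.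
have : J (u * x ^+ n) by rewrite E mulrC; apply: JM.
have abs := proj2 abJ.
suff : forall k, J (u * x ^+ k) -> J (x * x) \/ J (u * x).
  by move=> H /H[|Ju]; [left|right; exists u].
elim=> [|[|k] IH]; first by rewrite expr0 mulr1 [u * x]mulrC => /(JM Rx); right.
  by rewrite expr1; right.
have -> : u * x ^+ k.+2 = (u * x ^+ k) * x * x by rewrite !exprS; ring.
have Rk : R (u * x ^+ k) by apply: subringM => //; apply: subringX.
have E' : u * x ^+ k * x = u * x ^+ k.+1 by rewrite exprS; ring.
by case/(abs _ _ _ Rk Rx Rx) => [||]; rewrite ?E'; [exact: IH|exact: IH|left].
Qed.

(** If p^2 is in J, then p is in M', so p + x is not and (p + x)^2 is not in J. Hence p + x is in J
    locally at M, as is x, and so p. *)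
Lemma two_absorbing_pair M M' x u p : maximal_ideal R M -> maximal_ideal R M' ->
  J `<=` M' -> M x -> ~ M' x -> R u -> ~ M u -> J (u * x) -> M p ->
  exists v, [/\ R v, ~ M v & J (v * p)].
Proof.
move=> mM mM' JM' Mx nM'x Ru nu Jux Mp.
have [[[MR _ MD _] _] _] := mM.
have [[idM' _] _] := mM'; have sM' := ideal_submodule idM'.
have [_ primeM'] := maximal_prime rR mM'; have [_ primeM] := maximal_prime rR mM.
have Rx := MR _ Mx; have Rp := MR _ Mp.
have [Jpp|//] := two_absorbing_local mM Mp.
have M'p : M' p by case: (primeM' _ _ Rp Rp (JM' _ Jpp)).
have [Jq|[v [Rv nv Jv]]] := two_absorbing_local mM (MD _ _ Mp Mx).
  have M'px : M' (p + x).
    by have := primeM' _ _ (subringD rR Rp Rx) (subringD rR Rp Rx) (JM' _ Jq); case.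
  exfalso; apply: nM'x; have -> : x = (p + x) - p by ring.
  exact: (submoduleB rR sM').
exists (u * v); split; first exact: subringM.
  by case/(primeM _ _ Ru Rv).
have -> : u * v * p = u * (v * (p + x)) - v * (u * x) by ring.
by apply: (submoduleB rR (ideal_submodule idJ)); apply: JM.
Qed.
(** If some x in M1 has x^2 outside J, then J : x lies in a second maximal ideal M2. J agrees with
    M1 at M1 and with M2 at M2, and no third maximal ideal contains it; so for p in M1 and q in M2
    no maximal ideal contains J : p q. *)
Lemma two_absorbing_maximals : exists M M',
  [/\ maximal_ideal R M, maximal_ideal R M' & ideal_mul M M' `<=` J].
Proof.
have [M1 mM1 JM1] := max_ex rR idJ J1.
have [[[M1R _ _ M1M] _] _] := mM1; have idM1 : ideal R M1 by case: mM1 => -[].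
have [_ primeM1] := maximal_prime rR mM1.
have [_ J0 JD _] := idJ; have abs := proj2 abJ.
have [sq|/existsNP[x /not_implyP[Mx nJxx]]] := pselect (forall x, M1 x -> J (x * x)).
  exists M1, M1; split=> //; apply: ideal_mul_ind => // a b.
  exact: (two_absorbing_square rR abJ idM1).
have [//|[u [Ru nu Jux]]] := two_absorbing_local mM1 Mx.
have Rx := M1R _ Mx.
have nq1 : ~ quotient x 1.
  by case=> _; rewrite mul1r => Jx; apply: nJxx; apply: JM.
have [M2 mM2 qM2] := max_ex rR (quotient_ideal Rx) nq1.
have [[[M2R _ _ M2M] _] _] := mM2; have idM2 : ideal R M2 by case: mM2 => -[].
have [_ primeM2] := maximal_prime rR mM2.
have JM2 : J `<=` M2.
  by move=> j Jj; apply: qM2; split; [exact: JR|rewrite mulrC; apply: JM].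
have M2u : M2 u by apply: qM2.
have nM2x : ~ M2 x.
  move=> M2x; have [//|[v [Rv nv Jv]]] := two_absorbing_local mM2 M2x.
  by apply: nv; apply: qM2.
have M1N2 : M1 <> M2 by move=> E; apply: nu; rewrite E.
(* A third M3 yields e1 in M1 and e2 in M2, both outside M3, with u1 e1 and u2 e2 in J. The triple
   e1, e2, u1 + u2 violates the 2-absorbing property: M3, M2 and M1 exclude one pair each. *)
have only M3 : maximal_ideal R M3 -> J `<=` M3 -> M3 = M1 \/ M3 = M2.
  move=> mM3 JM3; apply: contrapT => /not_orP[n31 n32].
  have [[[M3R _ _ M3M] _] _] := mM3; have idM3 : ideal R M3 by case: mM3 => -[].
  have [_ primeM3] := maximal_prime rR mM3.
  have sep N N' : maximal_ideal R N -> maximal_ideal R N' -> J `<=` N -> J `<=` N' ->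
      N <> N' -> N <> M3 -> N' <> M3 ->
      exists e v, [/\ N e /\ ~ N' e, ~ M3 e, R v /\ ~ N v, N' v & J (v * e)].
    move=> mN mN' JN JN' NN' N3 N'3.
    have [[[NR _ ND NM] _] _] := mN; have idN' : ideal R N' by case: mN' => -[].
    have [_ primeN'] := maximal_prime rR mN'.
    have [|||f [Rf Nf Hf]] := @max_avoid _ _ rR N [:: N'; M3].
    - by [].
    - by move=> P; rewrite !inE => /orP[]/eqP->.
    - by rewrite !inE negb_or; apply/andP; split; apply/eqP.
    have nf P : P \in [:: N'; M3] -> ideal R P -> ~ P 1 -> ~ P (1 - f).
      move=> Pin idP P1 Pf; apply: P1; have [_ _ PD _] := idP.
      by rewrite -[1](subrK f); apply: PD => //; apply: Hf.
    have nN' : ~ N' (1 - f).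
      by apply: nf; rewrite ?inE ?eqxx //; apply: maximal_ideal1 mN'.
    have n3 : ~ M3 (1 - f).
      by apply: nf; rewrite ?inE ?eqxx ?orbT //; apply: maximal_ideal1 mM3.
    have R1f : R (1 - f) by apply: subringB.
    have [Jsq|[v [Rv nv Jv]]] := two_absorbing_local mN Nf.
      by exfalso; apply: nN'; case: (primeN' _ _ R1f R1f (JN' _ Jsq)).
    exists (1 - f), v; split=> //.
    by case: (primeN' _ _ Rv R1f (JN' _ Jv)).
  have [e1 [u1 [[Ne1 ne1] n3e1 [Ru1 nu1] Nu1 Ju1]]] := sep M1 M2 mM1 mM2 JM1 JM2 M1N2 (nesym n31) (nesym n32).
  have [e2 [u2 [[Ne2 ne2] n3e2 [Ru2 nu2] Nu2 Ju2]]] := sep M2 M1 mM2 mM1 JM2 JM1 (nesym M1N2) (nesym n32) (nesym n31).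
  have Re1 := M1R _ Ne1; have Re2 := M2R _ Ne2.
  have n1 : ~ M1 (u1 + u2).
    move=> H; apply: nu1; have -> : u1 = (u1 + u2) - u2 by ring.
    exact: (submoduleB rR (ideal_submodule idM1)).
  have n2 : ~ M2 (u1 + u2).
    move=> H; apply: nu2; have -> : u2 = (u1 + u2) - u1 by ring.
    exact: (submoduleB rR (ideal_submodule idM2)).
  have Ru12 : R (u1 + u2) by apply: subringD.
  have : J (e1 * e2 * (u1 + u2)).
    have -> : e1 * e2 * (u1 + u2) = e2 * (u1 * e1) + e1 * (u2 * e2) by ring.
    by apply: JD; apply: JM.
  case/(abs _ _ _ Re1 Re2 Ru12).
  - by move/JM3/(primeM3 _ _ Re1 Re2) => [].
  - by move/JM2/(primeM2 _ _ Re1 Ru12) => [].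
  - by move/JM1/(primeM1 _ _ Re2 Ru12) => [].
exists M1, M2; split=> //; apply: ideal_mul_ind => // p q Mp Mq.
have Rp := M1R _ Mp; have Rq := M2R _ Mq; have Rpq := subringM rR Rp Rq.
have [v [Rv nv Jv]] := two_absorbing_pair mM1 mM2 JM2 Mx nM2x Ru nu Jux Mp.
have Jxu : J (x * u) by rewrite mulrC.
have [w [Rw nw Jw]] := two_absorbing_pair mM2 mM1 JM1 M2u nu Rx nM2x Jxu Mq.
apply: contrapT => nJpq.
have nq : ~ quotient (p * q) 1 by case=> _; rewrite mul1r.
have [M3 mM3 qM3] := max_ex rR (quotient_ideal Rpq) nq.
have [|E|E] := only M3 mM3.
- by move=> j Jj; apply: qM3; split; [exact: JR|rewrite mulrC; apply: JM].
- apply: nv; rewrite -E; apply: qM3; split=> //.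
  by rewrite mulrA mulrC; apply: JM.
- apply: nw; rewrite -E; apply: qM3; split=> //.
  by rewrite mulrCA; apply: JM.
Qed.

End TwoAbsorbing.

Lemma taf_prod_maximal c : R c -> c <> 0 ->
  exists2 ms, (forall M, M \in ms -> maximal_ideal R M)
    & ideal_prod R ms `<=` ideal_gen R [set 0] c.
Proof.
move=> Rc c0; set I := ideal_gen R [set 0] c.
have idI : ideal R I by apply: ideal_gen_ideal => //; apply: ideal0.
have [I1|I1] := pselect (I 1); first by exists [::] => //=; rewrite (ideal1 idI I1).
have [|s [abs E]] := tafR (I := I); first exact/(proper_ideal1 rR idI).
have Ic : ideal_prod R s c by rewrite -E; apply: ideal_gen_mem.
have ids J : J \in s -> ideal R J by case/abs => -[].
suff [ms Hms sub] : exists2 ms, (forall M, M \in ms -> maximal_ideal R M)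
    & ideal_prod R ms `<=` ideal_prod R s by exists ms => //; rewrite E.
have nz J : J \in s -> exists2 j, J j & j <> 0.
  move=> Js; apply: set_nz; first by case: (ids _ Js).
  move=> J0; apply: c0; move: Ic; rewrite (ideal_prod_rem R Js) J0.
  apply: (ideal_mul_ind (X := [set 0])) => //= [x y -> ->|x y -> _]; first by rewrite addr0.
  by rewrite mul0r.
elim: (s) abs nz ids => [_ _ _|J t IH abs nz ids]; first by exists [::].
have tJ P : P \in t -> P \in J :: t by rewrite inE orbC => ->.
have [ms Hms sub] := IH (fun P Pt => abs P (tJ P Pt)) (fun P Pt => nz P (tJ P Pt))
  (fun P Pt => ids P (tJ P Pt)).
have [j Jj j0] := nz J (mem_head _ _).
have [M [M' [mM mM' MM'J]]] := two_absorbing_maximals (abs J (mem_head _ _)) Jj j0.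
exists [:: M, M' & ms].
  by move=> N; rewrite !inE => /or3P[/eqP->|/eqP->|/Hms].
by rewrite /= ideal_mulA; apply: ideal_mulS.
Qed.

(** In a product of maximal ideals inside c R, k counts the factors equal to M and u collects
    elements outside M from the other ones; neither depends on x. *)
Lemma taf_separate M c : maximal_ideal R M -> R c -> c <> 0 ->
  exists u k, [/\ R u, ~ M u & forall x, M x -> exists2 t, R t & u * x ^+ k = c * t].
Proof.
move=> mM Rc c0; have [ms Hms sub] := taf_prod_maximal Rc c0.
have [_ primeM] := maximal_prime rR mM; have [[[MR _ _ _] _] _] := mM.
suff [u [k [Ru nu H]]] : exists u k, [/\ R u, ~ M u & forall x, M x -> ideal_prod R ms (u * x ^+ k)].
  exists u, k; split=> // x /H/sub[_ -> [t Rt ->]].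
  by exists t => //; rewrite add0r mulrC.
elim: (ms) Hms => [_|N t IH Ht].
  exists 1, 0%N; split=> //; first exact: maximal_ideal1 mM.
  by move=> x _; rewrite expr0 mul1r.
have [|u [k [Ru nu H]]] := IH; first by move=> P Pt; apply: Ht; rewrite inE Pt orbT.
have [->|MN] := pselect (N = M).
  exists u, k.+1; split=> // x Mx; rewrite exprS mulrCA.
  by apply: ideal_mul_in => //; apply: H.
have mN := Ht N (mem_head _ _); have [[[NR _ _ _] _] _] := mN.
have idM : ideal R M by case: mM => -[].
have [e Ne nMe] : exists2 e, N e & ~ M e.
  apply: contrapT => H'; apply: MN; symmetry.
  apply: (maximal_eq rR mN idM (maximal_ideal1 rR mM)) => e Ne.
  by apply: contrapT => nMe; apply: H'; exists e.
exists (e * u), k; split.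
- by apply: subringM => //; apply: NR.
- by case/(primeM _ _ (NR _ Ne) Ru).
- by move=> x Mx; rewrite -mulrA; apply: ideal_mul_in => //; apply: H.
Qed.

Lemma localization_meet x :
  (forall M, maximal_ideal R M -> localization R M x) -> R x.
Proof.
move=> H; pose q := [set r | R r /\ R (r * x)].
have idq : ideal R q.
  split=> [r []//||r t [Rr Hr] [Rt Ht]|r t Rr [Rt Ht]].
  - by split; rewrite ?mul0r; apply: subring0.
  - by split; rewrite ?mulrDl; apply: subringD.
  - by split; rewrite -?mulrA; apply: subringM.
have [[_]|nq] := pselect (q 1); first by rewrite mul1r.
have [M mM qM] := max_ex rR idq nq.
have [a [b [Ra Rb nb E]]] := H M mM.
have b0 : b != 0 by apply/eqP => b0; apply: nb; rewrite b0; case: mM => -[[]].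
exfalso; apply: nb; apply: qM; split=> //.
by rewrite E mulrC divfK.
Qed.

(** For x outside V, x^-n / d is in the maximal ideal of the localization for some n, and its
    product with d x^n is 1. *)
Lemma cic_pvd M V : maximal_ideal R M ->
  local_pvd (localization R M) (extension R M M) V -> T `<=` V.
Proof.
move=> mM pvdV x [d [Rd d0 Hd]]; have pM := maximal_prime rR mM.
have [_ _ E1 _] := localization_local rR pM.
have LV := pvd_sub pvdV.
have [->|/eqP x0] := eqVneq x 0; first exact: subring0 (pvd_subring pvdV).
have [//|Mx] := pvd_val pvdV x0.
have [n Hn] := pvd_arch pvdV (localization_sub rR pM Rd) d0.
exfalso; apply: E1; have -> : 1 = x^-1 ^+ n / d * (d * x ^+ n).
  by rewrite mulrA divfK; [rewrite -exprMn mulVf ?expr1n //; apply/eqP|apply/eqP].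
apply: (pvd_mul pvdV); first exact: Hn.
apply: LV; apply: (localization_sub rR pM).
case: n {Hn} => [|n]; first by rewrite expr0 mulr1.
exact: Hd.
Qed.

(* Together with [cic_pvd]: the localization of R^* at R \ M is V. *)
Lemma pvd_cic M V v : maximal_ideal R M ->
  local_pvd (localization R M) (extension R M M) V -> V v ->
  exists u, [/\ R u, ~ M u & T (u * v)].
Proof.
move=> mM pvdV Vv; have [p [q [Rp Rq q0 Ev]]] := fracR v.
have pM := maximal_prime rR mM; have [[[MR _ _ _] _] _] := mM.
have [u [k [Ru nu Hu]]] := taf_separate mM Rq q0.
exists u; split=> //; have [y My y0] := maximal_nonzero mM.
have rL N : maximal_ideal R N -> subring (localization R N).
  by move=> mN; apply/localization_subring/maximal_prime.
have RL N : maximal_ideal R N -> R `<=` localization R N.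
  by move=> mN; apply: localization_sub => //; apply: maximal_prime.
(* y is a common denominator for all powers of u v: at M because y V lies in the extension of M, and
   at N <> M because u v itself is in the localization. *)
exists y; split=> // [|n _]; first exact: MR.
apply: localization_meet => N mN.
have [->|NM] := pselect (N = M).
  have -> : y * (u * v) ^+ n = u ^+ n * (y * v ^+ n) by rewrite exprMn; ring.
  have rM := rL _ mM; apply: (subringM rM).
    by apply: (RL _ mM); apply: subringX.
  have [_ [EL _ _ _] _ _] := localization_local rR pM.
  apply: EL; apply: (pvd_mul pvdV); first exact: (extension_sub rR pM).
  exact: (subringX (pvd_subring pvdV) _ Vv).
have idN : ideal R N by case: mN => -[].
have [x Mx nNx] : exists2 x, M x & ~ N x.
  apply: contrapT => H; apply: NM.
  apply: (maximal_eq rR mM idN (maximal_ideal1 rR mN)) => x Mx.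
  by apply: contrapT => nNx; apply: H; exists x.
have rN := rL _ mN; apply: (subringM rN); first by apply: (RL _ mN); apply: MR.
apply: (subringX rN); have [t Rt E] := Hu _ Mx.
have Rx := MR _ Mx; have [_ primeN] := maximal_prime rR mN.
exists (p * t), (x ^+ k); split; [exact: subringM|exact: subringX| |].
  elim: (k) => [|j IH]; first by rewrite expr0; apply: maximal_ideal1 mN.
  by rewrite exprS => /(primeN _ _ Rx (subringX rR _ Rx))[].
have x0 : x ^+ k != 0.
  by rewrite expf_neq0 //; apply/eqP => x0; apply: nNx; rewrite x0; case: idN.
by apply: (mulIf x0); rewrite divfK // Ev mulrAC E; field; apply/eqP.
Qed.

Lemma taf_cic_ded : ded T.
Proof.
split=> // J idJ J0; have [JT Jz JD JM] := idJ; have [j Jj j0] := set_nz Jz J0.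
have RT : R `<=` T.
  move=> x Rx; exists 1; split=> // [|n _]; first exact/eqP/oner_neq0.
  by rewrite mul1r; apply: subringX.
apply: contrapT => nX; have idX := colon_mul_ideal rT idJ (@subset_refl _ _).
set X := ideal_mul J (colon T J) in idX.
have idXR := ideal_meet rR RT idX.
have [|M mM XRM] := max_ex rR idXR; first by case.
have [V pvdV] := taf_pvd mM; have [[[MR _ _ _] _] _] := mM.
have JV : J `<=` V by apply: subset_trans (cic_pvd mM pvdV).
have [b [Jb b0 Hb]] := pvd_min pvdV JV Jj j0.
have [p [q [Rp Rq q0 Eb]]] := fracR b.
have bU : b != 0 by apply/eqP.
have Ep : p = b * q by rewrite Eb divfK //; apply/eqP.
have p0 : p <> 0 by apply/eqP; rewrite Ep mulf_neq0 //; apply/eqP.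
have [u [k [Ru nu Hu]]] := taf_separate mM Rp p0.
(* The element v with v (z / b) in T depends on z, but u does not. For m = 1 - v y in M one has 1 =
   m^k + v w; in u z = u m^k z + u w v z the first term is divisible by p = b q, the second by b. *)
have key z : J z -> exists2 t, T t & u * z = b * t.
  move=> Jz'; have [v [Rv nv Tv]] := pvd_cic mM pvdV (Hb _ Jz').
  have [y Ry My] := maximal_inv rR mM Rv nv; set m := 1 - v * y in My.
  have Rm := MR _ My.
  have [w Rw Ew] : exists2 w, R w & 1 = m ^+ k + v * w.
    elim: (k) => [|i [w Rw Ew]]; first by exists 0; [exact: subring0|rewrite expr0 mulr0 addr0].
    exists (w + m ^+ i * y); first by apply: subringD => //; apply: subringM => //; apply: subringX.
    rewrite {1}Ew exprS /m; ring.
  have [t Rt Et] := Hu _ My.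
  exists (q * t * z + u * w * (v * (z / b))).
    apply: (subringD rT).
      by apply: (subringM rT); [apply: RT; apply: subringM|apply: JT].
    by apply: (subringM rT) => //; apply: RT; apply: subringM.
  have -> : u * z = (u * m ^+ k) * z + u * w * (v * z).
    by rewrite -[LHS]mulr1 {1}Ew; ring.
  by rewrite Et Ep; field.
apply: nu; apply: XRM; split=> //.
have -> : u = b * (u / b) by rewrite mulrCA divff ?mulr1.
apply: ideal_mul_in => // z /key[t Tt E].
by rewrite mulrAC E mulrAC divff ?mul1r.
Qed.

Lemma taf_pullback : colon R T <> [set 0] -> exists s, pullback_of R T s.
Proof.
move=> F0; have RT : R `<=` T.
  move=> x Rx; exists 1; split=> // [|n _]; first exact/eqP/oner_neq0.
  by rewrite mul1r; apply: subringX.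
have dT := taf_cic_ded; set F := colon R T in F0.
have FR : F `<=` R by move=> x Fx; rewrite -[x]mulr1; apply: Fx; apply: subring1.
have [_ FD _] := colon_submodule T rR.
have Fz : F 0 by move=> t _; rewrite mul0r; apply: subring0.
have [a Fa a0] := set_nz Fz F0.
have idF : ideal T F.
  split=> //; first exact: subset_trans RT.
  by move=> t x Tt Fx y Ty; rewrite mulrAC mulrC; apply: Fx; apply: subringM.
have mc N : maximal_ideal T N -> F `<=` N -> maximal_ideal R (N `&` R).
  move=> mN FN; apply: (taf_prime_maximal (c := a)) => //.
    by apply: (prime_meet rR rT RT); apply: maximal_prime.
  by split; [apply: FN|apply: FR].
apply: (radical_pullback rR dT RT _ FR Fa a0).
(* Radicality is checked at each M. Either x is in the extension of M, which is stable under V, or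
   x^-1 is in V, and x t is x^n times an element of V, which some u outside M brings into T. *)
- split=> // x n Tx Fxn t Tt; apply: localization_meet => M mM.
  have pM := maximal_prime rR mM; have [V pvdV] := taf_pvd mM; have rV := pvd_subring pvdV.
  have TV := cic_pvd mM pvdV.
  have [_ [EL E0 _ _] _ _] := localization_local rR pM.
  have [->|x0] := eqVneq x 0; first by rewrite mul0r; apply: EL.
  have x0' : x^-1 <> 0 by apply/eqP; rewrite invr_eq0.
  have [Vx|] := pvd_val pvdV x0'; last first.
    by rewrite invrK => Ex; apply: EL; apply: (pvd_mul pvdV) => //; apply: TV.
  have [|u [Ru nu Tu]] := pvd_cic (v := x * x^-1 ^+ n * t) mM pvdV.
    apply: (subringM rV); last exact: TV.
    by apply: (subringM rV); [apply: TV|apply: subringX].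
  have u0 : u != 0 by apply/eqP => u0; apply: nu; rewrite u0; case: mM => -[[]].
  exists (x ^+ n * (u * (x * x^-1 ^+ n * t))), u; split=> //; first exact: Fxn.
  by rewrite exprVn; field; rewrite u0 expf_neq0.
(* N is recovered from its contraction, as the part of T inside the maximal ideal of the
   localization. *)
- have char N : maximal_ideal T N -> F `<=` N ->
      N = [set x | T x /\ extension R (N `&` R) (N `&` R) x].
    move=> mN FN; have mM := mc N mN FN; set M := N `&` R in mM *.
    have [[[NT N0 ND NM] _] _] := mN; have [_ primeN] := maximal_prime rT mN.
    have pM := maximal_prime rR mM; have [V pvdV] := taf_pvd mM.
    have [_ [EL E0 _ _] _ _] := localization_local rR pM.
    apply/seteqP; split=> [x Nx|x [Tx [c [b [[Nc Rc] Rb nb E]]]]].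
      have Tx := NT _ Nx; split=> //.
      have [->//|x0] := eqVneq x 0.
      have x0' : x^-1 <> 0 by apply/eqP; rewrite invr_eq0.
      have [Vx|] := pvd_val pvdV x0'; last by rewrite invrK.
      have [u [Ru nu Tu]] := pvd_cic mM pvdV Vx.
      exfalso; apply: nu; split=> //.
      have -> : u = (u * x^-1) * x by rewrite divfK.
      exact: NM.
    have b0 : b != 0.
      by apply/eqP => b0; apply: nb; rewrite b0; split=> //; apply: subring0.
    have : N (b * x) by rewrite E mulrC divfK.
    case/(primeN _ _ (RT _ Rb) Tx) => // Nb.
    by exfalso; apply: nb.
  by move=> M N mM mN FM FN E; rewrite (char M) // (char N) // E.
- move=> N x mN FN Rx nNx.
  have [|y Ry [Ny _]] := maximal_inv rR (mc N mN FN) Rx; first by case.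
  by exists y.
Qed.

End TAFPullback.

(** * Quotients by the conductor *)

Lemma fraction_eq (R : idomainType) (x : {fraction R}) :
  exists a b, [/\ dom R a, dom R b, b <> 0 & x = a / b].
Proof.
elim/quotW: x => r; exists (tofrac (frac r).1), (tofrac (frac r).2).
have d0 : tofrac (frac r).2 != 0 by rewrite tofrac_eq0 denom_ratioP.
split; [by exists (frac r).1|by exists (frac r).2|exact/eqP|].
apply: (mulIf d0); rewrite divfK //; apply/eqP.
rewrite !piE /FracField.mulf /FracField.equivf /=.
by rewrite !numden_Ratio ?(mul1r, mulr1, oner_neq0, denom_ratioP) // mulrC.
Qed.

Lemma not_field_nonunit (R : idomainType) : ~ GRing.field_axiom R ->
  exists r, [/\ dom R r, r <> 0 & forall y, dom R y -> 1 <> r * y].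
Proof.
move=> /existsNP[x /not_implyP[x0 nux]]; exists (tofrac x); split.
- by exists x.
- by apply/eqP; rewrite tofrac_eq0.
- move=> _ [y _ <-] /eqP; rewrite -tofracM -tofrac1 tofrac_eq => /eqP E.
  by apply: nux; apply/unitrP; exists y; rewrite mulrC -E.
Qed.

Lemma cic_subring_set (R : idomainType) : subring (cic R).
Proof.
have [h1 hB hM] := cic_subring R; split.
- exact/cic_predP.
- by move=> x y /cic_predP Hx /cic_predP Hy; apply/cic_predP; apply: hB.
- by move=> x y /cic_predP Hx /cic_predP Hy; apply/cic_predP; apply: hM.
Qed.

Section QuotientSets.
Variables (A B : comPzRingType) (T F : set A) (p : A -> B).
Implicit Types (S I J P Q : set A) (X Y : set B).
Hypotheses (rT : subring T) (idF : ideal T F) (p1 : p 1 = 1)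
  (pB : forall x y, T x -> T y -> p (x - y) = p x - p y)
  (pM : forall x y, T x -> T y -> p (x * y) = p x * p y)
  (p0 : forall x, T x -> p x = 0 <-> F x)
  (p_surj : forall b, exists2 x, T x & p x = b).

Let pz : p 0 = 0.
Proof. by apply/p0; [exact: subring0|case: idF]. Qed.
Let pN x : T x -> p (- x) = - p x.
Proof. by move=> Tx; rewrite -sub0r pB ?pz ?sub0r //; apply: subring0. Qed.
Let pD x y : T x -> T y -> p (x + y) = p x + p y.
Proof.
by move=> Tx Ty; rewrite -[y in LHS]opprK pB ?pN ?opprK //; apply: subringN.
Qed.

(** The map p is a homomorphism on T only, so preimages are taken inside T. *)
Definition comap X := T `&` (p @^-1` X).

Section Sub.
Variable S : set A.
Hypotheses (rS : subring S) (ST : S `<=` T) (FS : F `<=` S).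

Let pF x y : T x -> T y -> p x = p y -> F (x - y).
Proof. by move=> Tx Ty E; apply/p0; [exact: subringB|rewrite pB // E subrr]. Qed.

Lemma comap_image J : ideal S J -> F `<=` J -> comap (p @` J) = J.
Proof.
move=> idJ FJ; have [JS _ JD _] := idJ; apply/seteqP; split=> [x [Tx [y Jy E]]|x Jx].
  have Fxy := pF Tx (ST (JS _ Jy)) (esym E).
  by rewrite -(subrK y x); apply: JD => //; apply: FJ.
by split; [apply/ST/JS|exists x].
Qed.

Lemma image_comap X : p @` comap X = X.
Proof.
apply/seteqP; split=> [_ [x [_ Xx] <-]//|b Xb].
by have [x Tx E] := p_surj b; exists x => //; split=> //; rewrite /= E.
Qed.

Lemma comap_sub X : X `<=` p @` S -> comap X `<=` S.
Proof.
move=> XS x [Tx /XS[y Sy E]]; rewrite -(subrK y x); apply: subringD => //.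
by apply/FS/pF => //; apply: ST.
Qed.

Lemma image_subring : subring (p @` S).
Proof.
split; first by exists 1 => //; apply: subring1.
- by move=> _ _ [x Sx <-] [y Sy <-]; exists (x - y); [apply: subringB|rewrite pB //; apply: ST].
- by move=> _ _ [x Sx <-] [y Sy <-]; exists (x * y); [apply: subringM|rewrite pM //; apply: ST].
Qed.

Lemma image_ideal J : ideal S J -> ideal (p @` S) (p @` J).
Proof.
move=> idJ; have [JS J0 JD JM] := idJ; have JT := subset_trans JS ST.
split.
- exact: image_subset.
- by exists 0.
- move=> _ _ [x Jx <-] [y Jy <-]; exists (x + y); first exact: JD.
  by rewrite pD //; apply: JT.
- move=> _ _ [x Sx <-] [y Jy <-]; exists (x * y); first exact: JM.
  by rewrite pM; [|apply: ST|apply: JT].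
Qed.

Lemma comap_ideal X : ideal (p @` S) X -> ideal S (comap X) /\ F `<=` comap X.
Proof.
move=> [XS X0 XD XM]; have [FT _ _ _] := idF.
have rpS := image_subring.
have sX : submodule (p @` S) X by [].
have FX : F `<=` comap X.
  by move=> x Fx; have Tx := FT _ Fx; split=> //; rewrite /= (proj2 (p0 Tx) Fx).
split=> //; split; first exact: comap_sub.
- by apply: FX; case: idF.
- by move=> x y [Tx Xx] [Ty Xy]; split; [apply: subringD|rewrite /= pD //; apply: XD].
- move=> x y Sx [Ty Xy]; have Tx := ST Sx; split; first exact: subringM.
  by rewrite /= pM //; apply: XM => //; exists x.
Qed.

Lemma image_prime P : prime_ideal S P -> F `<=` P -> prime_ideal (p @` S) (p @` P).
Proof.
move=> [[idP nP] primeP] FP; have [PS _ _ PM] := idP.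
have EP := comap_image idP FP.
have memP x : S x -> (p @` P) (p x) -> P x.
  by move=> Sx H; rewrite -EP; split=> //; apply: ST.
have idpP := image_ideal idP.
split.
  apply/(proper_ideal1 image_subring idpP); rewrite -p1 => /(memP _ (subring1 rS)).
  by apply/(proper_ideal1 rS idP).
move=> _ _ [x Sx <-] [y Sy <-]; rewrite -pM; [|exact: ST|exact: ST].
move=> /(memP _ (subringM rS Sx Sy)) /(primeP _ _ Sx Sy)[Px|Py].
  by left; exists x.
by right; exists y.
Qed.

Lemma comap_prime X : prime_ideal (p @` S) X -> prime_ideal S (comap X).
Proof.
move=> [[idX nX] primeX]; have [idC FC] := comap_ideal idX.
split.
  apply/(proper_ideal1 rS idC) => -[_]; rewrite /= p1.
  by apply/(proper_ideal1 image_subring idX).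
move=> x y Sx Sy [Txy]; rewrite /= pM; [|exact: ST|exact: ST].
case/primeX; [by exists x|by exists y|left|right]; split=> //; exact: ST.
Qed.

Lemma image_reduced : (forall x n, S x -> F (x ^+ n) -> F x) <-> reduced (p @` S).
Proof.
have pX x n : S x -> p (x ^+ n) = p x ^+ n.
  move=> Sx; elim: n => [|n IH]; first by rewrite !expr0.
  by rewrite !exprS pM ?IH //; apply: ST => //; apply: subringX.
split=> [H|[_ H] x n Sx Fx].
  split; first exact: ideal0 image_subring.
  move=> _ n [x Sx <-]; rewrite /= -pX // => /p0 Fx.
  by apply/p0; [exact: ST|apply: (H x n) => //; apply: Fx; apply: ST; apply: subringX].
apply/p0; first exact: ST.
apply: (H _ n); first by exists x.
by rewrite -pX //; apply/p0 => //; apply: ST; apply: subringX.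
Qed.

Lemma image_artinian :
  dcc (fun J => ideal S J /\ F `<=` J) -> artinian (p @` S).
Proof.
move=> dccS X idX dX.
have [||N HN] := dccS (fun n => comap (X n)).
- by move=> n; apply: comap_ideal.
- by move=> n x [Tx /dX Xx].
by exists N => n /HN E; rewrite -[LHS]image_comap E image_comap.
Qed.

(** The chain of the ideals x^n S is stationary modulo F. *)
Lemma artinian_power x : artinian (p @` S) -> S x ->
  exists n s, S s /\ F (x ^+ n - x ^+ n.+1 * s).
Proof.
move=> art Sx; pose J n := [set x ^+ n * s | s in S].
have SX n := subringX rS n Sx.
have idJ n : ideal S (J n).
  split=> [_ [s Ss <-]||_ _ [s Ss <-] [t St <-]|r _ Sr [s Ss <-]].
  - exact: subringM.
  - by exists 0; [exact: subring0|rewrite mulr0].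
  - by exists (s + t); [exact: subringD|rewrite mulrDr].
  - by exists (r * s); [exact: subringM|rewrite mulrCA].
have [n|n|n /(_ n.+1 (leqnSn n)) E] := art (fun n => p @` J n).
- exact: image_ideal.
- apply: image_subset => _ [s Ss <-]; exists (x * s); first exact: subringM.
  by rewrite exprS; ring.
have : (p @` J n) (p (x ^+ n)).
  by exists (x ^+ n) => //; exists 1; [exact: subring1|rewrite mulr1].
rewrite -E => -[_ [s Ss <-] Es]; exists n, s; split=> //.
by apply: pF => //; apply: ST => //; apply: subringM.
Qed.

End Sub.

Section Unibranched.
Variable S : set A.
Hypotheses (rS : subring S) (ST : S `<=` T) (FS : F `<=` S).

Let TT : T `<=` T. Proof. by []. Qed.
Let FT : F `<=` T. Proof. by case: idF. Qed.

Lemma comap_meet X : comap (X `&` p @` S) = comap X `&` S.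
Proof.
apply/seteqP; split=> [x [Tx [Xx Sx]]|x [[Tx Xx] Sx]].
  by split=> //; apply: (comap_sub rS ST FS (X := p @` S)) => //; split.
by split=> //; split=> //; exists x.
Qed.

Lemma image_unibranched : unibranched S T -> unibranched (p @` S) (p @` T).
Proof.
move=> H X pX; have pP := comap_prime rS ST FS pX.
have [idP FP] := comap_ideal rS ST FS (proj1 (proj1 pX)).
have [Q [[pQ EQ] uQ]] := H _ pP.
have FQ : F `<=` Q by move=> x /FP; rewrite -EQ => -[].
have EQ' := comap_image TT (proj1 (proj1 pQ)) FQ.
exists (p @` Q); split.
  split; first exact: image_prime.
  by rewrite -[LHS]image_comap comap_meet EQ' EQ image_comap.
move=> Y [pY EY]; rewrite (uQ (comap Y)) ?image_comap //; split.
  exact: comap_prime pY.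
by rewrite -comap_meet EY.
Qed.

Lemma unibranched_inj P Q : unibranched (p @` S) (p @` T) ->
  prime_ideal T P -> prime_ideal T Q -> F `<=` P -> F `<=` Q ->
  prime_ideal S (P `&` S) -> P `&` S = Q `&` S -> P = Q.
Proof.
move=> H pP pQ FP FQ pPS E.
have EP := comap_image TT (proj1 (proj1 pP)) FP.
have EQ := comap_image TT (proj1 (proj1 pQ)) FQ.
have FPS : F `<=` P `&` S by move=> x Fx; split; [apply: FP|apply: FS].
have [X [_ uX]] := H _ (image_prime rS ST pPS FPS).
have key Z : prime_ideal T Z -> F `<=` Z -> Z `&` S = P `&` S -> comap (p @` Z) = Z -> X = p @` Z.
  move=> pZ FZ EZ cZ; apply: uX; split; first exact: image_prime.
  by rewrite -[LHS]image_comap comap_meet cZ EZ.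
by rewrite -EP -(key P) // (key Q).
Qed.

End Unibranched.
End QuotientSets.

Section PullbackDCC.
Variable K : fieldType.
Implicit Types (R T I J N : set K) (s : seq (set K)).

(** An ideal J over the meet of s is determined by the listed ideals containing it: some z in J is 1
    modulo all the others, and x (1 - z) is in the meet. *)
Lemma pullback_ideal_mem R T s J x : pullback_of R T s -> ideal R J ->
  (forall y, T y -> (forall N, N \in s -> N y) -> J y) -> R x ->
  (forall N, N \in s -> J `<=` N -> N x) -> J x.
Proof.
move=> cR [JR J0 JD JM] AJ Rx Hx; have rR := pullback_subring cR.
have RT := pullback_sub cR; have dT := pullback_ded cR; have rT : subring T by case: dT.
have R1 z : R z -> R (1 - z) by move=> Rz; apply: subringB => //; apply: subring1.
suff [z Jz Hz] : exists2 z, J z & forall N, N \in s -> J `<=` N \/ N (1 - z).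
  have -> : x = x * (1 - z) + x * z by ring.
  apply: JD; last exact: JM.
  apply: AJ => [|N Ns]; first by apply: RT; apply: subringM => //; apply/R1/JR.
  have [_ _ _ NM] := pullback_ideal cR Ns.
  case: (Hz _ Ns) => [/(Hx _ Ns) Nx|Nz]; last by apply: NM => //; apply: RT.
  by rewrite mulrC; apply: NM => //; apply/RT/R1/JR.
have : {subset s <= s} by [].
elim: {1 3}s => [_|N t IH Hs]; first by exists 0.
have [|z Jz Hz] := IH; first by move=> M Mt; apply: Hs; rewrite inE Mt orbT.
have Ns : N \in s by apply: Hs; rewrite inE eqxx.
have [JN|/existsNP[w /not_implyP[Jw nNw]]] := pselect (J `<=` N).
  by exists z => // M; rewrite inE => /orP[/eqP->|/Hz]; first by left.
have [y Ry Ny] := pullback_inv cR Ns (JR _ Jw) nNw.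
exists (z + (1 - z) * (w * y)).
  by apply: JD => //; apply: (JM); [apply/R1/JR|rewrite mulrC; apply: JM].
have -> : 1 - (z + (1 - z) * (w * y)) = (1 - z) * (1 - w * y) by ring.
have Rwy : R (1 - w * y) by apply: R1; apply: subringM => //; apply: JR.
move=> M Mt; have [_ _ _ MM] := pullback_ideal cR (Hs _ Mt).
move: Mt; rewrite inE => /orP[/eqP EM|/Hz[JM'|Mz]]; [right|by left|right].
  by apply: MM; [apply/RT/R1/JR|rewrite EM].
by rewrite mulrC; apply: MM => //; apply: RT.
Qed.

Lemma pullback_dcc R T s : pullback_of R T s ->
  dcc (fun J => ideal R J /\ forall y, T y -> (forall N, N \in s -> N y) -> J y).
Proof.
move=> cR J idJ dJ.
have mono m n : (m <= n)%N -> J n `<=` J m.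
  elim: n => [|n IH]; first by rewrite leqn0 => /eqP->.
  by rewrite leq_eqVlt => /orP[/eqP->//|/IH sub x /dJ/sub].
suff [n Hn] : exists n, forall N m, N \in s -> J m `<=` N -> J n `<=` N.
  exists n => m nm; apply/seteqP; split; first exact: mono.
  move=> x Jx; have [idJm AJm] := idJ m; have [idJn _] := idJ n.
  apply: (pullback_ideal_mem cR idJm AJm); first by case: idJn => + _ _ _; apply.
  by move=> N Ns /(Hn _ _ Ns); apply.
elim: (s) => [|N t [n Hn]]; first by exists 0%N.
have [k Hk] : exists k, forall m, J m `<=` N -> J k `<=` N.
  have [[m Hm]|nH] := pselect (exists m, J m `<=` N); first by exists m.
  by exists 0%N => m Hm; exfalso; apply: nH; exists m.
exists (maxn n k) => M m; rewrite inE => /orP[/eqP->/Hk|Mt /(Hn _ _ Mt)];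
  by apply: subset_trans; apply: mono; rewrite ?leq_maxr ?leq_maxl.
Qed.

End PullbackDCC.

Section QuotientMap.
Variables (A : comPzRingType) (I : ideal_of A).
Local Notation q := (quotient_map I).

Lemma quotient_map0 : q 0 = 0.
Proof. by apply: (@addrI _ (q 0)); rewrite -quotient_mapD !addr0. Qed.

Lemma quotient_map1 : q 1 = 1.
Proof. by []. Qed.

Lemma quotient_mapB x y : q (x - y) = q x - q y.
Proof. by apply: (@addIr _ (q y)); rewrite -quotient_mapD !subrK. Qed.

Lemma quotient_map_mul x y : q (x * y) = q x * q y.
Proof. exact: quotient_mapM. Qed.

Lemma quotient_map_eq0 x : q x = 0 <-> ideal_set I x.
Proof. by rewrite -quotient_map0 quotient_mapE subr0. Qed.

Lemma quotient_map_surj b : exists x, q x = b.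
Proof. by exists (repr (b : Quotient.quot (ideal_pred I))); apply: reprK. Qed.

End QuotientMap.

Section CicQuotient.
Variable R : idomainType.
Hypothesis not_field : ~ GRing.field_axiom R.

(* [insubd] sends the elements outside R^* to 0. *)
Definition cic_proj (x : {fraction R}) : cic_quotient R :=
  quotient_map (IdealOf (conductor_ideal R)) (insubd (0 : cic_ring R) x).

Let T := cic R.
Let F := conductor R.
Let rT : subring T := cic_subring_set R.
Let rR : subring (dom R) := dom_subring R.

Let valK x : T x -> val (insubd (0 : cic_ring R) x) = x.
Proof. by move=> /cic_predP Tx; rewrite insubdK. Qed.

Let valE z x : T x -> val z = x -> insubd (0 : cic_ring R) x = z.
Proof. by move=> Tx E; apply: val_inj; rewrite valK. Qed.

Let RT : dom R `<=` T.
Proof.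
move=> x Rx; exists 1; split=> // [||n _]; first exact: subring1.
  exact/eqP/oner_neq0.
by rewrite mul1r; apply: subringX.
Qed.

Let FR : F `<=` dom R.
Proof. by move=> x Fx; rewrite -[x]mulr1; apply: Fx; apply: subring1. Qed.

Let idF : ideal T F.
Proof.
have [F0 FD _] := colon_submodule T rR; split=> //; first exact: subset_trans RT.
by move=> t x Tt Fx y Ty; rewrite mulrAC mulrC; apply: Fx; apply: subringM.
Qed.

Let p1 : cic_proj 1 = 1.
Proof. by rewrite /cic_proj (valE (z := 1)) //; apply: subring1. Qed.

Let pB x y : T x -> T y -> cic_proj (x - y) = cic_proj x - cic_proj y.
Proof.
move=> Tx Ty; rewrite /cic_proj -quotient_mapB; congr quotient_map.
by apply: valE; [apply: subringB|rewrite rmorphB /= !valK].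
Qed.

Let pM x y : T x -> T y -> cic_proj (x * y) = cic_proj x * cic_proj y.
Proof.
move=> Tx Ty; rewrite /cic_proj -quotient_map_mul; congr quotient_map.
by apply: valE; [apply: subringM|rewrite rmorphM /= !valK].
Qed.

Let p0 x : T x -> cic_proj x = 0 <-> F x.
Proof. by move=> Tx; rewrite quotient_map_eq0 /= -[cic_val _]/(val _) valK. Qed.

Let p_surj b : exists2 x, T x & cic_proj x = b.
Proof.
have [z <-] := quotient_map_surj b; exists (val z); first exact/cic_predP/valP.
by rewrite /cic_proj (valE (z := z)) //; apply/cic_predP/valP.
Qed.

Let image_dom : cic_proj @` dom R = dom_quotient R.
Proof.
apply/seteqP; split=> [_ [x Rx <-]|_ [z Rz <-]].
  exists (insubd (0 : cic_ring R) x) => //=.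
  by rewrite -[cic_val _]/(val _) valK //; apply: RT.
by exists (val z) => //; rewrite /cic_proj (valE (z := z)) //; apply: RT.
Qed.

Let image_cic : cic_proj @` T = [set: cic_quotient R].
Proof. by apply/seteqP; split=> // b _; have [x Tx <-] := p_surj b; exists x. Qed.

Let FT : F `<=` T := subset_trans FR RT.
Let TT : T `<=` T := fun x Tx => Tx.

Lemma pullback_cic_quotient T' s : pullback_of (dom R) T' s -> dedekind (cic R) /\
       [/\ unibranched (dom_quotient R) [set: cic_quotient R],
           artinian (dom_quotient R), reduced (dom_quotient R),
           artinian [set: cic_quotient R] & reduced [set: cic_quotient R]].
Proof.
move=> cR; have ET : T = T' := pullback_cic cR; rewrite -{T'}ET in cR.
have dT := pullback_ded cR; split; first exact: ded_dedekind.
have AF x : T x -> (forall N, N \in s -> N x) -> F x.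
  move=> Tx Hx t Tt; apply: (pullback_meet cR); first exact: subringM.
  by move=> N Ns; have [_ _ _ NM] := pullback_ideal cR Ns; rewrite mulrC; apply: NM => //; apply: Hx.
have rad x n : T x -> F (x ^+ n) -> F x.
  move=> Tx Fx t Tt; apply: (pullback_mem cR); first exact: subringM.
  move=> N Ns; have [[[NT N0 ND NM] _] _] := pullback_max cR Ns.
  have [Nx|nNx] := pselect (N x).
    by exists 0; [exact: subring0|rewrite subr0 mulrC; apply: NM].
  have nNxn : ~ N (x ^+ n).
    elim: (n) => [|k IH]; first by rewrite expr0; apply: pullback_proper cR _ Ns.
    by rewrite exprS => /(pullback_prime cR Ns Tx (subringX rT _ Tx))[].
  have Txn := subringX rT n Tx.
  have [y Ty Ny] := maximal_inv rT (pullback_max cR Ns) Txn nNxn.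
  exists (x ^+ n * (y * (x * t))); first by apply: Fx; do !apply: subringM.
  have -> : x * t - x ^+ n * (y * (x * t)) = (x * t) * (1 - x ^+ n * y) by ring.
  by apply: NM => //; apply: subringM.
rewrite -image_dom -image_cic; split.
- apply: (image_unibranched (F := F)) => //; exact: pullback_unibranched cR.
- apply: (image_artinian rT idF p1 pB pM p0 p_surj rR RT FR) => J idJ dJ.
  apply: (pullback_dcc cR) => // n; have [idJn FJ] := idJ n; split=> // y Ty Hy.
  by apply: FJ; apply: AF.
- by apply/(image_reduced p1 pB pM p0 rR RT) => x n /RT; apply: rad.
- apply: (image_artinian rT idF p1 pB pM p0 p_surj rT TT FT) => J idJ dJ.
  apply: (pullback_dcc (pullback_top cR)) => // n; have [idJn FJ] := idJ n; split=> // y Ty Hy.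
  by apply: FJ; apply: AF.
- by apply/(image_reduced p1 pB pM p0 rT TT) => x n; apply: rad.
Qed.

Lemma cic_quotient_pullback : dedekind (cic R) ->
  unibranched (dom_quotient R) [set: cic_quotient R] -> artinian (dom_quotient R) ->
  reduced [set: cic_quotient R] -> exists T' s, pullback_of (dom R) T' s.
Proof.
rewrite -image_dom -image_cic => dedT uni art red.
have dT := dedekind_ded dedT.
have rad : forall x n, T x -> F (x ^+ n) -> F x.
  by apply/(image_reduced p1 pB pM p0 rT TT).
have pow x : dom R x -> exists n y, dom R y /\ F (x ^+ n - x ^+ n.+1 * y).
  exact: (artinian_power rT idF pB pM p0 rR RT).
have [r [Rr r0 nur]] := not_field_nonunit not_field.
(* If F were 0, R would be Artinian, and r^n = r^(n+1) y would make r a unit. *)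
have F0 : F <> [set 0].
  move=> EF; have [n [y [Ry]]] := pow r Rr; rewrite EF => /eqP.
  have -> : r ^+ n - r ^+ n.+1 * y = r ^+ n * (1 - r * y) by rewrite exprS; ring.
  rewrite mulf_eq0 expf_eq0 (introF eqP r0) andbF subr_eq0 => /eqP.
  exact: nur.
have [_ Fz _ _] := idF; have [a Fa a0] := set_nz Fz F0.
have pNR N : maximal_ideal T N -> prime_ideal (dom R) (N `&` dom R).
  by move=> mN; apply: (prime_meet rR rT RT); apply: maximal_prime.
exists T; apply: (radical_pullback rR dT RT (conj idF rad) FR Fa a0).
- move=> M N mM mN FM FN E.
  apply: (unibranched_inj rT idF p1 pB pM p0 p_surj rR RT FR uni) => //;
    by [apply: maximal_prime|apply: pNR].
(* x^n (1 - x y) is in F, hence in N, and x^n is not. *)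
- move=> N x mN FN Rx nNx; have [n [y [Ry Fy]]] := pow x Rx.
  exists y => //; have [_ primeN] := maximal_prime rT mN.
  have Tx := RT Rx; have Ty := RT Ry; have T1 := subring1 rT.
  have Txy : T (1 - x * y) by apply: subringB => //; apply: subringM.
  move/FN: Fy; have -> : x ^+ n - x ^+ n.+1 * y = x ^+ n * (1 - x * y) by rewrite exprS; ring.
  case/(primeN _ _ (subringX rT _ Tx) Txy) => // Nxn; exfalso; move: Nxn.
  elim: (n) => [|k IH]; first by rewrite expr0; apply: maximal_ideal1 mN.
  by rewrite exprS => /(primeN _ _ Tx (subringX rT _ Tx))[].
Qed.

End CicQuotient.

(** * Embeddings of Dedekind domains *)

Section DedekindRange.
Variables (T : idomainType) (K : fieldType) (g : {rmorphism T -> K}).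
Hypothesis injg : injective g.
Implicit Types (I J N : set T) (X : set K).

(* The elements of the inverse ideal are written b / c with a common
   denominator c. *)
Definition ded_ring : Prop := forall I, ideal [set: T] I -> I <> [set 0] ->
  exists2 c, c <> 0 & ideal_mul I [set b | forall x, I x -> exists t, b * x = c * t] c.

Lemma range_subring : subring (range g).
Proof.
split; first by exists 1; rewrite ?rmorph1.
- by move=> _ _ [x _ <-] [y _ <-]; exists (x - y); rewrite ?rmorphB.
- by move=> _ _ [x _ <-] [y _ <-]; exists (x * y); rewrite ?rmorphM.
Qed.

Lemma range_ideal I : ideal [set: T] I <-> ideal (range g) (g @` I).
Proof.
split=> [[_ I0 ID IM]|[XR [z Iz gz] XD XM]].
  split.
  - by move=> _ [x _ <-]; exists x.
  - by exists 0; rewrite ?rmorph0.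
  - by move=> _ _ [x Ix <-] [y Iy <-]; exists (x + y); [apply: ID|rewrite rmorphD].
  - by move=> _ _ [x _ <-] [y Iy <-]; exists (x * y); [apply: IM|rewrite rmorphM].
split=> //.
- by rewrite -(_ : z = 0) //; apply: injg; rewrite gz rmorph0.
- move=> x y Ix Iy; have [||w Iw] := XD (g x) (g y); [by exists x|by exists y|].
  by rewrite -rmorphD => /injg <-.
- move=> s x _ Ix; have [||w Iw] := XM (g s) (g x); [by exists s|by exists x|].
  by rewrite -rmorphM => /injg <-.
Qed.

Lemma image_preimage X : X `<=` range g -> g @` (g @^-1` X) = X.
Proof.
move=> XR; apply/seteqP; split=> [_ [x Xx <-]//|x Xx].
by have [t _ E] := XR _ Xx; exists t; rewrite /= ?E.
Qed.

Lemma image_inj x I : (g @` I) (g x) <-> I x.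
Proof. by split=> [[y Iy /injg E]|Ix]; [rewrite -E|exists x]. Qed.

(** As [ded_ring] does not mention g, [ded] passes from one embedding of T into a field to any
    other. *)
Lemma ded_rangeP : ded (range g) <-> ded_ring.
Proof.
split=> [[_ dT] I idI I0|dT].
  have [||c Ic c0] := @set_nz _ (g @` I).
  - by exists 0; rewrite ?rmorph0 //; case: idI.
  - move=> E; apply: I0; apply/seteqP; split=> [x Ix|_ ->]; last by case: idI.
    apply: injg; rewrite rmorph0; suff : [set 0] (g x) by [].
    by rewrite -E; exists x.
  have [x0 Ix0 Ec] := Ic; rewrite -{c Ic}Ec in c0.
  exists x0; first by move=> E; apply: c0; rewrite E rmorph0.
  have inv : invertible (range g) (g @` I).
    by apply: dT; [apply/range_ideal|apply: (nz_set (x := g x0))]; rewrite ?image_inj.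
  set B := [set b | _].
  have : exists2 w, ideal_mul I B w & g w = 1 * g x0.
    apply: (ideal_mul_ind (X := [set z | exists2 w, ideal_mul I B w & g w = z * g x0])) inv => /=.
    - by exists 0; [exact: ideal_mul0|rewrite rmorph0 mul0r].
    - move=> y z [w Hw Ew] [v Hv Ev]; exists (w + v); first exact: ideal_mulD.
      by rewrite rmorphD Ew Ev mulrDl.
    - move=> _ b [a Ia <-] Hb; have [|t _ Et] := Hb (g x0); first by exists x0.
      exists (a * t); last by rewrite rmorphM Et mulrA.
      apply: ideal_mul_in => // x Ix; have [|v _ Ev] := Hb (g x); first by exists x.
      by exists v; apply: injg; rewrite !rmorphM Et Ev; ring.
  by case=> w Hw; rewrite mul1r => /injg <-.
split; first exact: range_subring.
move=> J idJ J0; have [JR _ _ _] := idJ; have EJ := image_preimage JR.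
set I := g @^-1` J in EJ.
have idI : ideal [set: T] I by apply/range_ideal; rewrite EJ.
have [|c c0] := dT I idI.
  by move=> E; apply: J0; rewrite -EJ E image_set1 rmorph0.
have gc0 : g c != 0 by apply/eqP => E; apply: c0; apply: injg; rewrite E rmorph0.
suff /[apply] : ideal_mul I [set b | forall x, I x -> exists t, b * x = c * t] `<=`
    [set z | ideal_mul J (colon (range g) J) (g z / g c)] by rewrite /= mulfV.
apply: ideal_mul_ind => /= [|y z Hy Hz|a b Ia Hb].
- by rewrite rmorph0 mul0r; apply: ideal_mul0.
- by rewrite rmorphD mulrDl; apply: ideal_mulD.
- rewrite rmorphM -mulrA; apply: ideal_mul_in => // x Jx.
  have [t _ Et] := JR _ Jx; have [|v Ev] := Hb t; first by rewrite /I /= Et.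
  by exists v => //; rewrite -Et mulrAC -rmorphM Ev rmorphM mulrC mulrA mulVf ?mul1r.
Qed.

Lemma range_maximal N : maximal_ideal [set: T] N <-> maximal_ideal (range g) (g @` N).
Proof.
have rS := range_subring; have rT : subring [set: T] by [].
split=> mN.
  have [[idN _] _] := mN; apply: maximalP => //; first exact/range_ideal.
    rewrite -(rmorph1 g) => /image_inj; exact: maximal_ideal1 mN.
  move=> _ [x _ <-] nNx; have [|y _ Ny] := maximal_inv rT mN (I : [set: T] x).
    by move=> Nx; apply: nNx; exists x.
  by exists (g y); [exists y|rewrite -rmorphM -(rmorph1 g) -rmorphB; apply/image_inj].
have [[/range_ideal idN _] _] := mN; apply: maximalP => //.
  by move=> N1; apply: (maximal_ideal1 rS mN); exists 1; rewrite ?rmorph1.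
move=> x _ nNx; have [||_ [y _ <-]] := maximal_inv rS mN (x := g x); first by exists x.
  by move/image_inj.
by rewrite -rmorphM -(rmorph1 g) -rmorphB => /image_inj Ny; exists y.
Qed.

End DedekindRange.

Lemma dedekind_pullback_of (R : idomainType) : ~ GRing.field_axiom R -> dedekind_pullback R ->
  exists T s, pullback_of (dom R) T s.
Proof.
move=> not_field [T [n [N [k [f /= [[n0 dedT] mN distN subk [injf rf]]]]]]].
pose q i : T -> quotient_ring (N i) := quotient_map (N i).
have rT : subring [set: T] by [].
have rfP t : range f t <-> forall i, k i (q i t) by rewrite rf.
have kf r : forall i, k i (q i (f r)) by apply/rfP; exists r.
have k0 i : k i 0 by apply: subring0; case: (subk i).
have qE i x : q i x = 0 <-> (N i : set T) x by apply: quotient_map_eq0.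
have N1 i : ~ (N i : set T) 1 := maximal_ideal1 rT (mN i).
have kinv i x : ~ (N i : set T) x -> k i (q i x) -> exists t, k i (q i t) /\ (N i : set T) (1 - x * t).
  move=> nx kx; have [|y ky E] := (proj2 (subk i)) _ kx; first by move/qE.
  have [t Et] := quotient_map_surj y; exists t; split; first by rewrite /q Et.
  apply/qE; rewrite /q quotient_mapB quotient_map_mul quotient_map1 Et.
  by move: E; rewrite /q => ->; rewrite subrr.
(* If N i were 0, T would be a field and N i the only listed ideal, so R would be isomorphic to k i,
   a field. *)
have Nnz i : (N i : set T) <> [set 0].
  move=> Ni0; apply: not_field => r r0; apply/unitrP.
  have fr0 : ~ (N i : set T) (f r).
    by rewrite Ni0 => /= E; move/eqP: r0; apply; apply: injf; rewrite E rmorph0.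
  have [t [kt Nt]] := kinv i (f r) fr0 (kf r i).
  have [y _ Ey] : range f t.
    apply/rfP => j; have [->//|ij] := pselect (j = i).
    exfalso; apply: (distN i j) => [E|]; first exact: ij.
    have [[idj _] _] := mN j; symmetry; apply: (maximal_eq rT (mN i) idj (N1 j)).
    by rewrite Ni0 => _ ->; case: idj.
  exists y; suff E : r * y = 1 by rewrite [y * r]mulrC.
  apply: injf; rewrite rmorphM rmorph1 Ey; move: Nt; rewrite Ni0 => /= /eqP.
  by rewrite subr_eq0 => /eqP.
have [a [a0 Na]] : exists a, a != 0 /\ forall i, (N i : set T) a.
  suff [a [a0 Na]] : exists a, a != 0 /\ forall i, i \in enum 'I_n -> (N i : set T) a.
    by exists a; split=> // i; apply: Na; rewrite mem_enum.
  elim: (enum 'I_n) => [|i s [a [a0 Ha]]]; first by exists 1; rewrite oner_neq0.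
  have [[[_ Nz _ NM] _] _] := mN i.
  have [b Nb b0] : exists2 b, (N i : set T) b & b <> 0.
    apply: contrapT => H; apply: (Nnz i); apply/seteqP; split=> [b Nb|_ -> //].
    by apply: contrapT => b0; apply: H; exists b.
  exists (a * b); split; first by rewrite mulf_neq0 //; apply/eqP.
  move=> j; rewrite inE => /orP[/eqP->|js]; first exact: NM.
  by have [[[_ _ _ NjM] _] _] := mN j; rewrite mulrC; apply: NjM => //; apply: Ha.
have aT t : exists r, f r = t * a.
  have [r _ Er] : range f (t * a); last by exists r.
  apply/rfP => i; have -> : q i (t * a) = 0; last exact: k0.
  by apply/qE; have [[[_ _ _ NM] _] _] := mN i; apply: NM.
(* T embeds into the quotient field of R by t |-> (t a) / a. *)
pose h t := sval (cid (aT t)); have hE t : f (h t) = t * a by rewrite /h; case: cid.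
pose a1 := h 1; have fa1 : f a1 = a by rewrite hE mul1r.
have a10 : tofrac a1 != 0.
  by rewrite tofrac_eq0; apply/eqP => E; move/eqP: a0; apply; rewrite -fa1 E rmorph0.
pose g t := tofrac (h t) / tofrac a1.
have gB : zmod_morphism g.
  move=> x y; rewrite /g -mulrBl -rmorphB; congr (tofrac _ / _).
  by apply: injf; rewrite rmorphB !hE mulrBl.
have gM : monoid_morphism g.
  split=> [|x y]; first by rewrite /g mulfV.
  have E : h (x * y) * a1 = h x * h y.
    by apply: injf; rewrite !rmorphM !hE; ring.
  apply: (mulIf a10); rewrite /g divfK //.
  have -> : tofrac (h x) / tofrac a1 * (tofrac (h y) / tofrac a1) * tofrac a1 =
    tofrac (h x) * tofrac (h y) / tofrac a1 by field.
  by rewrite -rmorphM -E rmorphM mulfK.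
pose G : {rmorphism T -> {fraction R}} := HB.pack g
  (GRing.isZmodMorphism.Build T {fraction R} g gB)
  (GRing.isMonoidMorphism.Build T {fraction R} g gM).
have injG : injective G.
  move=> x y /(mulIf (invr_neq0 a10)) /eqP; rewrite tofrac_eq => /eqP E.
  by apply: (mulIf a0); rewrite -!hE E.
have Gf r : G (f r) = tofrac r.
  rewrite /= /g; apply: (mulIf a10); rewrite divfK // -rmorphM; congr tofrac.
  by apply: injf; rewrite hE rmorphM fa1.
have rTx : dom R `<=` range G by move=> _ [r _ <-]; exists (f r); rewrite ?Gf.
have dG : ded (range G).
  apply/(ded_rangeP injG)/(ded_rangeP (g := @tofrac T)); last exact: dedekind_ded.
  by move=> x y /eqP; rewrite tofrac_eq => /eqP.
pose s := [seq G @` (N i : set T) | i <- enum 'I_n].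
have sP X : X \in s -> exists i, X = G @` (N i : set T).
  by case/mapP => i _ ->; exists i.
exists (range G), s; split => //.
- exact: dom_subring.
- by move=> _ /sP[i ->]; apply/(range_maximal injG).
- move=> _ /sP[i ->] E; apply: (Nnz i); apply/seteqP; split=> [x Nx|_ ->].
    by apply: injG; rewrite rmorph0; suff : [set 0] (G x) by []; rewrite -E; exists x.
  by have [[[]]] := mN i.
- move=> _ [t _ <-] Ht; have [r _ <-] : range f t; last by exists r.
  apply/rfP => i; have [|_ [r _ <-]] := Ht (G @` (N i : set T)).
    by apply/mapP; exists i; rewrite // mem_enum.
  rewrite -Gf -rmorphB => /(image_inj injG)/quotient_mapE.
  by rewrite -[quotient_map _ t]/(q i t) => ->; apply: kf.
- move=> _ _ /sP[i ->] [r _ <-]; rewrite -Gf => /(image_inj injG) nN.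
  have [t [kt Nt]] := kinv i (f r) nN (kf r i).
  have [|||e [_ Ne He]] := @max_avoid _ _ rT (N i) [seq (N j : set T) | j <- enum 'I_n & j != i].
  + exact: mN.
  + by move=> _ /mapP[j _ ->].
  + apply/negP => /mapP[j]; rewrite mem_filter => /andP[/eqP ji _] E.
    by apply: (distN i j) => //; apply: nesym.
  have [y _ Ey] : range f (e * t).
    apply/rfP => j; have [->|/eqP ji] := pselect (j = i).
      have -> : q i (e * t) = q i t; last by [].
      apply/quotient_mapE; have [[idi _] _] := mN i; have [_ _ _ NM] := idi.
      have -> : e * t - t = (- t) * (1 - e) by ring.
      exact: NM.
    have -> : q j (e * t) = 0; last exact: k0.
    apply/qE; have [[[_ _ _ NM] _] _] := mN j; rewrite mulrC; apply: NM => //.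
    by apply: He; apply/mapP; exists j; rewrite // mem_filter ji mem_enum.
  exists (tofrac y); first by exists y.
  rewrite -(Gf y) -rmorphM -(rmorph1 G) -rmorphB; apply/(image_inj injG).
  have [[[_ _ ND NM] _] _] := mN i; rewrite Ey.
  have -> : 1 - f r * (e * t) = (1 - e) + e * (1 - f r * t) by ring.
  by apply: ND => //; apply: NM.
Qed.

Section CicDomain.
Variable R : idomainType.

(** An alias of [cic_ring] that carries the structure required of T in [dedekind_pullback]. *)
Definition cic_domain : Type := cic_ring R.
HB.instance Definition _ := GRing.ComNzRing.copy cic_domain (cic_ring R).

Let cic_unit : {pred cic_domain} := fun x => `[< exists y, y * x = 1 >].
Let cic_inv (x : cic_domain) : cic_domain :=
  if pselect (exists y, y * x = 1) is left h then sval (cid h) else x.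

Let cic_mulVx : {in cic_unit, left_inverse 1 cic_inv *%R}.
Proof. by move=> x /asboolP ux; rewrite /cic_inv; case: pselect => // h; case: cid. Qed.

Let cic_unitPl (x y : cic_domain) : y * x = 1 -> cic_unit x.
Proof. by move=> E; apply/asboolP; exists y. Qed.

Let cic_invr_out : {in [predC cic_unit], cic_inv =1 id}.
Proof. by move=> x /asboolPn nu; rewrite /cic_inv; case: pselect. Qed.

HB.instance Definition _ := GRing.ComNzRing_hasMulInverse.Build cic_domain
  cic_mulVx cic_unitPl cic_invr_out.

Let cic_integral : GRing.integral_domain_axiom cic_domain.
Proof.
move=> x y /(congr1 val) /eqP.
by rewrite rmorphM rmorph0 mulf_eq0 -!(inj_eq val_inj) rmorph0.
Qed.

HB.instance Definition _ := GRing.ComUnitRing_isIntegral.Build cic_domain cic_integral.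

Definition cic_domain_val : {rmorphism cic_domain -> {fraction R}} :=
  (val : {rmorphism cic_ring R -> {fraction R}}).
End CicDomain.

Section DedekindPullback.
Variable R : idomainType.
Hypothesis not_field : ~ GRing.field_axiom R.

Lemma pullback_dedekind_pullback T s : pullback_of (dom R) T s -> dedekind_pullback R.
Proof.
move=> cR; have ET := pullback_cic cR; rewrite -{T}ET -/(cic R) in cR.
have rR := dom_subring R; have RT := pullback_sub cR; have dT := pullback_ded cR.
have rT : subring (cic R) by case: dT.
(* The list must be nonempty and free of repetitions. As R is not a field, a nonzero nonunit lies in
   a nonzero maximal ideal of T, which is adjoined. *)
have [s' {}cR [us' s0]] : exists2 s', pullback_of (dom R) (cic R) s' & uniq s' /\ (0 < size s')%N.
  have [r [Rr r0 nur]] := not_field_nonunit not_field.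
  have idr : ideal (dom R) (ideal_gen (dom R) [set 0] r).
    by apply: ideal_gen_ideal => //; apply: ideal0.
  have [||N [mN N0 _]] := pullback_lying_over cR idr (x := r) _ _ r0.
  - by case=> _ -> [y Ry]; rewrite add0r mulrC; apply: nur.
  - exact: ideal_gen_mem.
  have [t [? ? ? tm tn tc ti] Nt] := pullback_extend cR mN N0.
  exists (undup t); last first.
    by rewrite undup_uniq; split=> //; move: Nt; rewrite -mem_undup; case: (undup t).
  split=> //.
  - by move=> M; rewrite mem_undup; apply: tm.
  - by move=> M; rewrite mem_undup; apply: tn.
  - by move=> x Tx H; apply: tc => // M Mt; apply: H; rewrite mem_undup.
  - by move=> M x; rewrite mem_undup; apply: ti.
pose v := cic_domain_val R; have injv : injective v := val_inj.
have rv : range v = cic R.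
  apply/seteqP; split=> [_ [z _ <-]|x /cic_predP Tx]; first exact/cic_predP/valP.
  by exists (CicRing Tx).
have rD : subring [set: cic_domain R] by [].
pose n := size s'; pose Ns (i : 'I_n) := nth set0 s' i.
have Nss i : Ns i \in s' by apply: mem_nth.
have vN i : v @` (v @^-1` Ns i) = Ns i.
  by apply: image_preimage; rewrite rv; case: (pullback_ideal cR (Nss i)).
have mN i : maximal_ideal [set: cic_domain R] (v @^-1` Ns i).
  by apply/(range_maximal injv); rewrite vN rv; apply: (pullback_max cR).
have idN i : ideal [set: cic_domain R] (v @^-1` Ns i) by case: (mN i) => -[].
pose N i := IdealOf (idN i).
pose q i := quotient_map (N i).
pose S := v @^-1` dom R.
have fP r : tofrac r \in @cic_pred R by apply/cic_predP/RT; exists r.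
pose f r : cic_domain R := CicRing (fP r).
have vf r : v (f r) = tofrac r by [].
have fB : zmod_morphism f.
  by move=> x y; apply: injv; rewrite rmorphB !vf rmorphB.
have fM : monoid_morphism f.
  split=> [|x y]; apply: injv; first by rewrite vf !rmorph1.
  by rewrite rmorphM !vf rmorphM.
pose F : {rmorphism R -> cic_domain R} := HB.pack f
  (GRing.isZmodMorphism.Build R (cic_domain R) f fB)
  (GRing.isMonoidMorphism.Build R (cic_domain R) f fM).
exists (cic_domain R), n, N, (fun i => q i @` S), F; split.
- split=> //; apply: ded_dedekind; apply/ded_rangeP.
    by move=> x y /eqP; rewrite tofrac_eq => /eqP.
  by apply/(ded_rangeP injv); rewrite rv.
- exact: mN.
- move=> i j ij E; apply: ij; apply: val_inj; apply/eqP.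
  rewrite -(nth_uniq set0 (ltn_ord i) (ltn_ord j) us'); apply/eqP.
  by rewrite -/(Ns i) -/(Ns j) -vN -[RHS]vN; congr (_ @` _).
- move=> i; split.
    split; first by exists 1 => //; rewrite /S /preimage /mkset rmorph1; apply: subring1.
    + move=> _ _ [x Sx <-] [y Sy <-]; exists (x - y); last exact: quotient_mapB.
      by rewrite /S /preimage /mkset rmorphB; apply: subringB.
    + move=> _ _ [x Sx <-] [y Sy <-]; exists (x * y); last exact: quotient_map_mul.
      by rewrite /S /preimage /mkset rmorphM; apply: subringM.
  move=> _ [x Sx <-] qx0.
  have [||y [r _ Er] Ny] := pullback_inv cR (Nss i) (x := v x) => //.
    by move=> Nx; apply: qx0; apply/quotient_map_eq0.
  exists (q i (F r)); first by exists (F r) => //; exists r.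
  rewrite -quotient_map_mul -quotient_map1; apply/quotient_mapE.
  change (Ns i (v (x * F r - 1))); rewrite rmorphB rmorphM rmorph1 -[v x * v (F r) - 1]opprB vf Er.
  by apply: (submoduleN rT) => //; apply/ideal_submodule/(pullback_ideal cR (Nss i)).
- split.
    move=> x y E; have /eqP : v (F x) = v (F y) by rewrite E.
    by rewrite !vf tofrac_eq => /eqP.
  apply/seteqP; split=> [_ [r _ <-] i|t Ht]; first by exists (F r) => //; exists r.
  have [r _ Er] : dom R (v t).
    apply: (pullback_mem cR); first by rewrite -rv; exists t.
    move=> M Ms; have iM : (index M s' < n)%N by rewrite index_mem.
    have [x Sx /quotient_mapE Ex] := Ht (Ordinal iM).
    exists (v x) => //; rewrite -opprB -rmorphB.
    apply: (submoduleN rT); first exact/ideal_submodule/(pullback_ideal cR Ms).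
    by have <- : Ns (Ordinal iM) = M by rewrite /Ns /= nth_index.
  by exists r => //; apply: injv.
Qed.

End DedekindPullback.

Theorem theorem28 (R : idomainType) (not_field : ~ GRing.field_axiom R) :
  [<-> TAF (dom R) /\ conductor R <> [set 0];
       mori (dom R) /\ gpvd (dom R);
       dedekind_pullback R;
       dedekind (cic R) /\
       [/\ unibranched (dom_quotient R) [set: cic_quotient R],
           artinian (dom_quotient R), reduced (dom_quotient R),
           artinian [set: cic_quotient R] & reduced [set: cic_quotient R]]].
Proof.
tfae.
- case=> tafR F0; have [r [Rr r0 nur]] := not_field_nonunit not_field.
  have [s cR] := taf_pullback (dom_subring R) tafR Rr r0 nur (@fraction_eq R) (cic_subring_set R) F0.
  by split; [exact: pullback_mori cR|exact: pullback_gpvd cR].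
- case=> mR gR; have [T [s cR]] := mori_gpvd_pullback (dom_subring R) mR gR.
  exact: pullback_dedekind_pullback cR.
- move=> /(dedekind_pullback_of not_field)[T [s cR]]; exact: pullback_cic_quotient cR.
- case=> dT [uni art _ _ red].
  have [T [s cR]] := cic_quotient_pullback not_field dT uni art red.
  split; first exact: pullback_TAF cR.
  by rewrite /conductor /cic (pullback_cic cR); apply: pullback_conductor cR.
Qed.
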